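(* For every integer $d\ge 3$ there exist $a_d\in(1,2)$, an integer $k\in[0,\lceil d/2\rceil-1]$ and a family $\{H_{d,a}\}_{a\in(1,a_d)}$ of piecewise $C^\infty$ maps of $S_d$ into itself such that, for every $a\in(1,a_d)$: (1) $H_{d,a}$ commutes with the inversion symmetry $\sigma_d$. (2) $H_{d,a}$ coincides with $G_{d,\epsilon_a}$ on $\bigcup_{j=0}^d A_j$, where $\epsilon_a=1-\frac a2\in(0,\frac12)$ (so that $2(1-\epsilon_a)=a$). (3) $H_{d,a}$ has an acim whose support is included in $\overline{A_k\cup B_k}$ (and, by symmetry, it also has a disjointly supported acim whose support is included in $\overline{A_{d-k}\cup B_{d-k}}$). (4) The support of the acim in $\overline{A_k\cup B_k}$ is actually included in some AsIUP $U$ of $H_{d,a}$ (with respect to $\sigma_d$) with $U\subset\overline{A_k\cup B_k}$. Moreover, the restriction $H_{d,a}|_{U\cap B_k}$ is an affine map; the fixed point of this affine map belongs to $B_k$; and there exists a (not necessarily normed nor orthogonal) basis $\{e_n\}_{n=1}^d$ of $\mathbb{R}^d$ such that the linear part $L$ of $H_{d,a}|_{U\cap B_k}$ satisfies $$Le_n=\frac{a|e_n|}{|e_{n+1}|}\,e_{n+1},\qquad \forall n\in[1,d],$$ where the index $d+1$ is identified with $1$.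
   Context: Notation. For integers $m\le n$, $[m,n]$ denotes the set of integers from $m$ to $n$ when used for indices. $|\cdot|$ is the Euclidean norm, $\overline{X}$ is the closure of $X$ in $\mathbb{R}^d$, $\delta_{i,j}$ is the Kronecker symbol. ''acim'' means absolutely continuous (with respect to Lebesgue measure) invariant probability measure. The simplex and its symmetry. $S_d=\{x\in\mathbb{R}^d: x_i>0\ \forall i,\ x_1+\cdots+x_d<1\}$. The inversion symmetry $\sigma_d:S_d\to S_d$ is $(\sigma_d x)_i=x_{d-i}$ for $i\in[1,d-1]$ and $(\sigma_d x)_d=1-(x_1+\cdots+x_d)$. Subsets of $S_d$. $A_0=\{x\in S_d: x_1+\cdots+x_d<\frac12\}$ and $A_k=\{x\in S_d: x_k>\frac12\}$ for $k\in[1,d]$. Also $B_0=\{x\in S_d: x_1+\cdots+x_{d-1}<\frac12,\ x_2+\cdots+x_d<\frac12,\ x_1+\cdots+x_d>\frac12\}$, $B_1=\{x\in S_d: x_1<\frac12,\ x_2+\cdots+x_d<\frac12,\ x_1+x_2>\frac12\}$, $B_k=\{x\in S_d: x_k<\frac12,\ x_{k-1}+x_k>\frac12,\ x_k+x_{k+1}>\frac12\}$ for $k\in[2,d-1]$, $B_d=\{x\in S_d: x_1+\cdots+x_{d-1}<\frac12,\ x_d<\frac12,\ x_{d-1}+x_d>\frac12\}$. The map $G_{d,\epsilon}$ ($\epsilon\in(0,\frac12)$). Let $N=d+1$ and $g(t)=t-\lfloor t+\frac12\rfloor$. Given $x\in S_d$, choose $u\in\mathbb{R}^N$ with $u_{i+1}-u_i=x_i$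 for $i\in[1,d]$, and let $w_i=2\left(u_i+\frac{\epsilon}{N}\sum_{j=1}^N g(u_j-u_i)\right)$ for $i\in[1,N]$. Suppose no difference $u_j-u_i$ equals $\frac12$ modulo 1 and no difference $w_i-w_j$ ($i\ne j$) is an integer (this holds for Lebesgue-a.e. $x$, and for all $x\in\bigcup_j A_j$). Let $z_i=w_i+\lfloor w_N-w_i\rfloor-\lfloor w_N\rfloor$ for $i\in[1,N]$, so that $0<z_N-z_i<1$ for $i<N$, and let $y_1<\cdots<y_{N-1}<y_N=z_N$ be obtained by putting $z_1,\dots,z_{N-1}$ in increasing order. Then $(G_{d,\epsilon}x)_i=y_{i+1}-y_i$ for $i\in[1,d]$; this is an element of $S_d$ that depends only on $x$. Piecewise maps. A map $H$ of $S_d$ is piecewise affine (resp. piecewise $C^\infty$) if there is a finite collection $\{A_\omega\}$ of open, convex, pairwise disjoint polytopes in $S_d$ (an atomic collection, whose elements are called atoms) with $S_d\setminus\bigcup_\omega A_\omega$ of zero Lebesgue measure, such that each $H|_{A_\omega}$ is affine (resp. $C^\infty$) and $H(A_\omega)\subset S_d$. IUP and AsIUP. A finite union $U=\bigcup_j U_j$ of (full-dimensional) polytopes is an invariant union of polytopes (IUP) of $H$ if there is an atomic collection $\{A_\omega\}$ of $H$ with $H\left(\bigcup_{j,\omega}U_j\cap A_\omega\right)\subset\bigcup_j U_j$. It is an asymmetric IUP (AsIUP) with respect to $\sigma_d$ if moreover $U\cap\sigma_d(U)=\emptyset$. *)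

(* Defs.v *)
From HB Require Import structures.
From mathcomp Require Import all_boot all_order all_algebra.
From mathcomp Require Import all_classical all_reals all_analysis.
From mathcomp Require Import ring.

Set Implicit Arguments.
Unset Strict Implicit.
Unset Printing Implicit Defensive.

Import Order.TTheory GRing.Theory Num.Theory.
Import numFieldNormedType.Exports.

Local Open Scope classical_set_scope.
Local Open Scope ring_scope.

Section Simplex.
Context {R : realType} {d : nat}.
Local Notation V := 'rV[R]_d.
Implicit Types x : V.

(* The coordinate x_i with i in [1, d] (and 0 for any other index). *)
Definition co x (i : nat) : R := \sum_(j < d | j.+1 == i :> nat) x 0 j.

(* x_m + ... + x_n *)
Definition cosum x (m n : nat) : R := \sum_(m <= i < n.+1) co x i.

Definition Sd : set V :=
  [set x : V | (forall i : 'I_d, 0 < x 0 i) /\ cosum x 1 d < 1].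

(* The affine formula is used on the whole of R^d. *)
Definition sigma x : V :=
  \row_(j < d) (if j.+1 == d then 1 - cosum x 1 d else co x (d - j.+1)).

Definition Aset (k : nat) : set V :=
  [set x : V | Sd x /\ (if k == 0%N then cosum x 1 d < 2^-1 else 2^-1 < co x k)].

Definition Bset (k : nat) : set V :=
  [set x : V | Sd x /\
    (if k == 0%N then
       [/\ cosum x 1 d.-1 < 2^-1, cosum x 2 d < 2^-1 & 2^-1 < cosum x 1 d]
     else if k == 1%N then
       [/\ co x 1 < 2^-1, cosum x 2 d < 2^-1 & 2^-1 < co x 1 + co x 2]
     else if k == d then
       [/\ cosum x 1 d.-1 < 2^-1, co x d < 2^-1 & 2^-1 < co x d.-1 + co x d]
     else
       [/\ co x k < 2^-1, 2^-1 < co x k.-1 + co x k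
         & 2^-1 < co x k + co x k.+1])].

(* mathcomp-analysis' norm on row vectors is the sup norm. *)
Definition enorm x : R := Num.sqrt (\sum_i x 0 i ^+ 2).

End Simplex.

Section TheMapG.
Context {R : realType} {d : nat}.
Local Notation V := 'rV[R]_d.
Implicit Types (u : 'I_d.+1 -> R) (x y : V).

Definition gfun (t : R) : R := t - (Num.floor (t + 2^-1))%:~R.

Definition is_lift x u : Prop :=
  forall i : 'I_d, u (lift ord0 i) - u (widen_ord (leqnSn d) i) = x 0 i.

Definition wG (eps : R) u (i : 'I_d.+1) : R :=
  2 * (u i + eps / d.+1%:R * \sum_(j < d.+1) gfun (u j - u i)).

Definition zG (eps : R) u (i : 'I_d.+1) : R :=
  let w := wG eps u in
  w i + (Num.floor (w ord_max - w i))%:~R - (Num.floor (w ord_max))%:~R.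

Definition yG (eps : R) u : seq R :=
  rcons (sort <=%R [seq zG eps u (widen_ord (leqnSn d) i) | i <- enum 'I_d])
        (zG eps u ord_max).

Definition G_of_lift (eps : R) u : V :=
  \row_(i < d) ((yG eps u)`_i.+1 - (yG eps u)`_i).

Definition nondegenerate (eps : R) u : Prop :=
  (forall i j, u j - u i - 2^-1 \isn't a Num.int) /\
  (forall i j, i != j -> wG eps u i - wG eps u j \isn't a Num.int).

(* The graph of the partially defined map G_{d,eps}; by [G_graph_functional]
   the choice of u is immaterial. *)
Definition G_graph (eps : R) x y : Prop :=
  Sd x /\ exists u, [/\ is_lift x u, nondegenerate eps u
                      & y = G_of_lift eps u].

Lemma lift_translate x u u' : is_lift x u -> is_lift x u' ->
  forall i, u' i = u i + (u' ord0 - u ord0).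
Proof.
move=> hu hu' [i hi]; elim: i hi => [|i IH] hi.
  by rewrite (_ : Ordinal hi = ord0) ?subrKC //; exact: val_inj.
have hi' : (i < d)%N by [].
have := hu (Ordinal hi'); rewrite -(hu' (Ordinal hi')).
rewrite (_ : lift ord0 _ = Ordinal hi); last exact: val_inj.
rewrite (_ : widen_ord _ _ = Ordinal (leqW hi')); last exact: val_inj.
by rewrite (IH (leqW hi')) => /eqP; rewrite subr_eq => /eqP ->; ring.
Qed.

Lemma G_graph_functional eps x y y' :
  G_graph eps x y -> G_graph eps x y' -> y = y'.
Proof.
move=> [_ [u [hu _ ->]]] [_ [u' [hu' _ ->]]].
have [c hc] : exists c, forall i, u' i = u i + c.
  by exists (u' ord0 - u ord0); exact: lift_translate hu hu'.
have hw i : wG eps u' i = wG eps u i + 2 * c.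
  rewrite /wG hc (eq_bigr (fun j => gfun (u j - u i))) => [|j _].
    by rewrite -mulrDr addrAC.
  by rewrite !hc; congr gfun; ring.
have [e he] : exists e, forall i, zG eps u' i = zG eps u i + e.
  exists (2 * c + (Num.floor (wG eps u ord_max))%:~R
          - (Num.floor (wG eps u ord_max + 2 * c))%:~R) => i.
  rewrite /zG /= !hw.
  rewrite (_ : _ + 2 * c - (wG eps u i + 2 * c) =
    wG eps u ord_max - wG eps u i); last by ring.
  by ring.
have hy : yG eps u' = [seq t + e | t <- yG eps u].
  rewrite /yG map_rcons he; congr rcons.
  rewrite (@map_sort _ _ _ <=%R <=%R); last by move=> s t; rewrite lerD2r.
  by rewrite -[in RHS]map_comp; apply: f_equal; apply: eq_map => i /=.
have sy : size (yG eps u) = d.+1.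
  by rewrite size_rcons size_sort size_map size_enum_ord.
apply/rowP => i; rewrite !mxE hy.
rewrite !(nth_map 0) ?sy ?ltnS ?(ltnW (ltn_ord i)) //.
by ring.
Qed.

End TheMapG.

Section LebesgueBorel.
Context {R : realType} {d : nat}.
Local Notation V := 'rV[R]_d.

Definition box (lo hi : V) : set V :=
  [set x : V | forall i, lo 0 i <= x 0 i <= hi 0 i].

(* Lebesgue (outer) measure on R^d. *)
Definition lebesgue (A : set V) : \bar R :=
  ereal_inf [set s | exists lo hi : nat -> V,
    [/\ forall n i, lo n 0 i <= hi n 0 i,
        A `<=` \bigcup_n box (lo n) (hi n)
      & s = (\sum_(0 <= n <oo) (\prod_i (hi n 0 i - lo n 0 i))%:E)%E]].

End LebesgueBorel.

(* R^d with its Borel sigma-algebra. *)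
Definition borel (R : realType) (d : nat) :=
  g_sigma_algebraType [set A : set 'rV[R]_d | open A].

Section Measures.
Context {R : realType} {d : nat}.
Local Notation V := 'rV[R]_d.

Definition msupport (mu : probability (borel R d) R) : set V :=
  [set x : V | forall O : set V, open O -> O x -> (0 < mu O)%E].

Definition is_acim (H : V -> V) (mu : probability (borel R d) R) : Prop :=
  [/\ measurable_fun (Sd : set (borel R d)) (H : borel R d -> borel R d),
      mu Sd = 1%E,
      mu `<< (lebesgue : set (borel R d) -> \bar R)
    & forall E : set (borel R d), measurable E ->
        mu (Sd `&` (H @^-1` E)) = mu E].

End Measures.

Section Piecewise.
Context {R : realType} {d : nat}.
Local Notation V := 'rV[R]_d.

(* Compact convex polytopes with nonempty interior. *)
Definition polytope (P : set V) : Prop :=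
  [/\ exists (m : nat) (M : 'M[R]_(m, d)) (b : 'cV[R]_m),
        P = [set x : V | forall i, (M *m x^T) i 0 <= b i 0],
      bounded_set P & interior P !=set0].

Definition open_polytope (P : set V) : Prop :=
  (exists (m : nat) (M : 'M[R]_(m, d)) (b : 'cV[R]_m),
     P = [set x : V | forall i, (M *m x^T) i 0 < b i 0]) /\ bounded_set P.

(* f is C^n on the open set A. *)
Fixpoint Cn_on (n : nat) (A : set V) (f : V -> V) : Prop :=
  (forall x, A x -> {for x, continuous f}) /\
  (if n is n'.+1 then
     forall i : 'I_d, (forall x, A x -> derivable f x (delta_mx 0 i)) /\
                      Cn_on n' A ('D_(delta_mx 0 i) f)
   else True).

Definition smooth_on (A : set V) (f : V -> V) : Prop :=
  forall n, Cn_on n A f.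

Definition atomic_collection (H : V -> V) (m : nat) (At : 'I_m -> set V) :=
  [/\ forall w, open_polytope (At w) /\ At w `<=` Sd,
      trivIset setT At,
      lebesgue (Sd `\` \bigcup_w At w) = 0%E,
      forall w, smooth_on (At w) H
    & forall w, H @` At w `<=` Sd].

Definition piecewise_smooth (H : V -> V) : Prop :=
  exists (m : nat) (At : 'I_m -> set V), atomic_collection H At.

Definition IUP (H : V -> V) (U : set V) : Prop :=
  U `<=` Sd /\
  exists (n : nat) (P : 'I_n -> set V),
    [/\ forall j, polytope (P j), U = \bigcup_j P j
      & exists (m : nat) (At : 'I_m -> set V), atomic_collection H At /\
          H @` (\bigcup_j \bigcup_w (P j `&` At w)) `<=` U].

Definition AsIUP (H : V -> V) (U : set V) : Prop :=
  IUP H U /\ U `&` (sigma @` U) = set0.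

End Piecewise.

(* Main.v *)
Require Import Defs.
From mathcomp Require Import all_boot all_order all_algebra.
From mathcomp Require Import all_classical all_reals all_analysis.
From HB Require Import structures.
From mathcomp Require Import measurable_realfun.
From mathcomp Require Import ring lra.
Import Order.TTheory GRing.Theory Num.Theory.
Import numFieldNormedType.Exports.
Local Open Scope classical_set_scope.
Local Open Scope ring_scope.

Set Implicit Arguments.
Unset Strict Implicit.
Unset Printing Implicit Defensive.

(** Why the theorem holds, with [k = 1].

    On the set [Aset j] the map [G] is the homothety of ratio [a] centred at the
    [j]-th vertex of the simplex: the only gap larger than 1/2 between lifted
    points is the [j]-th one, and once that gap is cut open all the differences
    are smaller than 1/2, so that [gfun] is affine on them
    ([G_graph_vertex_dilation]). The requirement of agreeing with [G] therefore
    only prescribes these [d + 1] homotheties, and [H] may be chosen freely on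
    the rest of the simplex as long as it commutes with [sigma]. Given an affine
    map [x L + t], [glued_map] uses the homotheties on the [Aset j], the affine
    map on the part of [Bset 1] which it sends into the simplex, its conjugate
    by [sigma] on the mirror image of that part, and the identity elsewhere. It
    is piecewise affine because each of these domains is, up to hyperplanes, a
    union of sign cells of finitely many affine functions ([glued_map_atomic]).

    It remains to choose [L] and [t]. Let [frame_mx] be a frame of vectors
    e_0, ..., e_{d-1} of one common length, so that the required form of [L] is
    e_i -> a e_{i+1}. Around the first vertex, use coordinates xi along suitable
    multiples of the e_i ([chart]). There the homothety reads xi -> a xi, it
    applies when xi_0 < 1, and the affine branch applies when xi_0 > 1 and reads
    xi_i -> xi_i / a into the next coordinate, except for xi_0 which is sent to
    (a^(2d) xi_0) / a - shift ([turn]). Follow a point of a cube [lo, hi]^d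
    around 1: if xi_0 < 1 apply the homothety and then the branch; if xi_0 > 1
    apply the branch and then the homothety. In both cases two steps rotate the
    coordinates and apply to xi_0 alone a map of slope a^(2d) having two
    increasing branches; the shift and the two ends of the cube are such that
    this is a copy of the beta-transformation s -> beta s mod 1 with
    beta = a^(2d) ([turn_loop_low], [turn_loop_high]).

    The cube, the part xi_0 <= 1 of it enlarged by [a], and the cube shrunk by
    [a], form the invariant union of polytopes [box_union]. All its points have
    x_1 > 3/8 and x_2 + ... + x_d < 3/8, so that their mirror images have a
    first coordinate smaller than 3/8: the union is asymmetric. The constants
    fit in the simplex because a^(2d) is close to 1, which is how the bound on
    [a] is found, and because the frame is chosen close to a plane, the vectors
    beyond that plane having a tiny component [tau] which keeps them independent
    ([frame_constants]).

    The beta-transformation preserves Parry's absolutely continuous measure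
    ([parry_measure_invariant]), so its [d]-th power is preserved by two steps
    ([loop_measure]); averaging it with its image under [H] gives an invariant
    probability carried by [box_union] ([invariant_average]). Absolute
    continuity is obtained from the bound C e^d on the measure of balls of
    radius e ([ball_bounded_dominates]), which is stable under products and
    under invertible affine maps. The image under [sigma] is the other
    measure. *)

(** * The beta-transformation and Parry's measure *)

(* Innermost conditions are split first, so that no condition is left inside a
   hypothesis. *)
Ltac case_minmax :=
  rewrite /Num.min /Num.max;
  repeat match goal with
  | |- context [if ?c then _ else _] =>
    lazymatch c with
    | context [if _ then _ else _] => fail
    | _ => let H := fresh in case: (boolP c) => H; rewrite -?leNgt in H; cbn iota
    end
  end.

Section BetaTransformation.
Context {R : realType} (b : R).
Hypothesis b_bounds : 2^-1 <= b < 1.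

Definition beta_map (x : R) : R := if x <= b then x / b else x / b - 1.

Definition beta_orbit (n : nat) : R := iter n beta_map 1.

(** [clamp t] is the distribution function of Lebesgue measure on [0, t], and
    [parry] that of the measure whose density is the sum of b^n times the
    indicator of [0, T^n 1], where T is [beta_map]; this is Parry's invariant
    density, up to a constant. *)
Definition clamp (t x : R) : R := Num.min (Num.max x 0) t.

Definition parry_sum (N : nat) (x : R) : R :=
  \sum_(n < N) b ^+ n * clamp (beta_orbit n) x.

Definition parry (x : R) : R := limn (parry_sum ^~ x).

Let b_gt0 : 0 < b. Proof. by move: b_bounds; lra. Qed.

Lemma beta_map_itv x : 0 <= x <= 1 -> 0 <= beta_map x <= 1.
Proof.
move=> /andP[x0 x1]; rewrite /beta_map; case: (leP x b) => xb.
  by rewrite divr_ge0 ?(ltW b_gt0)//= ler_pdivrMr ?mul1r.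
rewrite subr_ge0 ler_pdivlMr // mul1r (ltW xb) /= lerBlDr ler_pdivrMr //.
by move: b_bounds; lra.
Qed.

Lemma beta_orbit_itv n : 0 <= beta_orbit n <= 1.
Proof.
elim: n => [|n IH]; first by rewrite /beta_orbit /= ler01 lexx.
exact: beta_map_itv.
Qed.

Lemma clamp_scale t x : clamp t (b * x) = b * clamp (t / b) x.
Proof.
rewrite /clamp minr_pMr ?(ltW b_gt0)// maxr_pMr ?(ltW b_gt0)// mulr0.
by rewrite [b * (t / b)]mulrC divfK ?gt_eqF.
Qed.

Lemma clamp_le0 t x : x <= 0 -> 0 <= t -> clamp t x = 0.
Proof. by move=> x0 t0; rewrite /clamp max_r // min_l. Qed.

Lemma clamp_gt0 t x : 0 < x -> clamp t x = Num.min x t.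
Proof. by move=> x0; rewrite /clamp max_l // ltW. Qed.

(** The image of Lebesgue measure on [0, t] under [beta_map]. The full branch of
    the map covers [0, 1] if [t] exceeds [b], and [t / b - beta_map t] is then 1
    and otherwise 0; the last branch covers [0, beta_map t]. Invariance of the
    whole sum follows since these digits, along the orbit of 1, expand 1 in
    base 1 / b. *)
Lemma clamp_beta t x : 0 <= t <= 1 ->
  clamp t (b * Num.min x 1) + clamp t (b * (Num.max x 0 + 1)) - clamp t b
  = b * ((t / b - beta_map t) * clamp 1 x + clamp (beta_map t) x).
Proof.
move=> /andP[t0 t1].
have -> : clamp t b = b * clamp (t / b) 1 by rewrite -clamp_scale mulr1.
rewrite !clamp_scale -mulrDr -mulrBr; congr (_ * _).
have s0 : 0 <= t / b by rewrite divr_ge0 ?(ltW b_gt0).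
have s2 : t / b <= 2.
  by rewrite ler_pdivrMr //; move: b_bounds; lra.
have -> : beta_map t = if t / b <= 1 then t / b else t / b - 1.
  by rewrite /beta_map ler_pdivrMr // mul1r.
move: (t / b) s0 s2 => s s0 s2.
set y := if s <= 1 then s else s - 1.
have [y0 y1] : 0 <= y /\ y <= 1 by rewrite /y; case: (leP s 1) => ?; split; lra.
have [x0|x0] := leP x 0.
  have x1 : x <= 1 by lra.
  by rewrite (min_l x1) add0r !(clamp_le0 x0) //; ring.
have [x1|x1] := leP 1 x.
  rewrite !clamp_gt0 ?ltr01 ?addr_gt0 //.
  have xs : s <= x + 1 by lra.
  have xy : y <= x by lra.
  by rewrite (min_r xs) (min_r x1) (min_r xy); ring.
rewrite !clamp_gt0 ?ltr01 ?addr_gt0 //.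
rewrite (min_l (ltW x1)) /y; case: (leP s 1) => s1.
  have xs : s <= x + 1 by lra.
  by rewrite (min_r xs); ring.
have xs : x <= s by lra.
rewrite (min_l xs).
by rewrite /Num.min ltrBrDr; case: ifP => _; ring.
Qed.

Lemma parry_sumS N x :
  parry_sum N.+1 x = parry_sum N x + b ^+ N * clamp (beta_orbit N) x.
Proof. by rewrite /parry_sum big_ord_recr. Qed.

(** Invariance up to a remainder: the digits telescope. *)
Lemma parry_sum_beta N x :
  parry_sum N (b * Num.min x 1) + parry_sum N (b * (Num.max x 0 + 1))
    - parry_sum N b
  = parry_sum N.+1 x - b ^+ N * beta_orbit N * clamp 1 x.
Proof.
elim: N => [|N IH].
  by rewrite /parry_sum big_ord_recl !big_ord0 /beta_orbit /= expr0; lra.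
rewrite (parry_sumS N.+1 x) exprS.
rewrite (parry_sumS N (b * Num.min x 1)) (parry_sumS N (b * (Num.max x 0 + 1))).
rewrite (parry_sumS N b).
have := clamp_beta x (beta_orbit_itv N); move: IH.
rewrite -[beta_map _]/(beta_orbit N.+1).
have : b * (beta_orbit N / b) = beta_orbit N by rewrite mulrC divfK ?gt_eqF.
move: (clamp (beta_orbit N) (b * _)) (clamp (beta_orbit N) (b * (_ + _))).
move: (clamp (beta_orbit N) b) (clamp (beta_orbit N.+1) x) (clamp 1 x).
move: (b ^+ N) (beta_orbit N / b) (beta_orbit N.+1) => B s y r w u p q bb IH cl.
have -> X Y Z : X + B * p + (Y + B * q) - (Z + B * r) =
  (X + Y - Z) + B * (p + q - r) by ring.
by rewrite IH cl -bb; ring.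
Qed.

Lemma clamp_nd t x y : x <= y -> clamp t x <= clamp t y.
Proof.
rewrite /clamp /Num.min /Num.max => xy.
by case_minmax; lra.
Qed.

Lemma clamp_lip t x y : x <= y -> clamp t y - clamp t x <= y - x.
Proof.
rewrite /clamp /Num.min /Num.max => xy.
by case_minmax; lra.
Qed.

Lemma clamp_ge0 t x : 0 <= t -> 0 <= clamp t x.
Proof. by move=> t0; rewrite /clamp le_min t0 le_max lexx orbT. Qed.

Lemma clamp_le t x : clamp t x <= t.
Proof. by rewrite /clamp ge_min lexx orbT. Qed.

Lemma geometric_bound N : \sum_(n < N) b ^+ n <= (1 - b)^-1.
Proof.
have b1 : 0 < 1 - b by move: b_bounds; lra.
rewrite -[leRHS]mul1r ler_pdivlMr // mulrC -opprB mulNr -subrX1 opprB.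
by rewrite gerBl exprn_ge0 ?(ltW b_gt0).
Qed.

Lemma parry_sum_nd N x y : x <= y -> parry_sum N x <= parry_sum N y.
Proof.
move=> xy; apply: ler_sum => n _; rewrite ler_pM2l ?exprn_gt0 //.
exact: clamp_nd.
Qed.

Lemma parry_sum_lip N x y : x <= y ->
  parry_sum N y - parry_sum N x <= (1 - b)^-1 * (y - x).
Proof.
move=> xy; rewrite /parry_sum -sumrB.
apply: (@le_trans _ _ (\sum_(n < N) b ^+ n * (y - x))).
  apply: ler_sum => n _; rewrite -mulrBr ler_pM2l ?exprn_gt0 //.
  exact: clamp_lip.
by rewrite -mulr_suml ler_wpM2r ?subr_ge0 // geometric_bound.
Qed.

Lemma parry_cvg x : parry_sum ^~ x @ \oo --> parry x.
Proof.
apply: (@nondecreasing_is_cvgn _ (parry_sum ^~ x)).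
  apply/nondecreasing_seqP => n; rewrite /parry_sum big_ord_recr /= lerDl.
  rewrite mulr_ge0 ?exprn_ge0 ?(ltW b_gt0) // clamp_ge0 //.
  by case/andP: (beta_orbit_itv n).
exists ((1 - b)^-1) => _ [N _ <-].
apply: le_trans (geometric_bound N); apply: ler_sum => n _.
rewrite ger_pMr ?exprn_gt0 // (le_trans (clamp_le _ _)) //.
by case/andP: (beta_orbit_itv n).
Qed.

Lemma parry_nd : nondecreasing parry.
Proof.
move=> x y xy.
have h := ler_cvg_to (@parry_cvg x) (@parry_cvg y).
by apply: h; near=> n; exact: parry_sum_nd.
Unshelve. all: by end_near. Qed.

(** The Lipschitz bound will give absolute continuity, for the powers as well. *)
Lemma parry_lip x y : x <= y -> parry y - parry x <= (1 - b)^-1 * (y - x).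
Proof.
move=> xy.
have h := ler_cvg_to (cvgB (@parry_cvg y) (@parry_cvg x))
  (cvg_cst ((1 - b)^-1 * (y - x))).
by apply: h; near=> n; exact: parry_sum_lip.
Unshelve. all: by end_near. Qed.

Lemma parry_le0 x : x <= 0 -> parry x = 0.
Proof.
move=> x0; rewrite /parry (_ : parry_sum ^~ x = cst 0) ?lim_cst //.
apply/funext => N; apply: big1 => n _.
have /andP[t0 _] := beta_orbit_itv n.
by rewrite /clamp max_r // min_l // mulr0.
Qed.

Lemma parry_ge1 x : 1 <= x -> parry x = parry 1.
Proof.
move=> x1; rewrite /parry; congr (limn _); apply/funext => N.
apply: eq_bigr => n _; congr (_ * _).
have /andP[t0 t1] := beta_orbit_itv n.
by rewrite /clamp !max_l ?min_r //; lra.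
Qed.

Lemma parry1_gt0 : 0 < parry 1.
Proof.
apply: (@lt_le_trans _ _ 1) => //.
apply: (ler_cvg_to (cvg_cst (1 : R)) (@parry_cvg 1)).
near=> N.
have -> : N = N.-1.+1 by rewrite prednK //; near: N; exact: nbhs_infty_gt.
rewrite /parry_sum big_ord_recl /= expr0 mul1r /beta_orbit /=.
rewrite {1}/clamp max_l // min_l // lerDl; apply: sumr_ge0 => i _.
rewrite mulr_ge0 ?exprn_ge0 ?(ltW b_gt0) // clamp_ge0 //.
by case/andP: (beta_orbit_itv (lift ord0 i)).
Unshelve. all: by end_near. Qed.

Lemma parry_beta x :
  parry (b * Num.min x 1) + parry (b * (Num.max x 0 + 1)) - parry b = parry x.
Proof.
have cl : parry_sum N (b * Num.min x 1) + parry_sum N (b * (Num.max x 0 + 1))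
    - parry_sum N b @[N --> \oo] -->
    parry (b * Num.min x 1) + parry (b * (Num.max x 0 + 1)) - parry b.
  apply: cvgB; last exact: (@parry_cvg).
  by apply: cvgD; exact: (@parry_cvg).
have b0 : b ^+ N * beta_orbit N * clamp 1 x @[N --> \oo] --> 0.
  rewrite -[X in _ --> X](mul0r (clamp 1 x)); apply: cvgMl.
  apply: (@squeeze_cvgr _ _ _ _ (fun _ => 0) (fun N => b ^+ N)).
  - near=> N; have /andP[t0 t1] := beta_orbit_itv N.
    rewrite mulr_ge0 ?exprn_ge0 ?(ltW b_gt0) //=.
    by rewrite ger_pMr ?exprn_gt0.
  - exact: cvg_cst.
  - by apply: cvg_expr; rewrite gtr0_norm //; move: b_bounds; lra.
have cr : parry_sum N.+1 x - b ^+ N * beta_orbit N * clamp 1 x @[N --> \oo]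
    --> parry x - 0.
  have sx : parry_sum N.+1 x @[N --> \oo] --> parry x.
    by rewrite (cvg_shiftS (parry_sum ^~ x)); exact: (@parry_cvg).
  exact: cvgB sx b0.
move: cr; rewrite subr0 => cr.
have cl' : parry_sum N.+1 x - b ^+ N * beta_orbit N * clamp 1 x @[N --> \oo] -->
    parry (b * Num.min x 1) + parry (b * (Num.max x 0 + 1)) - parry b.
  by under eq_cvg do rewrite -parry_sum_beta.
exact: cvg_unique cl' cr.
Unshelve. all: by end_near. Qed.

Definition parry_cdf (x : R) : R := parry x / parry 1.

Let parry_cdf_nd : nondecreasing parry_cdf.
Proof. by move=> x y xy; rewrite ler_pM2r ?invr_gt0 ?parry1_gt0 // parry_nd. Qed.

Let parry_rc : right_continuous parry_cdf.
Proof.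
apply: right_continuousW => x; apply: cvgMl.
have b1 : 0 < (1 - b)^-1 by rewrite invr_gt0; move: b_bounds; lra.
apply/cvgrPdist_lt => e e0; near=> y.
have : `|x - y| < e * (1 - b).
  near: y; apply/nbhs_ballP; exists (e * (1 - b)) => //=.
  by rewrite mulr_gt0 //; move: b_bounds; lra.
have e1 : e = (1 - b)^-1 * (e * (1 - b)).
  by rewrite mulrCA mulVf ?mulr1 // gt_eqF // -invr_gt0.
have [xy|yx] := leP x y.
  rewrite ler0_norm ?subr_le0 // opprB => xye.
  rewrite ler0_norm ?subr_le0 ?parry_nd // opprB.
  by apply: le_lt_trans (parry_lip xy) _; rewrite [ltRHS]e1 ltr_pM2l.
rewrite ger0_norm ?subr_ge0 ?(ltW yx) // => xye.
rewrite ger0_norm ?subr_ge0 ?parry_nd ?(ltW yx) //.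
by apply: le_lt_trans (parry_lip (ltW yx)) _; rewrite [ltRHS]e1 ltr_pM2l.
Unshelve. all: by end_near. Qed.

HB.instance Definition _ :=
  isCumulative.Build R _ R parry_cdf parry_cdf_nd parry_rc.

Let parry_cdfNy : parry_cdf @ -oo --> (0 : R).
Proof.
apply: cvg_near_cst; near=> x; rewrite /parry_cdf parry_le0 ?mul0r //.
Unshelve. all: by end_near. Qed.

Let parry_cdfy : parry_cdf @ +oo --> (1 : R).
Proof.
apply: cvg_near_cst; near=> x.
rewrite /parry_cdf parry_ge1 ?divff ?gt_eqF ?parry1_gt0 //.
Unshelve. all: by end_near. Qed.

HB.instance Definition _ :=
  isCumulativeBounded.Build R 0 1 parry_cdf parry_cdfNy parry_cdfy.

Definition parry_measure : probability (measurableTypeR R) R :=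
  lebesgue_stieltjes_measure parry_cdf.

Lemma parry_measure_itv (x y : R) : x <= y ->
  parry_measure `]x, y]%classic = (parry_cdf y - parry_cdf x)%:E.
Proof.
move=> xy; rewrite /parry_measure /= /lebesgue_stieltjes_measure.
rewrite /measure_extension/= measurable_mu_extE/= ?wlength_itv_bnd //.
exact: is_ocitv.
Qed.

Lemma beta_map_measurable :
  @measurable_fun _ _ (measurableTypeR R) (measurableTypeR R) setT beta_map.
Proof.
suff : measurable_fun [set: R] beta_map by [].
apply: measurable_fun_ifT => /=.
- exact: measurable_fun_ler.
- exact: mulrr_measurable.
- by apply: measurable_funB => //; exact: mulrr_measurable.
Qed.

(** Each of the two branches contributes one interval; truncating the endpoints
    by 0 and 1 makes the formula valid wherever [x] and [y] lie. *)
Lemma beta_map_preimage (x y : R) : x <= y ->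
  beta_map @^-1` `]x, y]%classic =
  `](b * Num.min x 1), (b * Num.min y 1)]%classic `|`
  `](b * (Num.max x 0 + 1)), (b * (Num.max y 0 + 1))]%classic.
Proof.
move=> xy; have cut w : (if w <= 1 then x < w <= y else x < w - 1 <= y) =
    (Num.min x 1 < w <= Num.min y 1) ||
    (Num.max x 0 + 1 < w <= Num.max y 0 + 1).
  apply/idP/idP; case: (leP w 1) => w1.
  - by move=> /andP[? ?]; apply/orP; left; apply/andP; split; case_minmax; lra.
  - by move=> /andP[? ?]; apply/orP; right; apply/andP; split; case_minmax; lra.
  - move=> /orP[] /andP[]; case_minmax => ? ?; apply/andP; split; lra.
  - move=> /orP[] /andP[]; case_minmax => ? ?; apply/andP; split; lra.
apply/seteqP; suff eqz z : (x < beta_map z <= y) =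
    (b * Num.min x 1 < z <= b * Num.min y 1) ||
    (b * (Num.max x 0 + 1) < z <= b * (Num.max y 0 + 1)).
  by split => z; rewrite /= !in_itv /= eqz => /orP.
have -> : beta_map z = if z / b <= 1 then z / b else z / b - 1.
  by rewrite /beta_map ler_pdivrMr // mul1r.
have zE : z = b * (z / b) by rewrite mulrC divfK ?gt_eqF.
rewrite [in RHS]zE !ltr_pM2l ?ler_pM2l // -cut.
by case: (z / b <= 1).
Qed.

Lemma parry_measure_invariant (A : set (measurableTypeR R)) : measurable A ->
  parry_measure (beta_map @^-1` A) = parry_measure A.
Proof.
pose f : {mfun measurableTypeR R >-> measurableTypeR R} :=
  @mfun_Sub _ _ (measurableTypeR R) (measurableTypeR R) beta_map
    (mem_set beta_map_measurable).
pose image_measure : probability (measurableTypeR R) R :=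
  distribution parry_measure f.
move=> mA; apply/esym.
apply: (@lebesgue_stieltjes_measure_unique _ parry_cdf image_measure) => //.
move=> _ [[x y] /= _ <-]; have [yx|/ltW xy] := leP y x.
  by rewrite set_itv_ge ?measure0 // bnd_simp -leNgt.
rewrite -/parry_measure parry_measure_itv // /image_measure /= /distribution /pushforward /=.
rewrite beta_map_preimage //.
have le1 : b * Num.min x 1 <= b * Num.min y 1.
  by rewrite ler_pM2l //; case_minmax; lra.
have le2 : b * (Num.max x 0 + 1) <= b * (Num.max y 0 + 1).
  by rewrite ler_pM2l //; case_minmax; lra.
rewrite measureU //=.
- transitivity ((parry_cdf (b * Num.min y 1) - parry_cdf (b * Num.min x 1))%:E
    + (parry_cdf (b * (Num.max y 0 + 1)) - parry_cdf (b * (Num.max x 0 + 1)))%:E)%E.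
    rewrite -EFinD; congr (_%:E).
    rewrite /parry_cdf -(parry_beta x) -(parry_beta y); ring.
  by congr (_ + _)%E; rewrite -parry_measure_itv.
- apply/seteqP; split => // z [] /=; rewrite !in_itv /= => /andP[_ h1] /andP[h2 _].
  have : b * Num.min y 1 <= b * (Num.max x 0 + 1).
    by rewrite ler_pM2l //; case_minmax; lra.
  by move: h1 h2; lra.
Qed.

Lemma parry_measure_lip : exists2 C, 0 < C & forall x y : R, x <= y ->
  (parry_measure `]x, y]%classic <= (C * (y - x))%:E)%E.
Proof.
have b1 : 0 < 1 - b by move: b_bounds; lra.
exists ((1 - b)^-1 / parry 1); first by rewrite divr_gt0 ?invr_gt0 ?parry1_gt0.
move=> x y xy; rewrite parry_measure_itv // lee_fin /parry_cdf -mulrBl mulrAC.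
by rewrite ler_pM2r ?invr_gt0 ?parry1_gt0 // parry_lip.
Qed.

Lemma parry_measure_unit : parry_measure `]0, 1]%classic = 1%E.
Proof.
rewrite parry_measure_itv // /parry_cdf divff ?gt_eqF ?parry1_gt0 //.
by rewrite parry_le0 // mul0r subr0.
Qed.

End BetaTransformation.

(** * Borel probabilities on row vectors *)

Section BorelSpace.
Context {R : realType} {n : nat}.
Local Notation V := 'rV[R]_n.

Lemma rV_ballP (x y : V) e :
  ball x e y <-> 0 < e /\ forall j, `|x 0 j - y 0 j| < e.
Proof.
split=> -[e0 xy]; split => //.
  by move=> j; exact: (xy 0 j).
by move=> i j; rewrite ord1; exact: xy.
Qed.

Definition rect (A : 'I_n -> set R) : set V := [set x | forall j, A j (x 0 j)].

Lemma ball_rect (x : V) e : 0 < e -> ball x e = rect (fun j => ball (x 0 j) e).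
Proof.
move=> e0; apply/seteqP; split => y /=; first by case/rV_ballP.
by move=> xy; apply/rV_ballP.
Qed.

Lemma measurable_ball (x e : R) : measurable (ball x e).
Proof. by rewrite ball_itv; exact: measurable_itv. Qed.

Lemma rect_bigcap (A : 'I_n -> set R) :
  rect A = \bigcap_(j in [set: 'I_n]) [set x | A j (x 0 j)].
Proof.
by apply/seteqP; split => x Ax; [move=> j _|move=> j]; apply: Ax.
Qed.

(** The sup-norm balls of rational centre and radius form a countable base. *)
Lemma open_bigcup_ball (O : set V) : open O -> exists F : nat -> set V,
  O = \bigcup_k F k /\
  forall k, F k = set0 \/ exists x e, 0 < e /\ F k = ball x e.
Proof.
move=> oO; pose c (qr : 'rV[rat]_n * rat) : V := map_mx ratr qr.1.
pose good qr := 0 < ratr qr.2 :> R /\ ball (c qr) (ratr qr.2) `<=` O.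
pose F k := if unpickle k is Some qr then
  (if pselect (good qr) then ball (c qr) (ratr qr.2) else set0) else set0.
exists F; split; last first.
  move=> k; rewrite /F; case: unpickle => [qr|]; last by left.
  case: pselect => [[h _]|_] /=; last by left.
  by right; exists (c qr), (ratr qr.2).
apply/seteqP; split => [x Ox|x [k _]]; last first.
  rewrite /F; case: unpickle => [qr|] //.
  by case: pselect => [[_ h]|_] //= /h.
have /nbhs_ballP[e /= e0 eO] : nbhs x O by exact: open_nbhs_nbhs.
have [r] : exists r : rat, ratr r \in `]0, (e / 2)[.
  by apply: rat_in_itvoo; rewrite divr_gt0.
rewrite in_itv /= => /andP[r0 re].
have /choice[q qx] : forall j, exists q : rat, `|ratr q - x 0 j| < ratr r.
  move=> j; have [|q] := @rat_in_itvoo R (x 0 j) (x 0 j + ratr r).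
    by rewrite ltrDl.
  rewrite in_itv /= => /andP[q1 q2]; exists q.
  by rewrite gtr0_norm ?subr_gt0 // ltrBlDl.
pose qr := (\row_j q j, r) : 'rV[rat]_n * rat.
exists (pickle qr) => //; rewrite /F pickleK.
have cx : ball (c qr) (ratr r) x.
  by apply/rV_ballP; split => // j; rewrite !mxE.
case: pselect => // -[]; split => //= y /rV_ballP[_ cy].
apply: eO; apply/rV_ballP; split => // j.
have := qx j; have := cy j; rewrite !mxE => h1 h2.
have -> : x 0 j - y 0 j = (ratr (q j) - y 0 j) - (ratr (q j) - x 0 j) by ring.
by apply: le_lt_trans (ler_normB _ _) _; lra.
Qed.

Lemma borel_measurable_fun d (T : measurableType d) (D : set T) (f : T -> borel R n) :
  (forall j, measurable_fun D (fun t => (f t : V) 0 j : measurableTypeR R)) ->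
  measurable_fun D f.
Proof.
move=> mf; move=> mD.
suff : measurable_fun D f by apply.
apply: (@measurability _ _ T (borel R n) D f [set A : set V | open A]) => //.
move=> _ [Q oQ <-].
have [F [-> Fball]] := open_bigcup_ball oQ.
rewrite preimage_bigcup setI_bigcupr; apply: bigcupT_measurable => k.
have [->|[x [e [e0 ->]]]] := Fball k; first by rewrite preimage_set0 setI0.
have -> : D `&` f @^-1` ball x e =
    D `&` \bigcap_(j in [set: 'I_n])
      (D `&` (fun t => (f t : V) 0 j) @^-1` ball (x 0 j) e).
  rewrite ball_rect //; apply/seteqP; split => t [Dt ft]; split => //.
    by move=> j _; split => //; exact: ft.
  by move=> j; case: (ft j I).
apply: measurableI => //; apply: fin_bigcap_measurable; first exact: finite_finset.
by move=> j _; apply: mf => //; exact: measurable_ball.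
Qed.

Lemma coord_measurable j :
  measurable_fun setT (fun x : borel R n => (x : V) 0 j : measurableTypeR R).
Proof.
apply: (measurability _ (measurable_realfun.RGenOInfty.measurableE R)).
move=> _ [_ [a ->] <-]; rewrite setTI; apply: sub_sigma_algebra => /=.
rewrite set_itvoy.
by apply: open_comp; [move=> x _; exact: coord_continuous|exact: open_gt].
Qed.

Lemma rect_measurable (A : 'I_n -> set R) : (forall j, measurable (A j)) ->
  measurable (rect A : set (borel R n)).
Proof.
move=> mA; rewrite rect_bigcap.
apply: fin_bigcap_measurable; first exact: finite_finset.
move=> j _; rewrite -[X in measurable X]setTI.
exact: (coord_measurable j measurableT (mA j)).
Qed.

Lemma ball_measurable (x : V) e : 0 < e ->
  measurable (ball x e : set (borel R n)).
Proof.
move=> e0; rewrite ball_rect //; apply: rect_measurable => j.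
exact: measurable_ball.
Qed.

(** Products of measurable sets form a pi-system, and they generate the Borel
    sets because balls are such products. *)
Lemma borel_measure_unique (m1 m2 : probability (borel R n) R) :
  (forall A : 'I_n -> set R, (forall j, measurable (A j)) ->
    m1 (rect A) = m2 (rect A)) ->
  forall E, measurable E -> m1 E = m2 E.
Proof.
move=> m12; pose G : set (set (borel R n)) :=
  [set E | exists2 A : 'I_n -> set R, (forall j, measurable (A j)) & E = rect A].
apply: (measure_unique G (fun _ => setT)).
- apply/seteqP; split; last first.
    apply: smallest_sub; first exact: sigma_algebra_measurable.
    by move=> _ [A mA ->]; exact: rect_measurable.
  apply: smallest_sub; first exact: smallest_sigma_algebra.
  move=> O /open_bigcup_ball[F [-> FB]].
  apply: sigma_algebra_bigcup => k.
  have [->|[x [e [e0 ->]]]] := FB k; first exact: sigma_algebra0.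
  apply: sub_sigma_algebra; exists (fun j => ball (x 0 j) e).
    by move=> j; exact: measurable_ball.
  exact: ball_rect.
- move=> _ _ [A mA ->] [B mB ->]; exists (fun j => A j `&` B j).
    by move=> j; exact: measurableI.
  by apply/seteqP; split => x; [case=> xA xB j|move=> xAB; split => j; case: (xAB j)].
- by move=> _; exists (fun=> setT) => //; apply/seteqP; split.
- by apply/seteqP; split => // x _; exists 0%N.
- by move=> _ [A mA ->]; exact: m12.
- by move=> _; exact: le_lt_trans (probability_le1 m1 measurableT) (ltry 1).
Qed.

End BorelSpace.

Section ProductMeasure.
Context {R : realType} (nu : probability (measurableTypeR R) R).

Let cons_rV n (tx : measurableTypeR R * borel R n) : borel R n.+1 :=
  row_mx (tx.1)%:M (tx.2 : 'rV[R]_n) : 'rV[R]_(1 + n).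

Let cons_rV0 n tx : (cons_rV tx : 'rV[R]_n.+1) 0 ord0 = tx.1.
Proof.
rewrite /cons_rV (_ : ord0 = lshift n ord0 :> 'I_(1 + n)); last exact: val_inj.
by rewrite [LHS]row_mxEl mxE eqxx mulr1n.
Qed.

Let cons_rVS n tx j :
  (cons_rV tx : 'rV[R]_n.+1) 0 (lift ord0 j) = (tx.2 : 'rV[R]_n) 0 j.
Proof.
rewrite /cons_rV (_ : lift ord0 j = rshift 1 j :> 'I_(1 + n)); last exact: val_inj.
exact: row_mxEr.
Qed.

Let cons_rV_measurable n : measurable_fun setT (@cons_rV n).
Proof.
apply: borel_measurable_fun => j; have [i|] := unliftP ord0 j => ->.
  rewrite (_ : (fun t => _) = (fun x : borel R n => (x : 'rV[R]_n) 0 i) \o snd).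
    exact: measurableT_comp (coord_measurable i) measurable_snd.
  by apply/funext => t; exact: cons_rVS.
rewrite (_ : (fun t => _) = fst); first exact: measurable_fst.
by apply/funext => t; exact: cons_rV0.
Qed.

Lemma product_probability n : exists mu : probability (borel R n) R,
  forall A : 'I_n -> set R, (forall j, measurable (A j)) ->
  mu (rect A) = (\prod_j fine (nu (A j)))%:E.
Proof.
elim: n => [|n [mu muE]].
  exists (dirac ((0 : 'rV[R]_0) : borel R 0) : probability (borel R 0) R) => A mA.
  rewrite big_ord0; transitivity (dirac ((0 : 'rV[R]_0) : borel R 0) (rect A) : \bar R) => //.
  by rewrite diracE mem_set // => -[].
pose f : {mfun _ >-> _} := mfun_Sub (mem_set (cons_rV_measurable (n := n))).
exists (distribution (nu \x mu)%E f) => A mA.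
rewrite /distribution /= /pushforward big_ord_recl.
have -> : f @^-1` rect A = A ord0 `*` rect (fun j => A (lift ord0 j)).
  apply/seteqP; split => -[t x] /= => [h|[h0 h] j].
    by split=> [|j]; [rewrite -[t](cons_rV0 (t, x))|
      rewrite -(cons_rVS (t, x))]; exact: h.
  have [i|] := unliftP ord0 j => ->; first by rewrite cons_rVS; exact: h.
  by rewrite cons_rV0.
rewrite product_measure1E //=; [|exact: mA|exact: rect_measurable].
by rewrite muE // EFinM fineK ?fin_num_measure //; exact: mA.
Qed.

End ProductMeasure.

Section BallBounded.
Context {R : realType} {n : nat}.
Local Notation V := 'rV[R]_n.

(** A form of boundedness of the density, easier to propagate than absolute
    continuity since it refers to one kind of sets only. *)
Definition ball_bounded (mu : set V -> \bar R) : Prop :=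
  exists2 C, 0 <= C & forall (x : V) e, 0 < e -> (mu (ball x e) <= (C * e ^+ n)%:E)%E.

Lemma measure_bigsetU_le d (T : measurableType d) (mu : {measure set T -> \bar R})
  (I : Type) (r : seq I) (P : pred I) (F : I -> set T) :
  (forall i, P i -> measurable (F i)) ->
  (mu (\big[setU/set0]_(i <- r | P i) F i) <= \sum_(i <- r | P i) mu (F i))%E.
Proof.
move=> mF; elim: r => [|i r IH]; first by rewrite !big_nil measure0.
rewrite !big_cons; case: ifP => // Pi.
apply: le_trans (leeD2l _ IH); apply: measureU2; first exact: mF.
by apply: bigsetU_measurable.
Qed.

Lemma cvg_prod_shift (l : V) :
  (\prod_i (l 0 i + k.+1%:R^-1)) @[k --> \oo] --> \prod_i l 0 i.
Proof.
apply: cvg_big; first exact: mul_continuous.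
move=> i _; rewrite -[X in _ --> X]addr0; apply: cvgD; first exact: cvg_cst.
exact: cvg_harmonic.
Qed.

(** A box is covered by the cubes of a fine grid; as the mesh goes to zero,
    their total volume goes to that of the box. *)
Lemma ball_bounded_box (mu : {measure set (borel R n) -> \bar R}) C :
  0 <= C ->
  (forall (x : V) e, 0 < e -> (mu (ball x e) <= (C * e ^+ n)%:E)%E) ->
  forall lo hi : V, (forall i, lo 0 i <= hi 0 i) ->
  (mu (box lo hi) <= (C * \prod_i (hi 0 i - lo 0 i))%:E)%E.
Proof.
move=> C0 muC lo hi lohi; pose l := hi - lo.
have l0 i : 0 <= l 0 i by rewrite !mxE subr_ge0.
have -> : \prod_i (hi 0 i - lo 0 i) = \prod_i l 0 i.
  by apply: eq_bigr => i _; rewrite !mxE.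
suff grid k : (mu (box lo hi) <= (C * \prod_i (l 0 i + k.+1%:R^-1))%:E)%E.
  have mfin : mu (box lo hi) \is a fin_num.
    by rewrite ge0_fin_numE // (le_lt_trans (grid 0%N)) // ltry.
  rewrite -(fineK mfin) lee_fin.
  have cl : C * \prod_i (l 0 i + k.+1%:R^-1) @[k --> \oo] --> C * \prod_i l 0 i.
    by apply: cvgMr; exact: cvg_prod_shift.
  apply: (ler_cvg_to (cvg_cst (fine (mu (box lo hi)))) cl).
  by near=> k; rewrite -lee_fin fineK.
pose N i := (Num.truncn (k.+1%:R * l 0 i)).+1.
pose M := \max_i N i.
have kgt0 : 0 < k.+1%:R :> R by rewrite ltr0n.
(* [c f] ranges over the points of the grid of mesh [1 / (k + 1)]
   which starts at the lower corner of the box; in direction [i] the indices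
   below [N i] are enough. *)
pose c (f : {ffun 'I_n -> 'I_M}) : V := \row_i (lo 0 i + (f i)%:R / k.+1%:R).
pose Q i := [pred m : 'I_M | (m < N i)%N].
have mball f : measurable (ball (c f) k.+1%:R^-1 : set (borel R n)).
  by apply: ball_measurable; rewrite invr_gt0.
have cover : box lo hi `<=`
    \big[setU/set0]_(f in family Q) ball (c f) k.+1%:R^-1.
  move=> x bx; rewrite -bigcup_seq_cond.
  have yi i : 0 <= k.+1%:R * (x 0 i - lo 0 i) <= k.+1%:R * l 0 i.
    have /andP[h1 h2] := bx i.
    by rewrite mulr_ge0 ?subr_ge0 // !mxE ler_pM2l // lerD2r.
  have tr i : (Num.truncn (k.+1%:R * (x 0 i - lo 0 i))%R < N i)%N.
    by rewrite ltnS le_truncn //; case/andP: (yi i).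
  have trM i : (Num.truncn (k.+1%:R * (x 0 i - lo 0 i))%R < M)%N.
    exact: leq_trans (tr i) (leq_bigmax i).
  exists [ffun i => Ordinal (trM i)].
    rewrite /= mem_index_enum; apply/familyP => i; rewrite ffunE inE; exact: tr.
  apply/rV_ballP; split; first by rewrite invr_gt0.
  move=> i; rewrite !mxE ffunE /=.
  have /andP[t0 _] := yi i; have /andP[] := truncn_itv t0.
  set t : R := (Num.truncn _)%:R => h1 h2.
  have {h2} : k.+1%:R * (x 0 i - lo 0 i) < t + 1 by rewrite (lt_le_trans h2) // -natr1.
  rewrite -ltr_pdivlMl // mulrC mulrDl mul1r => h2.
  move: h1; rewrite -ler_pdivrMl // [_ * t]mulrC => h1.
  set u := t / _ in h1 h2 *; set w := k.+1%:R^-1 in h2 *.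
  by move: (u) (w) h1 h2 => {}u {}w h1 h2; rewrite distrC ger0_norm; lra.
have mfam : measurable
    (\big[setU/set0]_(f in family Q) ball (c f) k.+1%:R^-1 : set (borel R n)).
  exact: bigsetU_measurable.
apply: le_trans (le_measure mu _ _ cover) _; rewrite ?inE //.
  rewrite (_ : box lo hi = rect (fun i => `[lo 0 i, hi 0 i]%classic)).
    by apply: rect_measurable => i; exact: measurable_itv.
  by apply/seteqP; split => x h i; have := h i; rewrite /= in_itv.
apply: le_trans (measure_bigsetU_le _ _ _) _ => //.
apply: (@le_trans _ _ (\sum_(f in family Q) (C * \prod_(i < n) k.+1%:R^-1)%:E)%E).
  apply: lee_sum => f _; rewrite big_const_ord iter_mulr_1.
  by apply: muC; rewrite invr_gt0.
rewrite sumEFin lee_fin -mulr_sumr ler_wpM2l //.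
rewrite -(bigA_distr_big_dep _ (fun i m => k.+1%:R^-1)) /=.
apply: ler_prod => i _; rewrite sumr_ge0 => [|m _]; last by rewrite invr_ge0.
have NM : (N i <= M)%N by exact: leq_bigmax.
rewrite -(big_ord_widen _ (fun _ => k.+1%:R^-1) NM) sumr_const card_ord.
have -> : N i = (Num.truncn (k.+1%:R * l 0 i)%R + 1)%N by rewrite addn1.
rewrite /= -[_^-1 *+ _]mulr_natl natrD mulrDl mul1r lerD2r ler_pdivrMr // mulrC.
by rewrite truncn_le mulr_ge0 // ltW.
Unshelve. all: by end_near. Qed.

(** A null set is covered by boxes of arbitrarily small total volume. *)
Lemma ball_bounded_dominates (mu : {measure set (borel R n) -> \bar R}) :
  ball_bounded mu -> mu `<< (lebesgue : set (borel R n) -> \bar R).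
Proof.
move=> [C C0 muC] N leb0 A mA AN; have {leb0 AN} := leb0 A mA AN.
rewrite /lebesgue => leb0.
apply/eqP; rewrite eq_le measure_ge0 andbT.
apply/lee_addgt0Pr => e e0; rewrite add0e.
have C1 : 0 < C + 1 by lra.
have eC : (0 < (e / (C + 1))%:E)%E by rewrite lte_fin divr_gt0.
move: leb0 => /esym leb0; rewrite leb0 in eC.
have [_ [lo [hi [lohi Acov ->]]] lt_e] := ereal_inf_lt eC.
have mbox k : measurable (box (lo k) (hi k) : set (borel R n)).
  rewrite (_ : box _ _ = rect (fun i => `[lo k 0 i, hi k 0 i]%classic)).
    by apply: rect_measurable => i; exact: measurable_itv.
  by apply/seteqP; split => x h i; have := h i; rewrite /= in_itv.
have h : (mu A <= \sum_(0 <= k <oo) mu (box (lo k) (hi k)))%E.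
  exact: measure_sigma_subadditive.
apply: le_trans h _.
have vol_ge0 k : 0 <= \prod_i (hi k 0 i - lo k 0 i).
  by apply: prodr_ge0 => i _; rewrite subr_ge0.
apply: (@le_trans _ _
   (\sum_(0 <= k <oo) (C%:E * (\prod_i (hi k 0 i - lo k 0 i))%:E))%E).
  apply: lee_nneseries => [k _ _|k _]; first exact: measure_ge0.
  by rewrite -EFinM; exact: ball_bounded_box.
rewrite nneseriesZl; last by move=> k _; rewrite lee_fin.
apply: (@le_trans _ _ (C%:E * (e / (C + 1))%:E)%E).
  by rewrite lee_wpmul2l ?lee_fin // ltW.
by rewrite -EFinM lee_fin mulrCA ger_pMr // ler_pdivrMr //; lra.
Qed.

Lemma product_ball_bounded (nu : probability (measurableTypeR R) R)
    (mu : probability (borel R n) R) C : 0 <= C ->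
  (forall x y : R, x <= y -> (nu `]x, y]%classic <= (C * (y - x))%:E)%E) ->
  (forall A : 'I_n -> set R, (forall j, measurable (A j)) ->
    mu (rect A) = (\prod_j fine (nu (A j)))%:E) ->
  ball_bounded mu.
Proof.
move=> C0 nuC muE; exists ((C * 2) ^+ n); first by rewrite exprn_ge0 // mulr_ge0.
move=> x e e0; rewrite ball_rect // muE => [|j]; last exact: measurable_ball.
rewrite lee_fin -exprMn -[X in _ ^+ X]card_ord -prodr_const.
apply: ler_prod => j _; rewrite fine_ge0 ?measure_ge0 //=.
rewrite -lee_fin fineK ?fin_num_measure //; last exact: measurable_ball.
apply: (@le_trans _ _ (nu `](x 0 j - e), (x 0 j + e)]%classic)).
  apply: le_measure; rewrite ?inE.
  - exact: measurable_ball.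
  - exact: measurable_itv.
  - by rewrite ball_itv; exact: subset_itv_oo_oc.
apply: le_trans (nuC _ _ _) _; first by lra.
by rewrite lee_fin le_eqVlt; apply/orP; left; apply/eqP; ring.
Qed.

Lemma affine_measurable (M : 'M[R]_n) (c : V) :
  measurable_fun setT ((fun x : V => x *m M + c) : borel R n -> borel R n).
Proof.
apply: borel_measurable_fun => j.
rewrite (_ : (fun t => _) =
    fun x : borel R n => \sum_i (x : V) 0 i * M i j + c 0 j); last first.
  by apply/funext => x; rewrite !mxE.
apply: measurable_funD; last exact: measurable_cst.
apply: measurable_sum => i; apply: measurable_funM; last exact: measurable_cst.
exact: coord_measurable.
Qed.

(** The preimage of a ball under an invertible affine map lies in a ball whose
    radius is larger by a bounded factor. *)
Lemma affine_ball_bounded (mu : {measure set (borel R n) -> \bar R})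
    (M : 'M[R]_n) (c : V) : M \in unitmx -> ball_bounded mu ->
  ball_bounded (fun E => mu ((fun x : V => x *m M + c) @^-1` E)).
Proof.
move=> uM [C C0 muC].
pose K := 1 + \sum_i \sum_j `|invmx M i j|.
have K0 : 0 < K.
  by rewrite ltr_pwDl //; apply: sumr_ge0 => i _; apply: sumr_ge0.
exists (C * K ^+ n); first by rewrite mulr_ge0 // exprn_ge0 // ltW.
move=> y e e0; rewrite -mulrA -exprMn.
have Ke0 : 0 < K * e by rewrite mulr_gt0.
apply: le_trans (muC ((y - c) *m invmx M) _ Ke0).
have sub : (fun x : V => x *m M + c) @^-1` ball y e `<=`
    ball ((y - c) *m invmx M) (K * e).
  move=> x /rV_ballP[_ xy]; apply/rV_ballP; split => // j.
  have -> : x = (x *m M) *m invmx M by rewrite mulmxK.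
  rewrite !mxE -sumrB.
  under eq_bigr do rewrite -mulrBl.
  apply: le_lt_trans (ler_norm_sum _ _ _) _.
  apply: (@le_lt_trans _ _ (\sum_i e * `|invmx M i j|)).
    apply: ler_sum => i _; rewrite normrM ler_wpM2r //.
    have := ltW (xy i); rewrite !mxE.
    by congr (`|_| <= _); ring.
  rewrite -mulr_sumr mulrC ltr_pM2r // /K ltr_pwDl //.
  apply: ler_sum => i _; rewrite (bigD1 j) //= lerDl.
  by apply: sumr_ge0.
apply: (le_measure mu _ _ sub); rewrite inE; last exact: ball_measurable.
rewrite -[X in measurable X]setTI.
by apply: (affine_measurable M c) => //; exact: ball_measurable.
Qed.
End BallBounded.

(** * Affine functions, cells and null hyperplanes *)

Section AffineFunctionals.
Context {R : realType} {n : nat}.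
Local Notation V := 'rV[R]_n.

(** The affine function sending [x] to [x *m c + t], as the pair [(c, t)]: a
    comparable type, so that finite families of them are sequences. *)
Definition afun : Type := ('cV[R]_n * R)%type.

Definition ev (f : afun) (x : V) : R := (x *m f.1) 0 0 + f.2.

Definition afun_neg (f : afun) : afun := (- f.1, - f.2).

Definition afun_comp (f : afun) (M : 'M[R]_n) (c : V) : afun :=
  (M *m f.1, (c *m f.1) 0 0 + f.2).

Definition afun_coord (j : 'I_n) : afun := (delta_mx j 0, 0).

Lemma evE f x : ev f x = \sum_j x 0 j * f.1 j 0 + f.2.
Proof. by rewrite /ev mxE. Qed.

Lemma ev_neg f x : ev (afun_neg f) x = - ev f x.
Proof. by rewrite /ev mulmxN mxE opprD. Qed.

Lemma ev_comp f M c x : ev (afun_comp f M c) x = ev f (x *m M + c).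
Proof. by rewrite /ev /= mulmxDl mulmxA !mxE addrA. Qed.

Lemma ev_coord j x : ev (afun_coord j) x = x 0 j.
Proof.
rewrite evE /= addr0 (bigD1 j) //= mxE !eqxx mulr1 big1 ?addr0 // => i ij.
by rewrite mxE (negbTE ij) mulr0.
Qed.

Definition cell (gs : seq afun) : set V := [set x | forall g, g \in gs -> 0 < ev g x].
Definition closed_cell (gs : seq afun) : set V :=
  [set x | forall g, g \in gs -> 0 <= ev g x].

Lemma inequalities_mx (gs : seq afun) :
  exists (m : nat) (M : 'M[R]_(m, n)) (b : 'cV[R]_m),
  (cell gs = [set x : V | forall i, (M *m x^T) i 0 < b i 0]) /\
  (closed_cell gs = [set x : V | forall i, (M *m x^T) i 0 <= b i 0]).
Proof.
exists (size gs), (\matrix_(i, j) - (nth (0, 0) gs i).1 j 0),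
  (\col_i (nth (0, 0) gs i).2).
have sign x (i : 'I_(size gs)) :
    (\col_i (nth (0, 0) gs i).2) i 0 -
    ((\matrix_(i, j) - (nth (0, 0) gs i).1 j 0) *m x^T) i 0 = ev (nth (0, 0) gs i) x.
  rewrite evE !mxE addrC -sumrN; congr (_ + _); apply: eq_bigr => j _.
  by rewrite !mxE mulNr opprK mulrC.
split; apply/seteqP; split => x /= h.
- by move=> i; rewrite -subr_gt0 sign; apply: h; exact: mem_nth.
- by move=> g /(nthP (0, 0))[i ig <-]; rewrite -(sign x (Ordinal ig)) subr_gt0.
- by move=> i; rewrite -subr_ge0 sign; apply: h; exact: mem_nth.
- by move=> g /(nthP (0, 0))[i ig <-]; rewrite -(sign x (Ordinal ig)) subr_ge0.
Qed.

Lemma open_polytope_cell gs : bounded_set (cell gs) -> open_polytope (cell gs).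
Proof.
move=> bd; split => //; have [m [M [b [-> _]]]] := inequalities_mx gs.
by exists m, M, b.
Qed.

Lemma polytope_closed_cell gs : bounded_set (closed_cell gs) ->
  interior (closed_cell gs) !=set0 -> polytope (closed_cell gs).
Proof.
move=> bd int; split => //; have [m [M [b [_ ->]]]] := inequalities_mx gs.
by exists m, M, b.
Qed.

Lemma ev_continuous f : continuous (ev f).
Proof.
have -> : ev f = fun x : V => \sum_j x 0 j * f.1 j 0 + f.2.
  by apply/funext => x; rewrite evE.
have c1 j : continuous (fun x : V => x 0 j * f.1 j 0).
  by move=> x; exact: cvgM (@coord_continuous _ _ _ 0 j x) (cvg_cst _).
have c2 : continuous (fun x : V => \sum_j x 0 j * f.1 j 0).
  by apply: continuous_big => [|j _]; [exact: add_continuous|exact: c1].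
by move=> x; exact: cvgD (c2 x) (cvg_cst _).
Qed.

Lemma cell_open gs : open (cell gs).
Proof.
elim: gs => [|g gs IH].
  rewrite (_ : cell [::] = setT); first exact: openT.
  by apply/seteqP; split.
rewrite (_ : cell (g :: gs) = ev g @^-1` [set t | 0 < t] `&` cell gs).
  apply: openI IH; apply: open_comp; last exact: open_gt.
  by move=> x _; exact: ev_continuous.
apply/seteqP; split => x /=.
  move=> h; split; first by apply: h; rewrite inE eqxx.
  by move=> g' g'gs; apply: h; rewrite inE g'gs orbT.
by move=> [h0 h] g'; rewrite inE => /orP[/eqP ->|/h].
Qed.

Lemma closed_cell_closed gs : closed (closed_cell gs).
Proof.
elim: gs => [|g gs IH].
  rewrite (_ : closed_cell [::] = setT); first exact: closedT.
  by apply/seteqP; split.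
rewrite (_ : closed_cell (g :: gs) = ev g @^-1` [set t | 0 <= t] `&` closed_cell gs).
  apply: closedI IH; apply: preimage_closed; last exact: closed_ge.
  by move=> x _; exact: ev_continuous.
apply/seteqP; split => x /=.
  move=> h; split; first by apply: h; rewrite inE eqxx.
  by move=> g' g'gs; apply: h; rewrite inE g'gs orbT.
by move=> [h0 h] g'; rewrite inE => /orP[/eqP ->|/h].
Qed.

Lemma bounded_coord (A : set V) (M : R) :
  (forall x, A x -> forall j, `|x 0 j| <= M) -> bounded_set A.
Proof.
move=> AM; exists (Num.max M 0 + 1); split; first exact: num_real.
move=> N MN x Ax /=; apply: le_trans (ltW MN); apply: ltW.
have : ball (0 : V) (Num.max M 0 + 1) x.
  have M0 : 0 < Num.max M 0 + 1 by rewrite ltr_wpDl // le_max lexx orbT.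
  apply/rV_ballP; split => // j; rewrite mxE sub0r normrN.
  by rewrite (le_lt_trans (AM x Ax j)) // ltr_pwDr // le_max lexx.
by rewrite -ball_normE /= sub0r normrN.
Qed.

End AffineFunctionals.

Section NullSets.
Context {R : realType} {n : nat}.
Local Notation V := 'rV[R]_n.+1.

Definition volume (b : V * V) : R := \prod_i (b.2 0 i - b.1 0 i).

(** Negligible in the sense of Jordan content: a notion stable under finite
    unions by mere concatenation. *)
Definition content0 (A : set V) : Prop := forall e, 0 < e ->
  exists s : seq (V * V), [/\ forall b, b \in s -> forall i, b.1 0 i <= b.2 0 i,
    A `<=` [set x | exists2 b, b \in s & box b.1 b.2 x]
  & \sum_(b <- s) volume b <= e].

Lemma sub_content0 A B : A `<=` B -> content0 B -> content0 A.
Proof.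
move=> AB cB e /cB[s [s1 s2 s3]]; exists s; split => //.
by move=> x /AB /s2.
Qed.

Lemma content0U A B : content0 A -> content0 B -> content0 (A `|` B).
Proof.
move=> cA cB e e0; have e20 : 0 < e / 2 by rewrite divr_gt0.
have [s [s1 s2 s3]] := cA _ e20; have [t [t1 t2 t3]] := cB _ e20.
exists (s ++ t); split.
- by move=> b; rewrite mem_cat => /orP[/s1|/t1].
- by move=> x [/s2|/t2] [b bs bx]; exists b => //; rewrite mem_cat bs ?orbT.
- by rewrite big_cat /=; lra.
Qed.

Lemma content0_set0 : content0 set0.
Proof. by move=> e e0; exists [::]; split => //; rewrite big_nil ltW. Qed.

Lemma content0_lebesgue A : content0 A -> lebesgue A = 0%E.
Proof.
move=> cA; apply/eqP; rewrite eq_le; apply/andP; split; last first.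
  apply: le_ereal_inf_tmp => _ [lo [hi [lohi _ ->]]].
  apply: nneseries_ge0 => k _ _; rewrite lee_fin.
  by apply: prodr_ge0 => i _; rewrite subr_ge0.
apply/lee_addgt0Pr => e e0; rewrite add0e.
have [s [s1 s2 s3]] := cA e e0.
pose b k := nth (0, 0) s k.
have b_le k i : (b k).1 0 i <= (b k).2 0 i.
  have [ks|ks] := ltnP k (size s); first exact/s1/mem_nth.
  by rewrite /b nth_default //=.
have vol0 k : 0 <= volume (b k) by apply: prodr_ge0 => i _; rewrite subr_ge0.
apply: (@le_trans _ _ (\sum_(0 <= k <oo) (volume (b k))%:E)%E).
  apply: ereal_inf_lbound; exists (fun k => (b k).1), (fun k => (b k).2).
  split => // x /s2[_ /(nthP (0, 0))[k ks <-] bx].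
  by exists k.
apply: lime_le; first by apply: is_cvg_nneseries => k _ _; rewrite lee_fin.
apply: nearW => N; rewrite sumEFin lee_fin; apply: le_trans s3.
move: vol0; rewrite /b {s1 s2 b_le b}.
elim: s N => [|b s IH] [|N] vol0.
- by rewrite !big_nil.
- rewrite big_nil big1 // => k _; rewrite nth_nil.
  by rewrite /volume big_ord_recl /= !mxE subrr mul0r.
- rewrite big_geq //; elim: (b :: s) vol0 => [|c t IHt] vol0; first by rewrite big_nil.
  by rewrite big_cons addr_ge0 ?(vol0 0%N) // IHt // => k; exact: (vol0 k.+1).
- rewrite big_nat_recl // [leRHS]big_cons lerD2l; apply: IH => k; exact: (vol0 k.+1).
Qed.

(** A graph over a coordinate hyperplane is covered by boxes of side [1/k]
    in that hyperplane and of height of order [1/k]. *)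
Lemma hyperplane_content0 (f : afun (R := R) (n := n.+1)) : f.1 != 0 ->
  content0 [set x : V | (forall j, 0 <= x 0 j < 1) /\ ev f x = 0].
Proof.
move=> f0.
have [j fj] : exists j, f.1 j 0 != 0.
  apply/existsP; apply: contraNT f0; rewrite negb_exists => /forallP h.
  apply/eqP/colP => j; rewrite mxE; apply/eqP; have := h j; by rewrite negbK.
pose K := 1 + (\sum_i `|f.1 i 0|) / `|f.1 j 0|.
have fj0 : 0 < `|f.1 j 0| by rewrite normr_gt0.
have K0 : 0 < K.
  by rewrite ltr_pwDl // divr_ge0 // ?(ltW fj0) // sumr_ge0.
move=> e e0; pose k := (Num.truncn (2 * K / e)).+1.
have k0 : 0 < k%:R :> R by rewrite ltr0n.
have ke : 2 * K / k%:R <= e.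
  rewrite ler_pdivrMr // -ler_pdivrMl // mulrC ltW //.
  have : 0 <= 2 * K / e by rewrite divr_ge0 ?mulr_ge0 // ltW.
  by move/truncn_itv => /andP[_].
(* [pt r] is a corner of the grid of mesh [1 / k] in the directions other than
   [j], and [h r] the value that makes [f] vanish above it; the index [r j] is
   meaningless and forced to 0 to avoid repetitions. *)
pose pt (r : {ffun 'I_n.+1 -> 'I_k}) i : R := (r i)%:R / k%:R.
pose h r := - (f.2 + \sum_(i | i != j) pt r i * f.1 i 0) / f.1 j 0.
pose lo r : V := \row_i (if i == j then h r - K / k%:R else pt r i).
pose hi r : V := \row_i (if i == j then h r + K / k%:R else pt r i + k%:R^-1).
pose Q i := [pred m : 'I_k | (i == j) ==> (m == 0%N :> nat)].
pose s := [seq (lo r, hi r) | r <- enum (family Q)].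
exists s; split.
- move=> _ /mapP[r _ ->] i; rewrite !mxE; case: eqP => _.
    by have := divr_ge0 (ltW K0) (ltW k0); lra.
  by rewrite lerDl invr_ge0 ltW.
- move=> x [x01 fx].
  have xk i : 0 <= k%:R * x 0 i < k%:R.
    have /andP[h1 h2] := x01 i; apply/andP; split; first by rewrite mulr_ge0 // ltW.
    by rewrite gtr_pMr.
  have tk i : (Num.truncn (k%:R * x 0 i)%R < k)%N.
    by have /andP[h1 h2] := xk i; rewrite truncn_lt_nat.
  pose r := [ffun i => if i == j then ord0 else Ordinal (tk i)].
  have ptx i : i != j -> pt r i <= x 0 i <= pt r i + k%:R^-1.
    move=> /negbTE ij; have /andP[h1 _] := xk i; have /andP[] := truncn_itv h1.
    rewrite /pt ffunE ij /= -natr1 => h2 h3.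
    apply/andP; split; first by rewrite ler_pdivrMr // [x 0 i * _]mulrC.
    by rewrite -[X in _ + X]mul1r -mulrDl ler_pdivlMr // [x 0 i * _]mulrC ltW.
  exists (lo r, hi r).
    apply: map_f; rewrite mem_enum; apply/familyP => i; rewrite ffunE inE.
    by case: eqP.
  move=> i; rewrite !mxE; case: (eqVneq i j) => [->|ij]; last exact: ptx.
  suff : `|x 0 j - h r| <= K / k%:R by rewrite ler_distlC; lra.
  move: fx; rewrite evE (bigD1 j) //= => fx.
  have -> : x 0 j - h r =
      - (\sum_(i | i != j) (x 0 i - pt r i) * f.1 i 0) / f.1 j 0.
    under eq_bigr do rewrite mulrBl.
    rewrite sumrB; apply: (mulIf fj); rewrite mulrBl !divfK //.
    by move: fx; lra.
  rewrite normrM normrN normfV ler_pdivrMr // mulrAC /K mulrDl divfK ?gt_eqF //.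
  rewrite mul1r ler_pdivlMr //.
  apply: (@le_trans _ _ (\sum_i `|f.1 i 0|)); last by rewrite lerDr.
  rewrite mulrC -[k%:R]gtr0_norm // -normrM mulr_sumr.
  apply: le_trans (ler_norm_sum _ _ _) _.
  rewrite [leRHS](bigD1 j) //=; apply: ler_wpDl => //.
  apply: ler_sum => l lj; rewrite mulrA normrM ler_piMl //.
  have /andP[h1 h2] := ptx l lj.
  rewrite normrM gtr0_norm // mulrC ger0_norm ?subr_ge0 // -ler_pdivlMr // mul1r.
  by rewrite lerBlDl.
- rewrite big_map big_enum /=.
  pose F i (m : 'I_k) : R := if i == j then 2 * K / k%:R else k%:R^-1.
  have -> : \sum_(r in family Q) volume (lo r, hi r) =
      \sum_(r in family Q) \prod_i F i (r i).
    apply: eq_bigr => r _; apply: eq_bigr => i _; rewrite !mxE /F.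
    by case: eqP => _; ring.
  rewrite -bigA_distr_big_dep (bigD1 j) //= /F eqxx.
  rewrite [X in X * _](_ : _ = 2 * K / k%:R).
    rewrite [X in _ * X]big1 ?mulr1 // => i /negbTE ij; rewrite ij.
    by rewrite sumr_const cardT size_enum_ord -[_ *+ _]mulr_natl divff ?gt_eqF.
  rewrite (bigD1 ord0) //= big1 ?addr0 // => m /andP[/eqP m0].
  by case/negP; apply/eqP/val_inj.
Qed.

End NullSets.

Section SimplexCells.
Context {R : realType} {n : nat}.
Local Notation V := 'rV[R]_n.+1.

Lemma co_ord d (x : 'rV[R]_d) (j : 'I_d) : co x j.+1 = x 0 j.
Proof.
rewrite /co (bigD1 j) //= big1 ?addr0 // => i /andP[/eqP[ij]] /eqP nij.
by case: nij; exact: val_inj.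
Qed.

Lemma cosum_all d (x : 'rV[R]_d) : cosum x 1 d = \sum_j x 0 j.
Proof.
rewrite /cosum big_add1 /= big_mkord; apply: eq_bigr => j _; exact: co_ord.
Qed.

Definition simplex_funs : seq (afun (R := R) (n := n.+1)) :=
  (const_mx (-1), 1) :: [seq afun_coord j | j <- enum 'I_n.+1].

Lemma ev_simplex0 (x : V) : ev (const_mx (-1), 1) x = 1 - \sum_j x 0 j.
Proof.
rewrite evE addrC -sumrN; congr (_ + _).
by apply: eq_bigr => j _; rewrite mxE mulrN1.
Qed.

Lemma Sd_cell : Sd = cell simplex_funs :> set V.
Proof.
apply/seteqP; split => x /=.
  move=> [x0 x1] g; rewrite inE => /orP[/eqP ->|/mapP[j _ ->]].
    by rewrite ev_simplex0 -cosum_all subr_gt0.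
  by rewrite ev_coord.
move=> h; split.
  move=> j; rewrite -ev_coord; apply: h; rewrite inE map_f ?orbT //.
  by rewrite mem_enum.
by rewrite -subr_gt0 cosum_all -ev_simplex0; apply: h; rewrite inE eqxx.
Qed.

Lemma Sd_coord_lt1 (x : V) : Sd x -> forall j, 0 < x 0 j < 1.
Proof.
move=> [x0 x1] j; rewrite x0 /=; apply: le_lt_trans x1; rewrite cosum_all.
by rewrite (bigD1 j) //= lerDl; apply: sumr_ge0 => i _; exact: ltW.
Qed.

Lemma bounded_Sd (A : set V) : A `<=` Sd -> bounded_set A.
Proof.
move=> ASd; apply: (@bounded_coord _ _ _ 1) => x /ASd/Sd_coord_lt1 h j.
by have /andP[h1 h2] := h j; rewrite gtr0_norm // ltW.
Qed.

Lemma open_Sd : open (Sd : set V).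
Proof. by rewrite Sd_cell; exact: cell_open. Qed.

Lemma affine_continuous (M : 'M[R]_n.+1) (c : V) :
  continuous (fun x : V => x *m M + c).
Proof.
move=> x.
suff : forall e, 0 < e ->
    \forall y \near x, ball (x *m M + c) e (y *m M + c).
  by move=> h; apply: (cvg_ballP _ _).2 h; exact: nbhs_filter.
move=> e e0.
have h : \forall y \near x, forall j, `|(x *m M + c) 0 j - (y *m M + c) 0 j| < e.
  apply: (filter_forall (nbhs_filter x)) => j.
  have := @ev_continuous _ _ (afun_comp (afun_coord j) M c) x.
  move/cvgrPdist_lt => /(_ e e0); apply: filterS => y.
  by rewrite !ev_comp !ev_coord.
by near=> y; apply/rV_ballP; split => //; near: y.
Unshelve. all: by end_near. Qed.

(** The directional derivatives of an affine map are constant, hence affine, and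
    the induction on the order of differentiation closes up. *)
Lemma smooth_on_affine (A : set V) (f : V -> V) (M : 'M[R]_n.+1) (c : V) :
  open A -> (forall x, A x -> f x = x *m M + c) -> smooth_on A f.
Proof.
move=> oA fA k.
have cf (g : V -> V) (N : 'M[R]_n.+1) (b : V) :
    (forall x, A x -> g x = x *m N + b) -> forall x, A x -> {for x, continuous g}.
  move=> gA x Ax.
  have e : {near x, (fun x => x *m N + b) =1 g}.
    by apply: filterS (open_nbhs_nbhs (conj oA Ax)) => y /gA ->.
  rewrite /prop_for /continuous_at (gA x Ax).
  apply: cvg_trans (near_eq_cvg e) _.
  exact: affine_continuous.
elim: k f M c fA => [|k IH] f M c fA.
  by split => //; exact: cf fA.
split=> [|i]; first exact: cf fA.
pose v : V := delta_mx 0 i.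
have df x : A x ->
    (fun h => h^-1 *: ((f \o shift x) (h *: v) - f x)) @ (0 : R)^' --> v *m M.
  move=> Ax; apply: cvg_near_cst; near=> h.
  have h0 : h != 0 by near: h; exact: nbhs_dnbhs_neq.
  have Ah : A (h *: v + x).
    near: h; apply: nbhs_dnbhs.
    have : (h *: v + x) @[h --> (0 : R)] --> x.
      rewrite -[X in _ --> X]add0r -(scale0r v); apply: cvgD; last exact: cvg_cst.
      by apply: cvgZr_tmp; exact: cvg_id.
    by apply; exact: open_nbhs_nbhs.
  rewrite /= !fA // mulmxDl -scalemxAl.
  by rewrite opprD addrACA subrr addr0 addrK scalerA mulVf // scale1r.
split=> [x Ax|]; first by apply: cvgP; exact: df.
apply: (IH _ 0 (v *m M)) => x Ax; rewrite mulmx0 add0r.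
by apply/cvg_lim; [exact: norm_hausdorff|exact: df].
Unshelve. all: by end_near. Qed.

Section Signs.
Variable fs : seq (afun (R := R) (n := n.+1)).
Local Notation signs := ((size fs).-tuple bool).

Definition signed (b : bool) (f : afun (R := R) (n := n.+1)) :=
  if b then f else afun_neg f.

Definition sign_cell (s : signs) : set V :=
  cell (simplex_funs ++ [seq signed p.1 p.2 | p <- zip s fs]).

Lemma sign_cellP (s : signs) (x : V) : sign_cell s x <->
  Sd x /\ forall i, (i < size fs)%N ->
    0 < ev (signed (nth true s i) (nth (0, 0) fs i)) x.
Proof.
have sz : size (zip s fs) = size fs by rewrite size1_zip size_tuple.
rewrite Sd_cell; split.
  move=> h; split.
    by move=> g gs; apply: h; rewrite mem_cat gs.
  move=> i ifs; apply: h; rewrite mem_cat; apply/orP; right.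
  apply/mapP; exists (nth (true, (0, 0)) (zip s fs) i); first by rewrite mem_nth ?sz.
  by rewrite nth_zip ?size_tuple.
move=> [h1 h2] g; rewrite mem_cat => /orP[/h1 //|/mapP[p]].
move=> /(nthP (true, (0, 0)))[i]; rewrite sz => ifs <- ->.
by rewrite nth_zip ?size_tuple //; exact: h2.
Qed.

Lemma sign_cell_sign (s : signs) (x : V) i : (i < size fs)%N -> sign_cell s x ->
  ev (nth (0, 0) fs i) x != 0 /\ (0 < ev (nth (0, 0) fs i) x) = nth true s i.
Proof.
move=> ifs /sign_cellP[_ /(_ i ifs)]; case: (nth true s i) => /= h.
  by rewrite h gt_eqF.
by move: h; rewrite ev_neg oppr_gt0 => h; rewrite lt_eqF // ltNge ltW.
Qed.

Definition sign_atom (w : 'I_#|{: signs}|) : set V := sign_cell (enum_val w).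

(** Outside of finitely many hyperplanes, the simplex is the disjoint union of
    the cells on which every one of the given affine functions has a constant
    sign. *)
Lemma sign_atoms_atomic (H : V -> V) :
  (forall f, f \in fs -> f.1 != 0) ->
  (forall x, Sd x -> Sd (H x)) ->
  (forall x0, Sd x0 -> exists M c, forall x, Sd x ->
    (forall f, f \in fs -> ev f x0 != 0 /\ ev f x != 0 /\
       (0 < ev f x) = (0 < ev f x0)) ->
    H x = x *m M + c) ->
  atomic_collection H sign_atom.
Proof.
move=> fs0 HSd Haff; split.
- move=> w; have sub : sign_atom w `<=` Sd by move=> x /sign_cellP[].
  by split => //; apply: open_polytope_cell; exact: bounded_Sd.
- move=> w w' _ _ [x [xw xw']]; apply: enum_val_inj; apply: val_inj.
  apply: (@eq_from_nth _ true); rewrite !size_tuple // => i ifs.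
  by rewrite -(sign_cell_sign ifs xw).2 (sign_cell_sign ifs xw').2.
- apply: content0_lebesgue.
  apply: (@sub_content0 _ _ _ (\big[setU/set0]_(f <- fs)
     [set x : V | (forall j, 0 <= x 0 j < 1) /\ ev f x = 0])); last first.
    elim: (fs) fs0 => [|f t IH] t0; first by rewrite big_nil; exact: content0_set0.
    rewrite big_cons; apply: content0U.
      by apply: hyperplane_content0; apply: t0; rewrite inE eqxx.
    by apply: IH => g gt; apply: t0; rewrite inE gt orbT.
  move=> x [Sx nx]; rewrite -bigcup_seq /=; apply: contrapT => nz; apply: nx.
  have fx f : f \in fs -> ev f x != 0.
    move=> ffs; apply/eqP => fx0; apply: nz; exists f => //; split => //.
    by move=> j; have /andP[/ltW -> ->] := Sd_coord_lt1 Sx j.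
  pose s : signs := map_tuple (fun f => 0 < ev f x) (in_tuple fs).
  exists (enum_rank s) => //; rewrite /sign_atom enum_rankK.
  apply/sign_cellP; split => // i ifs.
  rewrite (nth_map (0, 0)) // /signed; case: ifPn => // h.
  rewrite ev_neg oppr_gt0 lt_neqAle fx ?mem_nth //=.
  by rewrite leNgt.
- move=> w; have oA : open (sign_atom w) by exact: cell_open.
  have [w0|/eqP/set0P[x0 x0w]] := pselect (sign_atom w = set0).
    by apply: (smooth_on_affine (M := 0) (c := 0)) => // x; rewrite w0.
  have Sx0 : Sd x0 by case/sign_cellP: (x0w).
  have [M [c Hc]] := Haff x0 Sx0.
  apply: (smooth_on_affine (M := M) (c := c)) => // x xw.
  have Sx : Sd x by case/sign_cellP: (xw).
  apply: Hc => // f /(nthP (0, 0))[i ifs <-].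
  have [h1 ->] := sign_cell_sign ifs xw; have [h2 ->] := sign_cell_sign ifs x0w.
  by [].
- by move=> w _ [x /sign_cellP[Sx _] <-]; exact: HSd.
Qed.
End Signs.
End SimplexCells.

(** * The map near the vertices *)

Section GNearVertices.
Context {R : realType} {d : nat}.
Local Notation V := 'rV[R]_d.

(** On [Aset j] this is the homothety of ratio [a] centred at the [j]-th vertex;
    the common formula comes from [x_i > 1/2] singling out that vertex. *)
Definition vertex_dilation (a : R) (x : V) : V :=
  \row_i (a * x 0 i + (if 2^-1 < x 0 i then 1 - a else 0)).

Lemma floor_shift (z : int) (t : R) : 0 <= t < 1 -> Num.floor (t + z%:~R) = z.
Proof. by move=> t01; apply: floor_def; rewrite intrD; lra. Qed.

Lemma int_shift (z : int) (t : R) : 0 < t < 1 -> t + z%:~R \isn't a Num.int.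
Proof.
move=> t01; rewrite intrEfloor floor_shift; last by lra.
by apply/eqP; lra.
Qed.

Section Cut.
Variables (a : R) (j : nat) (x : V).
Hypotheses (a12 : 1 < a < 2) (jd : (j <= d)%N) (Ax : Aset j x).

Let Sx : Sd x. Proof. by case: Ax. Qed.
Let x_gt0 k : 0 < x 0 k. Proof. by case: Sx. Qed.

Let U (m : nat) : R := \sum_(k < d | (k < m)%N) x 0 k.

Let US (k : 'I_d) : U k.+1 = U k + x 0 k.
Proof.
rewrite /U (bigD1 k) ?ltnS //= addrC; congr (_ + _); apply: eq_bigl => i.
by rewrite ltnS -val_eqE /= [RHS]ltn_neqAle andbC.
Qed.

Let U_nd m p : (m <= p)%N -> U m <= U p.
Proof.
move=> mp; rewrite /U [leRHS](bigID (fun k : 'I_d => (k < m)%N)) /=.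
rewrite [X in _ <= X + _](eq_bigl (fun k : 'I_d => (k < m)%N)) => [|k].
  by rewrite lerDl; apply: sumr_ge0 => k _; exact: ltW.
by rewrite andb_idl // => /leq_trans; apply.
Qed.

Let U_lt (m p : 'I_d.+1) : (m < p)%N -> U m < U p.
Proof.
move=> mp; have md : (m < d)%N by apply: leq_trans mp _; rewrite -ltnS.
apply: lt_le_trans (U_nd mp); rewrite (US (Ordinal md)).
by rewrite ltrDl.
Qed.

Let U0 : U 0 = 0. Proof. by rewrite /U big1. Qed.

Let U_ge0 m : 0 <= U m. Proof. by rewrite -U0; exact: U_nd. Qed.

Let Ud : U d = cosum x 1 d.
Proof. by rewrite cosum_all /U; apply: eq_bigl => k; rewrite ltn_ord. Qed.

Let Ud_lt1 : U d < 1. Proof. by rewrite Ud; case: Sx. Qed.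

Let U_le (m : 'I_d.+1) : U m <= U d.
Proof. by apply: U_nd; rewrite -ltnS. Qed.

(* The points on the left of the gap larger than 1/2 are moved one turn to the
   right: then all the points lie within a distance 1/2 of one another. *)
Let s (i : nat) : R := (i < j)%N%:R.

Let v (i : nat) : R := U i + s i.

(* Two points are at a distance larger than 1/2 exactly when they lie on the two
   sides of the [j]-th gap. *)
Let gap (i m : 'I_d.+1) : (i < m)%N ->
  (s i = s m /\ 0 < U m - U i < 2^-1) \/
  (s i = 1 /\ s m = 0 /\ 2^-1 < U m - U i < 1).
Proof.
move=> im; have := U_lt im; rewrite /s.
have := U_le m; have := U_ge0 i; have := Ud_lt1.
case: Ax => _; case: eqP => [-> /=|/eqP j0].
  by rewrite -Ud ?ltn0 => *; left; split => //; lra.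
have jd' : (j.-1 < d)%N by rewrite prednK // lt0n.
have jE : j = (Ordinal jd').+1 by rewrite /= prednK // lt0n.
rewrite {1}jE co_ord.
have := US (Ordinal jd'); rewrite -jE => Uj xj.
have := U_nd jd; have := U_ge0 j.-1; rewrite /= in Uj *.
case: (ltnP i j) => ij; case: (ltnP m j) => mj.
- have : U m <= U j.-1 by apply: U_nd; rewrite -ltnS prednK // lt0n.
  by move=> *; left; split => //; lra.
- have := U_nd mj; have : U i <= U j.-1 by apply: U_nd; rewrite -ltnS prednK // lt0n.
  by move=> *; right; do 2 split => //; lra.
- by exfalso; have := leq_trans (ltn_trans im mj) ij; rewrite ltnn.
- by have := U_nd ij; move=> *; left; split => //; lra.
Qed.

Let v_close (i m : 'I_d.+1) : i != m -> 0 < `|v m - v i| < 2^-1.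
Proof.
wlog im : i m / (i < m)%N.
  move=> h; rewrite neq_ltn => /orP[im|mi].
    by apply: h => //; rewrite neq_ltn im.
  by rewrite distrC; apply: h => //; rewrite neq_ltn mi.
move=> _; rewrite /v; case: (gap im) => [[-> h]|[-> [-> h]]].
  by rewrite ger0_norm; lra.
by rewrite ltr0_norm; lra.
Qed.

Let s_int i : exists z : int, s i = z%:~R.
Proof. by exists (i < j)%N; rewrite /s. Qed.

Let gfunE (i m : 'I_d.+1) : gfun (U m - U i) = v m - v i.
Proof.
have vmi : `|v m - v i| < 2^-1.
  by have [->|/v_close/andP[]] := eqVneq i m; rewrite ?subrr ?normr0.
rewrite /gfun; have [z1 h1] := s_int i; have [z2 h2] := s_int m.
have -> : U m - U i + 2^-1 = (v m - v i + 2^-1) + (z1 - z2)%:~R.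
  by rewrite /v h1 h2 intrB; ring.
rewrite floor_shift; last by move: vmi; rewrite ltr_norml; lra.
by rewrite /v h1 h2 intrB; ring.
Qed.

Let scale_lt1 (t : R) : 0 < t < 2^-1 -> 0 < a * t < 1.
Proof.
move=> /andP[t0 t1]; move: a12 => /andP[a1 a2].
rewrite mulr_gt0 /=; [|lra|done].
apply: (@lt_trans _ _ (2 * t)); last by lra.
by rewrite ltr_pM2r.
Qed.

Let u (i : 'I_d.+1) : R := U i.
Let eps : R := 1 - a / 2.
Let drift : R := 2 * (eps / d.+1%:R * \sum_(m < d.+1) v m).

Let wE (i : 'I_d.+1) : wG eps u i = a * v i - 2 * s i + drift.
Proof.
rewrite /wG (eq_bigr (fun m : 'I_d.+1 => v m - v i)); last first.
  by move=> m _; exact: gfunE.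
have N0 : d.+1%:R != 0 :> R by rewrite pnatr_eq0.
rewrite sumrB sumr_const cardT size_enum_ord -[v i *+ _]mulr_natl /drift.
have -> : u i = v i - s i by rewrite /v addrK.
by rewrite /eps; field.
Qed.

Let s_last : s d = 0. Proof. by rewrite /s ltnNge jd. Qed.

(* Hence [zG] is increasing in the index, and no sorting takes place in [yG]. *)
Let zE (i : 'I_d.+1) :
  zG eps u i = a * U i + (a - 1) * s i + (drift - (Num.floor (wG eps u ord_max))%:~R).
Proof.
rewrite /zG /= (_ : Num.floor _ = (i < j)%N).
  by rewrite [X in X + _ - _]wE /v -/(s i) /s; ring.
rewrite !wE /= s_last.
have -> : a * v d - 2 * 0 + drift - (a * v i - 2 * s i + drift)
    = (a * (v d - v i) + s i) + (Posz (i < j)%N)%:~R.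
  by rewrite -[(Posz _)%:~R]/(s i); ring.
apply: floor_shift; rewrite /v /= s_last.
have [->|im] := eqVneq i ord_max; first by rewrite /= s_last; lra.
have {}im : (i < @ord_max d)%N.
  by rewrite ltn_neqAle im -ltnS ltn_ord.
case: (gap im) => /= [[h1 h2]|[h1 [h2 h3]]].
  by rewrite s_last in h1; rewrite h1 !addr0; have := scale_lt1 h2; lra.
have : 0 < 1 - (U d - U i) < 2^-1 by lra.
by move/scale_lt1; rewrite h1; lra.
Qed.

Let z_lt (i m : 'I_d.+1) : (i < m)%N -> zG eps u i <= zG eps u m.
Proof.
move=> im; rewrite !zE; have [[-> h]|[-> [-> h]]] := gap im.
  by have := scale_lt1 h; lra.
have : 0 < 1 - (U m - U i) < 2^-1 by lra.
by move/scale_lt1; lra.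
Qed.

Let nondeg : Defs.nondegenerate eps u.
Proof.
split=> i m.
  have vmi : `|v m - v i| < 2^-1.
    by have [->|/v_close/andP[]] := eqVneq i m; rewrite ?subrr ?normr0.
  have [z1 h1] := s_int i; have [z2 h2] := s_int m.
  have -> : u m - u i - 2^-1 = (v m - v i + 2^-1) + (z1 - z2 - 1)%:~R.
    by rewrite /u /v h1 h2 !intrB; lra.
  by apply: int_shift; move: vmi; rewrite ltr_norml; lra.
move=> im; have := v_close im; rewrite distrC !wE.
have [z1 h1] := s_int i; have [z2 h2] := s_int m.
rewrite h1 h2; case: (ltP (v i) (v m)) => vim.
  rewrite ltr0_norm ?subr_lt0 // => h.
  have -> : a * v i - 2 * z1%:~R + drift - (a * v m - 2 * z2%:~R + drift) =
    (a * (v i - v m) + 1) + (z2 + z2 - (z1 + z1) - 1)%:~R.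
    by rewrite !intrB !intrD; ring.
  by apply: int_shift; have := scale_lt1 h; lra.
rewrite ger0_norm ?subr_ge0 // => h.
have -> : a * v i - 2 * z1%:~R + drift - (a * v m - 2 * z2%:~R + drift) =
  (a * (v i - v m)) + (z2 + z2 - (z1 + z1))%:~R.
  by rewrite !intrB !intrD; ring.
by apply: int_shift; exact: scale_lt1 h.
Qed.

Let yE (i : nat) (id : (i <= d)%N) : (yG eps u)`_i = zG eps u (inord i).
Proof.
pose wd := widen_ord (leqnSn d).
have srt : sorted <=%R [seq zG eps u (wd k) | k <- enum 'I_d].
  apply: (@homo_sorted _ _ _ (relpre val ltn)).
    by move=> k l kl; exact: z_lt.
  by rewrite -sorted_map val_enum_ord iota_ltn_sorted.
rewrite /yG sort_le_id // nth_rcons size_map size_enum_ord.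
have iN : (inord i : 'I_d.+1) = i :> nat by rewrite inordK.
case: ltnP => [h|h].
  rewrite (nth_map (Ordinal h)) ?size_enum_ord //.
  rewrite (_ : nth _ _ _ = Ordinal h); last first.
    exact: (nth_ord_enum _ (Ordinal h)).
  by congr zG; apply: val_inj; rewrite /= iN.
have ed : i = d by apply/eqP; rewrite eqn_leq id.
rewrite ed eqxx; congr zG; by apply: val_inj; rewrite /= inordK.
Qed.

Lemma G_graph_vertex_dilation : G_graph (1 - a / 2) x (vertex_dilation a x).
Proof.
split=> //; exists u; split => //.
  by move=> i; rewrite /u /= /bump leq0n add1n US addrC addKr.
apply/rowP => i; rewrite !mxE !yE ?(ltnW (ltn_ord i)) // !zE.
have e1 : (inord i.+1 : 'I_d.+1) = i.+1 :> nat by rewrite inordK // ltnS.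
have e0 : (inord i : 'I_d.+1) = i :> nat by rewrite inordK // ltnS ltnW.
rewrite e1 e0 US.
suff -> : (if 2^-1 < x 0 i then 1 - a else 0) = (a - 1) * (s i.+1 - s i) by ring.
have sE : s i.+1 - s i = - (i.+1 == j)%:R.
  rewrite /s; have [h|h|h] := ltngtP i.+1 j.
  - by rewrite subrr oppr0.
  - by rewrite subrr oppr0.
  - by rewrite sub0r.
rewrite sE; have [ij|/eqP ij] := eqVneq i.+1 j.
  by case: Ax => _; rewrite -ij /= co_ord => ->; rewrite mulr1n; ring.
case: ltP => [xi|_]; last by rewrite mulr0n; ring.
exfalso; case: Ax => Sd_x; have [x0 sx] := Sd_x; move: sx; rewrite cosum_all.
case: eqP => [_|/eqP j0].
  rewrite (bigD1 i) //=.
  have : 0 <= \sum_(k < d | k != i) x 0 k by apply: sumr_ge0 => k _; exact: ltW.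
  by lra.
have jd' : (j.-1 < d)%N by rewrite prednK // lt0n.
have jE : j = (Ordinal jd').+1 by rewrite /= prednK // lt0n.
rewrite {1}jE co_ord (bigD1 i) //= (bigD1 (Ordinal jd')) /=; last first.
  by apply/eqP => ji; apply: ij; rewrite jE -ji.
have : 0 <= \sum_(k < d | (k != i) && (k != Ordinal jd')) x 0 k.
  by apply: sumr_ge0 => k _; exact: ltW.
by lra.
Qed.

End Cut.
End GNearVertices.

(** * Barycentric coordinates and the inversion *)

Section Barycentric.
Context {R : realType} {n : nat}.
Local Notation d := n.+3.
Local Notation V := 'rV[R]_d.
Implicit Types x : V.

(** The [d + 1] barycentric coordinates; the one of index 0 is attached to the
    origin. *)
Definition bary x (i : nat) : R := if i == 0%N then 1 - cosum x 1 d else co x i.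

Lemma bary_ord x (j : 'I_d) : bary x j.+1 = x 0 j.
Proof. by rewrite /bary /= co_ord. Qed.

Lemma bary_inj x y : (forall i, (i <= d)%N -> bary x i = bary y i) -> x = y.
Proof. by move=> xy; apply/rowP => j; rewrite -!bary_ord; apply: xy. Qed.

Lemma sum_bary x : \sum_(0 <= i < d.+1) bary x i = 1.
Proof.
rewrite big_nat_recl // {1}/bary /= -[RHS](subrK (cosum x 1 d)); congr (_ + _).
by rewrite /cosum big_add1.
Qed.

Lemma SdP x : Sd x <-> forall i, (i <= d)%N -> 0 < bary x i.
Proof.
split=> [[x0 x1] [_|i id]|h].
- by rewrite /bary /= subr_gt0.
- by rewrite (bary_ord x (Ordinal id)).
- split=> [j|]; first by rewrite -bary_ord; exact: h.
  by have := h 0%N isT; rewrite /bary /= subr_gt0.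
Qed.

Lemma AsetP x j : (j <= d)%N -> Aset j x <-> Sd x /\ 2^-1 < bary x j.
Proof.
move=> jd; rewrite /Aset /= /bary; case: eqP => // _.
by split => -[Sx h]; split => //; lra.
Qed.

Lemma Aset_others x j i : (j <= d)%N -> (i <= d)%N -> i != j -> Aset j x ->
  bary x i < 2^-1.
Proof.
move=> jd id ij /(AsetP x jd)[/SdP x0 xj]; have := sum_bary x.
rewrite big_mkord (bigD1 (inord j)) //= (bigD1 (inord i)) /=; last first.
  by apply: contraNneq ij => /(congr1 val); rewrite /= !inordK // => ->.
rewrite !inordK //.
have : 0 <= \sum_(k < d.+1 | (k != inord j) && (k != inord i)) bary x k.
  by apply: sumr_ge0 => k _; apply/ltW/x0; rewrite -ltnS.
by lra.
Qed.

(** The inversion reverses the order of the vertices; the properties of [sigma]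
    below are read off from this. *)
Lemma bary_sigma x i : (i <= d)%N -> bary (sigma x) i = bary x (d - i).
Proof.
have pos k : (k < d)%N -> bary (sigma x) k.+1 = bary x (d - k.+1).
  move=> kd; rewrite (bary_ord _ (Ordinal kd)) mxE /=; case: eqP => [->|/eqP kd'].
    by rewrite subnn.
  by rewrite /bary subn_eq0 leqNgt ltn_neqAle kd' kd.
case: i => [_|i id]; last exact: pos.
have := sum_bary (sigma x); rewrite big_nat_recl // => s1.
have := sum_bary x; rewrite big_nat_recr //= subn0 => s2.
apply: (@addIr _ (\sum_(0 <= k < d) bary (sigma x) k.+1)); rewrite s1 -s2 addrC.
congr (_ + _); rewrite big_nat_rev /= big_nat [RHS]big_nat.
by apply: eq_bigr => k /andP[_ kd]; rewrite add0n pos.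
Qed.

Lemma sigmaK : involutive (sigma : V -> V).
Proof.
by move=> x; apply: bary_inj => i id; rewrite !bary_sigma ?leq_subr // subKn.
Qed.

Lemma Sd_sigma x : Sd (sigma x) <-> Sd x.
Proof.
split=> /SdP h; apply/SdP => i id.
  by rewrite -[x]sigmaK bary_sigma // h ?leq_subr.
by rewrite bary_sigma // h ?leq_subr.
Qed.

Lemma Aset_sigma x j : (j <= d)%N -> Aset j (sigma x) <-> Aset (d - j) x.
Proof.
move=> jd; rewrite !AsetP ?leq_subr // bary_sigma //.
by split=> -[/Sd_sigma Sx h].
Qed.

Definition sigma_mx : 'M[R]_d :=
  \matrix_(i, j) (if j.+1 == d then -1 else (i.+1 == (d - j.+1)%N :> nat)%:R).
Definition sigma_cst : V := \row_j (j.+1 == d)%:R.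

Lemma sigma_affine x : sigma x = x *m sigma_mx + sigma_cst.
Proof.
apply/rowP => j; rewrite !mxE; case: eqP => [jd|jd].
  rewrite cosum_all addrC -sumrN; congr (_ + _); apply: eq_bigr => i _.
  by rewrite mxE jd eqxx mulrN1.
rewrite addr0 /co big_mkcond; apply: eq_bigr => i _; rewrite mxE.
by move/eqP/negbTE: jd => ->; case: eqP; rewrite ?mulr1 ?mulr0.
Qed.

Lemma sigma_mx_unit : sigma_mx \in unitmx.
Proof.
have S2 : sigma_mx *m sigma_mx = 1%:M.
  apply/row_matrixP => i; rewrite row_mul [row i sigma_mx]rowE row1.
  have h x : x *m sigma_mx *m sigma_mx = x.
    have := sigmaK x; have := sigmaK 0; rewrite !sigma_affine mul0mx add0r.
    by rewrite mulmxDl -addrA => -> ; rewrite addr0.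
  exact: h.
by case/mulmx1_unit: S2.
Qed.

(** The coordinate 0 obeys the same rule as the others, because the coordinates
    of the image sum up to 1 as well. *)
Lemma vertex_dilation_bary (a : R) x j i : (j <= d)%N -> (i <= d)%N -> Aset j x ->
  bary (vertex_dilation a x) i =
  a * bary x i + (if 2^-1 < bary x i then 1 - a else 0).
Proof.
move=> jd id Ax.
have pos k : (k < d)%N -> bary (vertex_dilation a x) k.+1 =
    a * bary x k.+1 + (if 2^-1 < bary x k.+1 then 1 - a else 0).
  by move=> kd; rewrite !(bary_ord _ (Ordinal kd)) mxE.
case: i id => [_|i id]; last exact: pos.
have := sum_bary (vertex_dilation a x); rewrite big_nat_recl // => s1.
have : \sum_(0 <= i < d.+1) (a * bary x i + (if 2^-1 < bary x i then 1 - a else 0)) = 1.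
  rewrite big_split /= -mulr_sumr sum_bary mulr1 big_mkord.
  rewrite (bigD1 (inord j)) //= inordK // big1 => [|k kj].
    by have /(AsetP x jd)[_ ->] := Ax; rewrite addr0; ring.
  rewrite ltNge ltW //; apply: (Aset_others jd) Ax; first by rewrite -ltnS.
  by apply: contraNneq kj => kj; apply/eqP/val_inj; rewrite /= inordK.
rewrite big_nat_recl // => s2; move: (etrans s2 (esym s1)).
suff -> : \sum_(0 <= k < d) (a * bary x k.+1 +
      (if 2^-1 < bary x k.+1 then 1 - a else 0)) =
    \sum_(0 <= k < d) bary (vertex_dilation a x) k.+1 by move/addIr.
by apply: eq_big_nat => k /andP[_ kd]; rewrite pos.
Qed.

(** The region where the map is prescribed. *)
Definition inA x : Prop := exists j, (j <= d)%N /\ Aset j x.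

Lemma inA_sigma x : inA (sigma x) <-> inA x.
Proof.
have h y : inA y -> inA (sigma y).
  move=> [j [jd Ay]]; exists (d - j)%N; rewrite leq_subr; split => //.
  by rewrite Aset_sigma ?leq_subr // subKn.
by split=> /h //; rewrite sigmaK.
Qed.

Lemma vertex_dilation_sigma (a : R) x : inA x ->
  vertex_dilation a (sigma x) = sigma (vertex_dilation a x).
Proof.
move=> Ax; have [j' [jd' Asx]] : inA (sigma x) by apply/inA_sigma.
case: Ax => j [jd Ax]; apply: bary_inj => i id.
rewrite (vertex_dilation_bary a jd' id Asx) !bary_sigma //.
by rewrite (vertex_dilation_bary a jd _ Ax) ?leq_subr.
Qed.

Lemma vertex_dilation_Sd (a : R) x : 1 < a < 2 -> inA x -> Sd (vertex_dilation a x).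
Proof.
move=> a12 [j [jd Ax]]; apply/SdP => i id; rewrite (vertex_dilation_bary a jd id Ax).
have /(AsetP x jd)[/SdP/(_ i id) xi _] := Ax.
by case: (ltP 2^-1 (bary x i)) => h; [nra|rewrite addr0 mulr_gt0 //; lra].
Qed.

End Barycentric.

(** * Gluing an affine branch into a symmetric map *)

Section Gluing.
Context {R : realType} {n : nat}.
Local Notation d := n.+3.
Local Notation V := 'rV[R]_d.
Local Notation afun := (afun (R := R) (n := d)).
Implicit Types x : V.
Variables (a : R) (L : 'M[R]_d) (b : V).
Hypotheses (a12 : 1 < a < 2) (L_unit : L \in unitmx).

Let affine_map x : V := x *m L + b.

(* The signs of these functions decide which of the [Aset j] contains a point. *)
Definition vertex_funs : seq afun :=
  (const_mx (-1), 2^-1) :: [seq (delta_mx j 0, - 2^-1) | j <- enum 'I_d].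

(* The inequalities defining [Bset 1] inside the simplex. *)
Definition edge_funs : seq afun :=
  [:: (- delta_mx 0 0, 2^-1); (const_mx (-1) + delta_mx 0 0, 2^-1);
      (delta_mx 0 0 + delta_mx 1 0, - 2^-1)].

Definition branch_funs : seq afun :=
  edge_funs ++ [seq afun_comp g L b | g <- simplex_funs].

(** The part of [Bset 1] which the affine branch maps into the simplex. *)
Definition branch_domain : set V :=
  [set x | Sd x /\ forall g, g \in branch_funs -> 0 < ev g x].

Definition glued_map (x : V) : V :=
  if `[< inA x >] then vertex_dilation a x
  else if `[< branch_domain x >] then affine_map x
  else if `[< branch_domain (sigma x) >] then sigma (affine_map (sigma x))
  else x.

Lemma co1 x : co x 1 = x 0 0. Proof. exact: (co_ord x 0). Qed.
Lemma co2 x : co x 2 = x 0 1.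
Proof. by have := co_ord x 1. Qed.

Lemma cosum2 x : cosum x 2 d = cosum x 1 d - co x 1.
Proof. by rewrite /cosum [in RHS]big_ltn //= addrC addKr. Qed.

Lemma ev_delta x j c : ev (delta_mx j 0, c) x = x 0 j + c.
Proof. by have := ev_coord j x; rewrite /ev /= addr0 => ->. Qed.

Lemma ev_const x c : ev (const_mx (-1), c) x = c - cosum x 1 d.
Proof.
by have := ev_simplex0 x; rewrite /ev /= cosum_all => e; lra.
Qed.

Lemma mulmxN00 x (c : 'cV[R]_d) : (x *m - c) 0 0 = - (x *m c) 0 0.
Proof. by rewrite mulmxN mxE. Qed.

Lemma mulmxD00 x (c c' : 'cV[R]_d) : (x *m (c + c')) 0 0 = (x *m c) 0 0 + (x *m c') 0 0.
Proof. by rewrite mulmxDr mxE. Qed.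

Lemma edge_funsP x : Sd x ->
  (forall g, g \in edge_funs -> 0 < ev g x) <-> Bset 1 x.
Proof.
move=> Sx.
have e1 : ev (- delta_mx 0 0, 2^-1) x = 2^-1 - co x 1.
  by have := ev_delta x 0 0; rewrite /ev /= mulmxN00 co1 => e; lra.
have e2 : ev (const_mx (-1) + delta_mx 0 0, 2^-1) x = 2^-1 - cosum x 2 d.
  have := ev_delta x 0 0; have := ev_const x 0; rewrite /ev /= mulmxD00.
  by rewrite cosum2 co1 => h1 h2; lra.
have e3 : ev (delta_mx 0 0 + delta_mx 1 0, - 2^-1) x = co x 1 + co x 2 - 2^-1.
  have := ev_delta x 0 0; have := ev_delta x 1 0; rewrite /ev /= mulmxD00.
  by rewrite co1 co2 => h1 h2; lra.
split=> [h|[_ [h1 h2 h3]] g].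
  split => //=; split.
  - by have := h _ (mem_nth (0, 0) (isT : (0 < size edge_funs)%N)); rewrite e1 subr_gt0.
  - by have := h _ (mem_nth (0, 0) (isT : (1 < size edge_funs)%N)); rewrite e2 subr_gt0.
  - by have := h _ (mem_nth (0, 0) (isT : (2 < size edge_funs)%N)); rewrite e3 subr_gt0.
by rewrite !inE => /or3P[] /eqP ->; rewrite ?e1 ?e2 ?e3 subr_gt0.
Qed.

Lemma branch_domainP x : branch_domain x <-> Bset 1 x /\ Sd (affine_map x).
Proof.
split=> [[Sx h]|[Bx Sy]].
  split.
    apply/edge_funsP => // g gE; apply: h; rewrite mem_cat gE //.
  rewrite Sd_cell => g gs; rewrite -ev_comp; apply: h.
  by rewrite mem_cat; apply/orP; right; apply/mapP; exists g.
have Sx : Sd x by case: Bx.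
split => // g; rewrite mem_cat => /orP[gE|/mapP[g' gs ->]].
  by move/(edge_funsP Sx): Bx; apply.
by rewrite ev_comp; move: Sy; rewrite Sd_cell; apply.
Qed.

Lemma B1_bary x : Bset 1 x -> [/\ bary x 1 < 2^-1,
  2^-1 < bary x 0 + bary x 1 & 2^-1 < bary x 1 + bary x 2].
Proof.
by move=> [_ /=]; rewrite cosum2 /bary /= => -[h1 h2 h3]; split; lra.
Qed.

(** Source of all the disjointness statements: too many large coordinates do not
    fit into a total of 1. *)
Lemma sum_bary_uniq x (s : seq nat) : Sd x -> uniq s -> all (leq^~ d) s ->
  \sum_(i <- s) bary x i <= 1.
Proof.
move=> /SdP x0 us sd; rewrite -(sum_bary x) [leRHS](bigID (mem s)) /=.
rewrite -[\sum_(0 <= i < _ | _ \in _) _]big_filter.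
have pe : perm_eq [seq i <- index_iota 0 d.+1 | i \in s] s.
  apply: uniq_perm => //; first by rewrite filter_uniq // iota_uniq.
  move=> i; rewrite mem_filter mem_index_iota /= ltnS andb_idr // => si.
  by move/allP: sd; apply.
rewrite (perm_big _ pe) lerDl big_nat_cond; apply: sumr_ge0 => i /andP[/andP[_ id] _].
by apply/ltW/x0.
Qed.

Lemma B1_notinA x : Bset 1 x -> ~ inA x.
Proof.
move=> Bx [j [jd Ax]]; have [h1 h2 h3] := B1_bary Bx.
have /(AsetP x jd)[Sx xj] := Ax.
case: j jd {Ax} xj => [|[|j]] jd xj; last 1 first.
- have := @sum_bary_uniq x [:: 0; 1; j.+2]%N Sx isT.
  rewrite /= jd => /(_ isT); rewrite !big_cons big_nil; lra.
- have := @sum_bary_uniq x [:: 0; 1; 2]%N Sx isT isT.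
  by rewrite !big_cons big_nil; lra.
- by lra.
Qed.

Lemma B1_sigma_disjoint x : Bset 1 x -> ~ Bset 1 (sigma x).
Proof.
move=> Bx Bsx; have [_ h2 _] := B1_bary Bx; have [_ h4 _] := B1_bary Bsx.
have Sx : Sd x by case: Bx.
have us : uniq [:: 0; 1; n.+2; n.+3]%N by rewrite /= !inE !eqSS ltn_eqF.
have ds : all (leq^~ d) [:: 0; 1; n.+2; n.+3]%N by rewrite /= leqnn leqnSn.
have := sum_bary_uniq Sx us ds.
by move: h4; rewrite !bary_sigma // subn0 subn1 /= !big_cons big_nil; lra.
Qed.

Lemma Bset_sigma x : Bset 1 x -> Bset d.-1 (sigma x).
Proof.
move=> Bx; have [h1 h2 h3] := B1_bary Bx; have Sx : Sd x by case: Bx.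
split; first by apply/Sd_sigma.
have c k : (0 < k <= d)%N -> co (sigma x) k = bary x (d - k).
  by case: k => // k kd; rewrite -bary_sigma.
rewrite /= (ltn_eqF (ltnSn n.+2)).
have k1 : (n < d)%N := leqW (leqnSn n.+1).
rewrite (c n.+1) // (c n.+2) ?leqnSn // (c n.+3) ?leqnn //.
have e2 : (d - n.+1 = 2)%N by rewrite subSn ?subSnn.
rewrite e2 subnn subSnn.
by split; lra.
Qed.

Lemma glued_map_Sd x : Sd x -> Sd (glued_map x).
Proof.
move=> Sx; rewrite /glued_map; case: asboolP => [/vertex_dilation_Sd|_]; first exact.
case: asboolP => [/branch_domainP[] //|_].
by case: asboolP => [/branch_domainP[_] //|_] //; move/Sd_sigma.
Qed.

Lemma glued_map_sigma x : glued_map (sigma x) = sigma (glued_map x).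
Proof.
rewrite /glued_map sigmaK.
case: (asboolP (inA x)) => [Ax|nA].
  by rewrite asboolT ?vertex_dilation_sigma //; apply/inA_sigma.
rewrite asboolF; last by move/inA_sigma.
case: (asboolP (branch_domain x)) => [/branch_domainP[Bx _]|nB].
  by rewrite asboolF // => /branch_domainP[/(B1_sigma_disjoint Bx)].
by case: asboolP => // _; rewrite sigmaK.
Qed.

Lemma glued_map_A x : inA x -> glued_map x = vertex_dilation a x.
Proof. by move=> Ax; rewrite /glued_map asboolT. Qed.

Lemma glued_map_B x : Bset 1 x -> Sd (affine_map x) -> glued_map x = affine_map x.
Proof.
move=> Bx Sx; rewrite /glued_map asboolF; last exact: B1_notinA.
by rewrite asboolT //; apply/branch_domainP.
Qed.

(** Their signs at a point determine the case of [glued_map] which applies. *)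
Definition glue_funs : seq afun :=
  vertex_funs ++ branch_funs ++
  [seq afun_comp g sigma_mx sigma_cst | g <- branch_funs].

Lemma const_mxN1_neq0 : const_mx (-1) != 0 :> 'cV[R]_d.
Proof.
by apply/eqP => /matrixP/(_ 0 0)/eqP; rewrite !mxE oppr_eq0 oner_eq0.
Qed.

Lemma delta_mx_neq0 (j : 'I_d) : delta_mx j 0 != 0 :> 'cV[R]_d.
Proof.
by apply/eqP => /matrixP/(_ j 0)/eqP; rewrite !mxE !eqxx oner_eq0.
Qed.

Lemma unitmx_mul_neq0 (M : 'M[R]_d) (c : 'cV[R]_d) : M \in unitmx -> c != 0 -> M *m c != 0.
Proof. by move=> uM; apply: contraNneq => h; rewrite -[c](mulKmx uM) h mulmx0. Qed.

Lemma simplex_funs_neq0 (f : afun) : f \in simplex_funs -> f.1 != 0.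
Proof.
rewrite inE => /orP[/eqP ->|/mapP[j _ ->]]; first exact: const_mxN1_neq0.
exact: delta_mx_neq0.
Qed.

Lemma branch_funs_neq0 (f : afun) : f \in branch_funs -> f.1 != 0.
Proof.
rewrite mem_cat => /orP[|/mapP[g /simplex_funs_neq0 g0 ->]]; last exact: unitmx_mul_neq0.
rewrite !inE => /or3P[] /eqP ->.
- by rewrite oppr_eq0; exact: delta_mx_neq0.
- apply/eqP => /matrixP/(_ 1 0)/eqP.
  by rewrite !mxE /= addr0 oppr_eq0 oner_eq0.
- apply/eqP => /matrixP/(_ 0 0)/eqP.
  by rewrite !mxE /= addr0 oner_eq0.
Qed.

Lemma glue_funs_neq0 (f : afun) : f \in glue_funs -> f.1 != 0.
Proof.
rewrite mem_cat => /orP[|].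
  rewrite inE => /orP[/eqP ->|/mapP[j _ ->]]; first exact: const_mxN1_neq0.
  exact: delta_mx_neq0.
rewrite mem_cat => /orP[/branch_funs_neq0 //|/mapP[g /branch_funs_neq0 g0 ->]].
by apply: unitmx_mul_neq0 => //; exact: sigma_mx_unit.
Qed.

Lemma inAP x : inA x <-> Sd x /\ exists2 f, f \in vertex_funs & 0 < ev f x.
Proof.
split=> [[[|j] [jd [Sx /= h]]]|[Sx [f]]].
- split => //; exists (const_mx (-1), 2^-1); first by rewrite inE eqxx.
  by rewrite ev_const subr_gt0.
- split => //; move: h; rewrite (co_ord x (Ordinal jd)) => h.
  exists (delta_mx (Ordinal jd) 0, - 2^-1); last by rewrite ev_delta subr_gt0.
  rewrite inE; apply/orP; right; apply/mapP; exists (Ordinal jd) => //.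
  by rewrite mem_enum.
- rewrite inE => /orP[/eqP ->|/mapP[j _ ->]].
    by rewrite ev_const subr_gt0 => h; exists 0%N; split => //; split.
  rewrite ev_delta subr_gt0 => h; exists j.+1; split => //.
  by apply/AsetP => //; rewrite bary_ord.
Qed.

Lemma glued_map_atomic : atomic_collection glued_map (sign_atom (fs := glue_funs)).
Proof.
apply: sign_atoms_atomic; [exact: glue_funs_neq0|exact: glued_map_Sd|].
move=> x0 Sx0.
pose same x := forall f, f \in glue_funs ->
  ev f x0 != 0 /\ ev f x != 0 /\ (0 < ev f x) = (0 < ev f x0).
have memA f : f \in vertex_funs -> f \in glue_funs.
  by move=> fs; rewrite mem_cat fs.
have memW f : f \in branch_funs -> f \in glue_funs.
  by move=> fs; rewrite mem_cat [X in _ || X]mem_cat fs orbT.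
have memV f : f \in branch_funs -> afun_comp f sigma_mx sigma_cst \in glue_funs.
  move=> fs; rewrite mem_cat [X in _ || X]mem_cat; apply/orP; right.
  by apply/orP; right; apply/mapP; exists f.
have sameA x : Sd x -> same x -> inA x <-> inA x0.
  move=> Sx h; rewrite !inAP; split => -[_ [f fs f0]]; split => //;
    exists f => //; have [_ [_ e]] := h f (memA f fs); first by rewrite -e.
  by rewrite e.
have sameW x : Sd x -> same x -> branch_domain x <-> branch_domain x0.
  move=> Sx h; split => -[_ W]; split => // f fs; have := W f fs;
  have [_ [_ e]] := h f (memW f fs); by rewrite e.
have sameV x : Sd x -> same x -> branch_domain (sigma x) <-> branch_domain (sigma x0).
  move=> Sx h; split => -[_ W]; (split; first exact/Sd_sigma) => f fs; have := W f fs;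
  have [_ [_]] := h _ (memV f fs); by rewrite !ev_comp -!sigma_affine => ->.
case: (pselect (inA x0)) => [A0|nA0].
  exists (a%:M), (\row_i (if 2^-1 < x0 0 i then 1 - a else 0)) => x Sx h.
  rewrite glued_map_A; last exact/(sameA x Sx h).
  rewrite mul_mx_scalar; apply/rowP => i; rewrite !mxE; congr (_ + _).
  have [|_ [_]] := h (delta_mx i 0, - 2^-1).
    apply: memA; rewrite inE; apply/orP; right.
    by apply/mapP; exists i => //; rewrite mem_enum.
  by rewrite !ev_delta !subr_gt0 => ->.
case: (pselect (branch_domain x0)) => [W0|nW0].
  exists L, b => x Sx h; rewrite /glued_map asboolF; last by move/(sameA x Sx h).
  by rewrite asboolT //; apply/(sameW x Sx h).
case: (pselect (branch_domain (sigma x0))) => [V0|nV0].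
  exists (sigma_mx *m L *m sigma_mx),
    (sigma_cst *m L *m sigma_mx + b *m sigma_mx + sigma_cst) => x Sx h.
  rewrite /glued_map asboolF; last by move/(sameA x Sx h).
  rewrite asboolF; last by move/(sameW x Sx h).
  rewrite asboolT; last exact/(sameV x Sx h).
  by rewrite !sigma_affine /affine_map !mulmxDl !mulmxA !addrA.
exists (1%:M), 0 => x Sx h.
rewrite /glued_map asboolF; last by move/(sameA x Sx h).
rewrite asboolF; last by move/(sameW x Sx h).
rewrite asboolF; last by move/(sameV x Sx h).
by rewrite mulmx1 addr0.
Qed.

Lemma branch_domain_cell : branch_domain = cell (simplex_funs ++ branch_funs).
Proof.
apply/seteqP; rewrite /branch_domain Sd_cell; split => x.
  by move=> [h1 h2] g; rewrite mem_cat => /orP[/h1|/h2].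
by move=> h; split => g gs; apply: h; rewrite mem_cat gs ?orbT.
Qed.

Lemma inA_open : open (inA : set V).
Proof.
have -> : inA = \bigcup_(f in [set f | f \in vertex_funs]) cell (rcons simplex_funs f).
  apply/seteqP; split => x.
    move=> /inAP[Sx [f fs f0]]; exists f => // g.
    rewrite mem_rcons inE => /orP[/eqP -> //|gs].
    by move: Sx; rewrite Sd_cell; apply.
  move=> [f fs h]; apply/inAP; split.
    by rewrite Sd_cell => g gs; apply: h; rewrite mem_rcons inE gs orbT.
  by exists f => //; apply: h; rewrite mem_rcons inE eqxx.
by apply: bigcup_open => f _; exact: cell_open.
Qed.

Lemma borel_open_measurable (A : set V) : open A -> measurable (A : set (borel R d)).
Proof. by move=> oA; exact: sub_sigma_algebra. Qed.

Lemma asbool_measurable (A : set V) : measurable (A : set (borel R d)) ->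
  measurable_fun setT (fun x : borel R d => `[< A x >]).
Proof.
move=> mA; apply: (measurable_fun_bool true); rewrite setTI.
rewrite (_ : _ @^-1` _ = A) //.
by apply/seteqP; split => x /=; [move/asboolP|move=> h; apply/asboolP].
Qed.

Lemma vertex_dilation_measurable :
  measurable_fun setT (vertex_dilation a : borel R d -> borel R d).
Proof.
apply: borel_measurable_fun => j.
rewrite (_ : (fun t => _) = fun x : borel R d =>
    a * (x : V) 0 j + (if 2^-1 < (x : V) 0 j then 1 - a else 0)); last first.
  by apply/funext => x; rewrite mxE.
apply: measurable_funD.
  by apply: measurable_funM; [exact: measurable_cst|exact: coord_measurable].
apply: measurable_fun_ifT; [|exact: measurable_cst|exact: measurable_cst].
by apply: measurable_fun_ltr; [exact: measurable_cst|exact: coord_measurable].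
Qed.

Lemma sigma_measurable : measurable_fun setT (sigma : borel R d -> borel R d).
Proof.
rewrite (_ : sigma = fun x : V => x *m sigma_mx + sigma_cst).
  exact: affine_measurable.
by apply/funext => x; exact: sigma_affine.
Qed.

Lemma glued_map_measurable : measurable_fun setT (glued_map : borel R d -> borel R d).
Proof.
have mL : measurable_fun setT (affine_map : borel R d -> borel R d).
  exact: affine_measurable.
have mB : measurable (branch_domain : set (borel R d)).
  by apply: borel_open_measurable; rewrite branch_domain_cell; exact: cell_open.
apply: measurable_fun_ifT; [|exact: vertex_dilation_measurable|].
  by apply: asbool_measurable; apply: borel_open_measurable; exact: inA_open.
apply: measurable_fun_ifT; [exact: asbool_measurable|exact: mL|].
apply: measurable_fun_ifT; last exact: measurable_id.
  apply: asbool_measurable; rewrite -[X in measurable X]setTI.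
  exact: sigma_measurable.
exact: (measurableT_comp sigma_measurable (measurableT_comp mL sigma_measurable)).
Qed.

End Gluing.

(** * The constants *)

Section Scalars.
Context {R : realType} (a A : R).
Hypotheses (a_gt1 : 1 < a) (a3A : a ^+ 3 <= A) (A_small : A ^+ 2 <= 2).

(** Here [A] stands for a^d. On the first coordinate, two steps of the dynamics
    act by t -> slope t - shift below 1 and t -> slope t - a shift above 1. The
    shift is such that the left end [cube_lo] is fixed ([lo_fixed]) and that the
    right branch starts from it at 1 ([lo_image]); [cube_hi] is the supremum of
    the left branch. So the two branches copy the beta-transformation. [fix0] is
    the first coordinate of the fixed point of the affine branch. *)
Definition slope : R := A ^+ 2.
Definition denom : R := 1 + a * (slope - 1).
Definition shift_amount : R := slope * (slope - 1) / denom.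
Definition cube_lo : R := slope / denom.
Definition cube_hi : R := slope - shift_amount.
Definition fix0 : R := a * A * (A + 1) / denom.

Lemma A_gta : a < A.
Proof.
have a1 := a_gt1; have aA := a3A; have A2 := A_small.
have aa : 1 < a * a by nra.
by apply: lt_le_trans a3A; rewrite !exprS expr0; nra.
Qed.

Lemma slope_gta : a < slope.
Proof.
have a1 := a_gt1; have aA := a3A; have A2 := A_small.
have Aa := A_gta; rewrite /slope expr2; by nra.
Qed.

Lemma slope_gt1 : 1 < slope. Proof. by have a1 := a_gt1; have := slope_gta; lra. Qed.

Lemma denom_gt1 : 1 < denom.
Proof.
have a1 := a_gt1; have aA := a3A; have A2 := A_small.
rewrite /denom ltrDl mulr_gt0 //; first by lra.
by have := slope_gt1; lra.
Qed.

Lemma denom_neq0 : denom != 0.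
Proof. by rewrite gt_eqF // (lt_trans _ denom_gt1). Qed.

Lemma denom_gt0 : 0 < denom. Proof. exact: lt_trans denom_gt1. Qed.

Lemma lo_gt0 : 0 < cube_lo.
Proof. by rewrite divr_gt0 ?denom_gt0 //; have := slope_gt1; lra. Qed.

Lemma shiftE : shift_amount = cube_lo * (slope - 1).
Proof. by rewrite /shift_amount /cube_lo mulrAC. Qed.

Lemma lo_fixed : slope * cube_lo - shift_amount = cube_lo.
Proof. by rewrite shiftE; ring. Qed.

Lemma lo_image : slope - a * shift_amount = cube_lo.
Proof. by rewrite /shift_amount /cube_lo /denom; field; exact: denom_neq0. Qed.

Lemma hi_lo : cube_hi - cube_lo = slope * (1 - cube_lo).
Proof. by rewrite /cube_hi shiftE; ring. Qed.

Lemma lo_lt1 : cube_lo < 1.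
Proof.
have a1 := a_gt1; have aA := a3A; have A2 := A_small.
rewrite ltr_pdivrMr ?denom_gt0 // mul1r /denom.
by have := slope_gt1; nra.
Qed.

Lemma a_lo_gt1 : 1 < a * cube_lo.
Proof.
have a1 := a_gt1; have aA := a3A; have A2 := A_small.
by rewrite mulrA ltr_pdivlMr ?denom_gt0 // mul1r /denom; lra.
Qed.

Lemma hi_gt1 : 1 < cube_hi.
Proof.
have a1 := a_gt1; have aA := a3A; have A2 := A_small.
have := hi_lo; have l1 := lo_lt1; have s1 := slope_gt1.
have : 0 < (slope - 1) * (1 - cube_lo) by rewrite mulr_gt0 // subr_gt0.
by nra.
Qed.

(** With [a_lo_gt1]: the cube enlarged by [a] lies beyond the hyperplane xi_0 = 1,
    and the cube shrunk by [a] before it. Hence the second of two steps always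
    uses the branch which the first one did not use. *)
Lemma hi_lta : cube_hi < a.
Proof.
have a1 := a_gt1; have aA := a3A; have A2 := A_small.
have -> : cube_hi = slope * (1 + (a - 1) * (slope - 1)) / denom.
  by rewrite /cube_hi /shift_amount /denom; field; exact: denom_neq0.
rewrite ltr_pdivrMr ?denom_gt0 // /denom.
have b1 := slope_gt1; have b2 : slope <= 2 by [].
move: slope b1 b2 => b b1 b2.
have : 0 < (a - 1) * (1 + (b - 1) + (a - 1) * (b - 1) - (b - 1) * (b - 1)).
  rewrite mulr_gt0 //; first by lra.
  have : 0 < (a - 1) * (b - 1) by rewrite mulr_gt0 //; lra.
  have : 0 <= (b - 1) * (2 - b) by rewrite mulr_ge0 //; lra.
  by nra.
by nra.
Qed.

Lemma fix0_gt1 : 1 < fix0.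
Proof.
have a1 := a_gt1; have aA := a3A; have A2 := A_small.
rewrite /fix0 ltr_pdivlMr ?denom_gt0 // mul1r /denom /slope.
have := A_gta; nra.
Qed.

Lemma fix0_lt2 : fix0 < 2.
Proof.
have a1 := a_gt1; have aA := a3A; have A2 := A_small.
rewrite /fix0 ltr_pdivrMr ?denom_gt0 // /denom /slope.
have Aa := A_gta.
have : 3 * (a - 1) < A - 1.
  apply: lt_le_trans (lerB a3A (lexx 1)); rewrite !exprS expr0.
  have : 0 < (a - 1) * (a - 1) * (a + 2) by rewrite !mulr_gt0 ?subr_gt0 //; lra.
  by nra.
have A1 : 1 < a * A by nra.
have : 0 < (a * A - 1) * (A - 1) by rewrite mulr_gt0 ?subr_gt0 //; lra.
by nra.
Qed.

Lemma fix0_fixed : A * A / a * fix0 - shift_amount = fix0 * (A / a).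
Proof.
have a1 := a_gt1; have aA := a3A; have A2 := A_small.
have a0 : a != 0 by rewrite gt_eqF //; lra.
rewrite /fix0 /shift_amount /denom /slope; field.
rewrite a0 /=; exact: denom_neq0.
Qed.

End Scalars.

(** Greedy choice of signs: the next term is added to the opposite of the sum so
    far, and the absolute value of the difference of two numbers in [0, 1] is
    again in [0, 1]. *)
Lemma balanced_signs (R : realType) m (b : 'I_m -> R) :
  (forall i, 0 <= b i <= 1) ->
  exists2 s : 'I_m -> R, (forall i, s i ^+ 2 = 1) & 0 <= \sum_i s i * b i <= 1.
Proof.
elim: m b => [|m IH] b b01.
  by exists (fun=> 1) => [i|]; rewrite ?expr1n // big_ord0 lexx ler01.
have [s s1 /andP[S0 S1]] := IH (fun i => b (widen_ord (leqnSn m) i)) (fun i => b01 _).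
pose s' (e : R) (i : 'I_m.+1) := if unlift ord_max i is Some k then - e * s k else e.
have s'S e : \sum_i s' e i * b i = e * (b ord_max -
    \sum_i s i * b (widen_ord (leqnSn m) i)).
  rewrite big_ord_recr /= mulrBr addrC; congr (_ + _).
    by rewrite /s' unlift_none.
  rewrite mulr_sumr -sumrN; apply: eq_bigr => i _.
  have -> : widen_ord (leqnSn m) i = lift ord_max i.
    by apply: val_inj; rewrite /= /bump leqNgt ltn_ord.
  by rewrite /s' liftK; ring.
have s'1 e : e ^+ 2 = 1 -> forall i, s' e i ^+ 2 = 1.
  move=> e1 i; rewrite /s'; case: unliftP => [k _|_] //.
  by rewrite exprMn sqrrN e1 s1 mul1r.
have /andP[B0 B1] := b01 ord_max.
case: (leP (\sum_i s i * b (widen_ord (leqnSn m) i)) (b ord_max)) => h.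
  by exists (s' 1); [apply: s'1; rewrite expr1n|rewrite s'S; lra].
by exists (s' (-1)); [apply: s'1; rewrite sqrrN expr1n|rewrite s'S; lra].
Qed.

(** ** The frame *)

Section Frame.
Context {R : realType} {n : nat}.
Local Notation d := n.+3.
Local Notation V := 'rV[R]_d.
Variable a : R.
Hypothesis a_gt1 : 1 < a.
Local Notation A := (a ^+ d).
Hypothesis A_small : A ^+ 2 <= 1 + (80 * d%:R)^-1.

(** The square of the weight of index [i] is the length, in units of the common
    length of the frame, of the [i]-th axis of the chart. It grows by the factor
    a^2 from one positive index to the next, so that a linear map multiplying the
    frame vectors by [a] divides the coordinates by [a]; it drops by the factor
    a^(2d - 2) from the index 0 to the index 1, and the coordinate is multiplied
    by a^(2d - 1) there. *)
Definition frame_weight (i : 'I_d) : R := if i == 0 then 1 else (a ^+ (d - i))^-1.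

Let a_gt0 : 0 < a. Proof. by have := a_gt1; lra. Qed.
Let a_neq0 : a != 0. Proof. by rewrite gt_eqF. Qed.
Let d_ge3 : 3 <= d%:R :> R. Proof. by rewrite ler_nat. Qed.

Lemma A_cube : a ^+ 3 <= A.
Proof. by rewrite ler_weXn2l // ltW. Qed.

Lemma A_le2 : A ^+ 2 <= 2.
Proof.
apply: le_trans A_small _.
have : (80 * d%:R)^-1 <= 1 :> R.
  by rewrite invf_le1; have := d_ge3; lra.
by move: (_^-1) => y; lra.
Qed.

Lemma weight_gt0 i : 0 < frame_weight i.
Proof. by rewrite /frame_weight; case: eqP => // _; rewrite invr_gt0 exprn_gt0. Qed.

Lemma weight_neq0 i : frame_weight i != 0. Proof. by rewrite gt_eqF ?weight_gt0. Qed.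

Lemma weight_le1 i : frame_weight i <= 1.
Proof.
rewrite /frame_weight; case: eqP => // _; rewrite invf_le1 ?exprn_gt0 //.
by rewrite exprn_ege1 // ltW.
Qed.

Lemma weight_ge i : a <= A * frame_weight i.
Proof.
have a1 : 1 <= a by apply: ltW.
rewrite /frame_weight; case: eqP => [_|i0].
  by rewrite mulr1 exprS ler_peMr ?exprn_ege1 // ltW.
rewrite ler_pdivlMr ?exprn_gt0 // -exprS ler_weXn2l //.
rewrite ltn_subrL andbT lt0n.
by apply/eqP => i0'; apply: i0; exact: val_inj.
Qed.

Lemma ordS0 : ordS (0 : 'I_d) = 1.
Proof. by apply: val_inj; rewrite /= modn_small. Qed.

Lemma weight_ordS i : i != 0 -> frame_weight (ordS i) = a * frame_weight i.
Proof.
move=> i0; rewrite /frame_weight (negbTE i0).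
have [id|id] := ltnP i.+1 d.
  have Si0 : ordS i != 0 by apply/eqP => /(congr1 val); rewrite /= modn_small.
  rewrite (negbTE Si0) /= modn_small // -(subnSK (ltnW id : i < d)%N) exprS.
  by rewrite invfM mulrA divff // mul1r.
have iE : i = n.+2 :> nat by apply/eqP; rewrite eqn_leq -ltnS ltn_ord -ltnS.
rewrite (_ : ordS i = 0) ?eqxx; last by apply: val_inj; rewrite /= iE modnn.
by rewrite iE subSnn expr1 divff.
Qed.

Lemma weight1 : frame_weight 1 = a / A.
Proof.
by rewrite /frame_weight /= subn1 /= -[LHS]mul1r -(divff a_neq0) -mulrA -invfM -exprS.
Qed.

(** The frame will be e_0 = - u_0 / 2 + gamma u_1, e_1 = g_1 u_1 and
    e_i = g_i u_1 + tau u_i, in the canonical basis. The equations say that these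
    vectors have the same length [r], and that at the point all of whose
    coordinates are inverse to the weights the second coordinate is 1/4. With
    g_i = s_i r c_i for signs s_i such that K, the sum of the s_i weight_i c_i,
    lies in [0, 1] ([balanced_signs]), the last equation gives
    gamma = 1/4 - r K and the first one becomes a quadratic equation for [r],
    solved by r (K + sqrt (5 - 4 K^2)) = 5/4. *)
Lemma frame_constants : exists gamma tau r (g : 'I_d -> R),
  [/\ 0 < r <= 5 / 4, 0 < tau, 2 * d%:R * tau <= (2 - fix0 a A) / 40,
      gamma ^+ 2 + (2^-1) ^+ 2 = r ^+ 2 &
  [/\ g 1 ^+ 2 = r ^+ 2,
      forall i, i != 0 -> i != 1 -> g i ^+ 2 + tau ^+ 2 = r ^+ 2 &
      gamma + \sum_(i | i != 0) frame_weight i * g i = 4^-1]].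
Proof.
have q1 := fix0_gt1 a_gt1 A_cube A_le2; have q2 := fix0_lt2 a_gt1 A_cube A_le2.
move: (fix0 a A) q1 q2 => q q1 q2.
have [N N3 NE] : exists2 N : R, 3 <= N & d%:R = N by exists d%:R; rewrite ?d_ge3.
rewrite NE.
pose t := (2 - q) / (100 * N).
have t0 : 0 < t by rewrite divr_gt0 //; lra.
have tN : t * (100 * N) = 2 - q by rewrite divfK // gt_eqF //; lra.
have t1 : t < 1 by rewrite ltr_pdivrMr; lra.
clearbody t.
pose om := Num.sqrt (1 - t ^+ 2).
have t2 : t ^+ 2 <= 1 by rewrite expr2; nra.
have om2 : om ^+ 2 = 1 - t ^+ 2 by rewrite sqr_sqrtr // subr_ge0.
have om0 : 0 <= om by exact: sqrtr_ge0.
have om1 : om <= 1 by have := sqr_ge0 t; nra.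
pose c (i : 'I_d) : R := if i == 0 then 0 else if i == 1 then 1 else om.
have c01 i : 0 <= c i <= 1.
  by rewrite /c; case: (i == 0); [|case: (i == 1)]; rewrite ?lexx ?ler01 ?om0 ?om1.
have [|s s1 K01] := @balanced_signs R d (fun i => frame_weight i * c i).
  move=> i; have /andP[c0 c1] := c01 i.
  by rewrite mulr_ge0 ?mulr_ile1 ?weight_le1 // ltW // weight_gt0.
move: K01; set K := \sum_i _ => /andP[K0 K1].
pose D := Num.sqrt (5 - 4 * K ^+ 2).
have K2 : K ^+ 2 <= 1 by rewrite expr2; nra.
have D2 : D ^+ 2 = 5 - 4 * K ^+ 2 by rewrite sqr_sqrtr //; lra.
have D0 : 0 <= D by exact: sqrtr_ge0.
have D1 : 1 <= D by nra.
have KD : 0 < K + D by lra.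
pose r := 5 / 4 / (K + D).
have rKD : r * (K + D) = 5 / 4 by rewrite divfK // gt_eqF.
have r0 : 0 < r by rewrite divr_gt0 //; lra.
have r54 : r <= 5 / 4 by rewrite ler_pdivrMr //; nra.
clearbody r; exists (4^-1 - r * K), (r * t), r, (fun i => s i * r * c i); split.
- by rewrite r0 r54.
- by rewrite mulr_gt0.
- have : r * t * N <= 5 / 4 * (t * N) by rewrite -mulrA ler_wpM2r // mulr_ge0 //; lra.
  by lra.
- have : (r * D) ^+ 2 = (5 / 4 - r * K) ^+ 2 by congr (_ ^+ 2); lra.
  by rewrite exprMn D2; lra.
split.
- by rewrite !exprMn s1 /c /= expr1n mul1r mulr1.
- move=> i i0 i1; rewrite !exprMn s1 /c (negbTE i0) (negbTE i1) om2; ring.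
- have -> : \sum_(i | i != 0) frame_weight i * (s i * r * c i) = r * K.
    rewrite /K mulr_sumr [RHS](bigD1 0) //= {2}/c eqxx !mulr0 add0r.
    by apply: eq_bigr => i _; ring.
  by rewrite subrK.
Qed.

End Frame.

(** * Averages, full measure and null sets *)

Section Average.
Context d (T : measurableType d) (R : realType).
Variables P Q : probability T R.

Let half : {nonneg R} := NngNum (ltW (divr_gt0 ltr01 (ltr0Sn R 1))).

Let avg : {measure set T -> \bar R} := measure_add (mscale half P) (mscale half Q).

Let avgE A : avg A = ((1 / 2)%:E * P A + (1 / 2)%:E * Q A)%E.
Proof. exact: measure_addE. Qed.

Let avg_setT : avg setT = 1%E.
Proof.
by rewrite avgE !probability_setT !mule1 -EFinD; congr (_%:E); lra.
Qed.

Let m := avg : set T -> \bar R.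
HB.instance Definition _ := Measure.on m.
HB.instance Definition _ := Measure_isProbability.Build _ _ _ m avg_setT.

Lemma average_probability : exists mu : probability T R,
  forall A, mu A = ((1 / 2)%:E * P A + (1 / 2)%:E * Q A)%E.
Proof. by exists m => A; exact: avgE. Qed.

End Average.

Section FullMeasure.
Context d (T : measurableType d) (R : realType) (P : probability T R).

Lemma full_measureI (G A : set T) : measurable G -> measurable A -> P G = 1%E ->
  P (A `&` G) = P A.
Proof.
move=> mG mA PG; apply/eqP; rewrite eq_le; apply/andP; split.
  by apply: le_measure; rewrite ?inE //; exact: measurableI.
have GC : P (~` G) = 0%E by rewrite probability_setC // PG subee.
apply: (@le_trans _ _ (P ((A `&` G) `|` ~` G))).
  apply: le_measure; rewrite ?inE //.
    by apply: measurableU; [exact: measurableI|exact: measurableC].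
  by move=> x Ax; case: (pselect (G x)) => Gx; [left|right].
apply: le_trans (measureU2 _ _ _) _.
- exact: measurableI.
- exact: measurableC.
- by rewrite [X in (_ + X)%E](_ : _ = 0%E) ?adde0 //; exact: GC.
Qed.

Lemma full_measure_eq (G A B : set T) : measurable G -> measurable A -> measurable B ->
  P G = 1%E -> A `&` G = B `&` G -> P A = P B.
Proof.
by move=> mG mA mB PG AB; rewrite -(full_measureI mG mA PG) AB full_measureI.
Qed.

Lemma full_measure_sub (G A : set T) : measurable G -> measurable A ->
  P G = 1%E -> G `<=` A -> P A = 1%E.
Proof.
move=> mG mA PG GA; apply/eqP; rewrite eq_le probability_le1 //= -PG.
by apply: le_measure; rewrite ?inE.
Qed.

End FullMeasure.

(** Averaging a probability over an orbit of length two produces an invariant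
    one as soon as the second iterate preserves it. *)
Lemma invariant_average (R : realType) n (H : 'rV[R]_n -> 'rV[R]_n)
    (S : set 'rV[R]_n) (P : probability (borel R n) R) :
  measurable_fun setT (H : borel R n -> borel R n) ->
  measurable (S : set (borel R n)) -> P S = 1%E -> P (H @^-1` S) = 1%E ->
  (forall E, measurable (E : set (borel R n)) -> P (H @^-1` (H @^-1` E)) = P E) ->
  exists mu : probability (borel R n) R,
    (forall A : set (borel R n), mu A =
        ((1 / 2)%:E * P A + (1 / 2)%:E * P (H @^-1` A))%E) /\
    (forall E : set (borel R n), measurable E -> mu (S `&` (H @^-1` E)) = mu E).
Proof.
move=> mH mS PS PHS H2.
have mpre (E : set (borel R n)) : measurable E ->
    measurable (H @^-1` E : set (borel R n)).
  by move=> mE; rewrite -[X in measurable X]setTI; exact: mH.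
pose f : {mfun borel R n >-> borel R n} :=
  @mfun_Sub _ _ (borel R n) (borel R n) H (mem_set mH).
have [mu muE] := average_probability P (distribution P f).
exists mu; split => [A|E mE]; first by rewrite muE.
have e1 : P (S `&` H @^-1` E) = P (H @^-1` E).
  by rewrite setIC; exact: full_measureI mS (mpre E mE) PS.
have e2 : P (H @^-1` (S `&` H @^-1` E)) = P E.
  rewrite preimage_setI setIC -[RHS]H2 //.
  exact: full_measureI (mpre S mS) (mpre _ (mpre E mE)) PHS.
rewrite (muE (S `&` _)) (muE E) e1 addeC; congr (_ * _ + _)%E; exact: e2.
Qed.

Lemma lebesgue_sub0 (R : realType) n (A B : set 'rV[R]_n) :
  B `<=` A -> lebesgue A = 0%E -> lebesgue B = 0%E.
Proof.
move=> BA A0; apply/eqP; rewrite eq_le; apply/andP; split.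
  rewrite -A0; apply: ereal_inf_le_tmp => _ [lo [hi [lohi Acov ->]]].
  by exists lo, hi; split => //; exact: subset_trans Acov.
apply: le_ereal_inf_tmp => _ [lo [hi [lohi _ ->]]].
apply: nneseries_ge0 => k _ _; rewrite lee_fin.
by apply: prodr_ge0 => i _; rewrite subr_ge0.
Qed.

(** The bound on the measure of balls passes to the image under an invertible
    affine map, which is therefore dominated by Lebesgue measure. *)
Lemma affine_law_null (R : realType) n (P : probability (borel R n) R)
    (M : 'M[R]_n) (c : 'rV[R]_n) (A : set (borel R n)) :
  M \in unitmx -> ball_bounded P -> measurable A -> lebesgue A = 0%E ->
  P ((fun x : 'rV[R]_n => x *m M + c) @^-1` A) = 0%E.
Proof.
move=> uM bP mA A0.
pose f : {mfun borel R n >-> borel R n} :=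
  @mfun_Sub _ _ (borel R n) (borel R n) _ (mem_set (affine_measurable M c)).
have dom := @ball_bounded_dominates R n (distribution P f) (affine_ball_bounded c uM bP).
by apply: (dom A) => // B mB BA; exact: lebesgue_sub0 BA A0.
Qed.

(** * An invariant measure for a twisted rotation of the coordinates *)

Section LoopMeasure.
Context {R : realType} {n : nat} (b : R).
Hypothesis b_bounds : 2^-1 <= b < 1.
Local Notation d := n.+1.
Local Notation V := 'rV[R]_d.

Definition loop_map (s : V) : V :=
  \row_j (if ord_pred j == 0 then beta_map b (s 0 0) else s 0 (ord_pred j)).

Lemma loop_mapS s i : loop_map s 0 (ordS i) =
  if i == 0 then beta_map b (s 0 0) else s 0 i.
Proof. by rewrite mxE ordSK. Qed.

(** The unit cube without the discontinuity. *)
Definition loop_domain : set V :=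
  rect (fun j => `]0, 1]%classic `\` (if j == 0 then [set b] else set0)).

Lemma parry_measure_point (x : R) : parry_measure b_bounds [set x] = 0%E.
Proof.
have [C C0 lipC] := parry_measure_lip b_bounds.
apply/eqP; rewrite eq_le measure_ge0 andbT; apply/lee_addgt0Pr => e e0.
rewrite add0e; have eC : 0 < e / C by rewrite divr_gt0.
have /(lipC) : x - e / C <= x by rewrite gerBl ltW.
rewrite subKr [C * _]mulrC divfK ?gt_eqF // => /(le_trans _) -> //.
apply: le_measure; rewrite ?inE; [exact: measurable_set1|exact: measurable_itv|].
by move=> _ -> /=; rewrite in_itv /= lexx andbT gtrBl.
Qed.

Let m01D (j : 'I_d) : measurable
  (`]0 : R, 1]%classic `\` (if j == 0 then [set b] else set0)).
Proof.
apply: measurableD; first exact: measurable_itv.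
by case: eqP => _; [exact: measurable_set1|exact: measurable0].
Qed.

Lemma loop_domain_measurable : measurable (loop_domain : set (borel R d)).
Proof. exact: rect_measurable. Qed.

Lemma loop_map_measurable : measurable_fun setT (loop_map : borel R d -> borel R d).
Proof.
apply: borel_measurable_fun => j; rewrite (_ : (fun _ => _) =
  (fun s : borel R d => if ord_pred j == 0 then beta_map b ((s : V) 0 0)
     else (s : V) 0 (ord_pred j))); last by apply/funext => s; rewrite mxE.
case: eqP => _; last exact: coord_measurable.
by apply: measurableT_comp; [exact: beta_map_measurable|exact: coord_measurable].
Qed.

Lemma parry_measure_domain (j : 'I_d) : parry_measure b_bounds
  (`]0, 1]%classic `\` (if j == 0 then [set b] else set0)) = 1%E.
Proof.
case: (j == 0); last by rewrite setD0 parry_measure_unit.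
have m1 : measurable (`]0 : R, 1]%classic `\` [set b]).
  by apply: measurableD; [exact: measurable_itv|exact: measurable_set1].
rewrite -(@measureU0 _ _ _ (parry_measure b_bounds) _ _ m1 (measurable_set1 b)
  (parry_measure_point b)).
apply: (@full_measure_sub _ _ _ (parry_measure b_bounds) `]0, 1]%classic _ _ _
  (parry_measure_unit b_bounds)).
- exact: measurable_itv.
- by apply: measurableU => //; exact: measurable_set1.
- by move=> x x01; have [->|/eqP xb] := eqVneq x b; [right|left].
Qed.

(** The coordinates are permuted, one of them being transformed on the way, so
    a power of an invariant measure of that transformation is preserved. *)
Lemma loop_measure : exists P : probability (borel R d) R,
  [/\ ball_bounded P, P loop_domain = 1%E &
    forall E : set (borel R d), measurable E -> P (loop_map @^-1` E) = P E].
Proof.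
pose nu := parry_measure b_bounds.
have [P PE] := product_probability nu d.
have [C C0 lipC] := parry_measure_lip b_bounds.
exists P; split; first exact: product_ball_bounded (ltW C0) lipC PE.
  by rewrite PE // big1 // => j _; rewrite parry_measure_domain.
pose f : {mfun borel R d >-> borel R d} :=
  @mfun_Sub _ _ (borel R d) (borel R d) _ (mem_set loop_map_measurable).
apply: (borel_measure_unique (m1 := distribution P f)) => A mA.
pose A' (i : 'I_d) : set R :=
  if i == 0 then beta_map b @^-1` (A (ordS i)) else A (ordS i).
have mA' i : measurable (A' i).
  rewrite /A'; case: eqP => // _; rewrite -[X in measurable X]setTI.
  exact: (beta_map_measurable b measurableT (mA _)).
transitivity (P (rect A')).
  rewrite [LHS](_ : _ = P (loop_map @^-1` rect A)) //.
  congr (P _); apply/seteqP; split => s /= h j.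
    by have := h (ordS j); rewrite loop_mapS /A'; case: eqP => // ->.
  rewrite -[j]ord_predK; move: (ord_pred j) => i; rewrite loop_mapS.
  by have := h i; rewrite /A'; case: eqP => // ->.
rewrite !PE //; congr EFin; rewrite [RHS](reindex_inj (can_inj (@ordSK _))).
apply: eq_bigr => i _; rewrite /A'; case: eqP => // _.
congr fine; exact: (parry_measure_invariant b_bounds (mA _)).
Qed.

End LoopMeasure.

Lemma msupport_sub (R : realType) n (P : probability (borel R n) R)
    (U : set 'rV[R]_n) :
  closed U -> measurable (U : set (borel R n)) -> P U = 1%E -> msupport P `<=` U.
Proof.
move=> cU mU PU x sx; apply: contrapT => nUx.
have := sx _ (closed_openC cU) nUx.
by rewrite (@probability_setC _ _ _ P _ mU) PU subee // ltxx.
Qed.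

(** What is asserted of a single map beyond its regularity, its symmetry and its
    agreement with [G]. *)
Definition asymmetric_acim (R : realType) (d : nat) (a : R) (k : nat)
    (H : 'rV[R]_d -> 'rV[R]_d) : Prop :=
      exists mu : probability (borel R d) R,
        is_acim H mu /\
        msupport mu `<=` closure (Aset k `|` Bset k) /\
        (exists nu : probability (borel R d) R,
           [/\ is_acim H nu,
               msupport nu `<=` closure (Aset (d - k) `|` Bset (d - k))
             & msupport mu `&` msupport nu = set0]) /\
        exists U : set 'rV[R]_d,
          [/\ AsIUP H U, U `<=` closure (Aset k `|` Bset k),
              msupport mu `<=` U
            & exists (L : 'M[R]_d) (b : 'rV[R]_d),
                [/\ forall x, U x -> Bset k x -> H x = x *m L + b,
                    exists p : 'rV[R]_d, Bset k p /\
                      (forall q : 'rV[R]_d, q *m L + b = q <-> q = p)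
                  & exists e : d.-tuple 'rV[R]_d,
                      basis_of fullv e /\
                      forall n : 'I_d,
                        tnth e n *m L =
                        (a * enorm (tnth e n) / enorm (tnth e (ordS n)))
                          *: tnth e (ordS n)]].

(** * The dynamics around the first vertex *)

Section FrameDynamics.
Context {R : realType} {n : nat}.
Local Notation d := n.+3.
Local Notation V := 'rV[R]_d.
Variable a : R.
Hypothesis a_gt1 : 1 < a.
Local Notation A := (a ^+ d).
Hypothesis A_small : A ^+ 2 <= 1 + (80 * d%:R)^-1.
Local Notation weight := (@frame_weight R n a).
Variables (gamma tau r : R) (g : 'I_d -> R).
Hypotheses (r_bounds : 0 < r <= 5 / 4) (tau_gt0 : 0 < tau)
  (tau_small : 2 * d%:R * tau <= (2 - fix0 a A) / 40)
  (gamma_r : gamma ^+ 2 + (2^-1) ^+ 2 = r ^+ 2)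
  (g1_r : g 1 ^+ 2 = r ^+ 2)
  (g_r : forall i, i != 0 -> i != 1 -> g i ^+ 2 + tau ^+ 2 = r ^+ 2)
  (g_sum : gamma + \sum_(i | i != 0) weight i * g i = 4^-1).

Let a_gt0 : 0 < a. Proof. by have := a_gt1; lra. Qed.
Let a_neq0 : a != 0. Proof. by rewrite gt_eqF. Qed.
Let A_gt0 : 0 < A. Proof. by rewrite exprn_gt0. Qed.
Let A_neq0 : A != 0. Proof. by rewrite gt_eqF. Qed.
Let A2 := A_le2 A_small.
Let A3 := @A_cube R n a a_gt1.
Let d_ge3 : 3 <= d%:R :> R. Proof. by rewrite ler_nat. Qed.

Definition frame_mx : 'M[R]_d := \matrix_(i, j)
  (if i == 0 then (if j == 0 then - 2^-1 else if j == 1 then gamma else 0)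
   else if j == 1 then g i else if j == i then tau else 0).

Definition weights_mx : 'M[R]_d := diag_mx (\row_i (weight i) ^+ 2).

(* The vertex which is the centre of the homothety on [Aset 1]. *)
Definition origin : V := delta_mx 0 0.

Definition chart (xi : V) : V := origin + xi *m (weights_mx *m frame_mx).

(** In the coordinates of the chart, the affine branch: a weighted cyclic
    permutation followed by a translation along one axis. *)
Definition turn_mx : 'M[R]_d := \matrix_(i, j)
  (if j == ordS i then a * weight i ^+ 2 / weight (ordS i) ^+ 2 else 0).

Definition turn (xi : V) : V := xi *m turn_mx - shift_amount a A *: delta_mx 0 1.

Lemma mul_frame (c : V) : [/\ (c *m frame_mx) 0 0 = - (c 0 0 / 2),
  (c *m frame_mx) 0 1 = gamma * c 0 0 + \sum_(i | i != 0) g i * c 0 i &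
  forall j, j != 0 -> j != 1 -> (c *m frame_mx) 0 j = tau * c 0 j].
Proof.
split=> [||j /negbTE j0 /negbTE j1]; rewrite mxE.
- rewrite (bigD1 0) //= mxE !eqxx big1 ?addr0 ?mulrN // => i i0.
  by rewrite mxE (negbTE i0) [0 == 1](_ : _ = false) // eq_sym (negbTE i0) mulr0.
- rewrite (bigD1 0) //= mxE /= mulrC; congr (_ + _).
  by apply: eq_bigr => i i0; rewrite mxE (negbTE i0) /= mulrC.
- rewrite (bigD1 j) //= mxE j0 j1 eqxx mulrC big1 ?addr0 // => i ij.
  rewrite mxE j0 j1; case: (i == 0); rewrite ?mulr0 //.
  by rewrite eq_sym (negbTE ij) mulr0.
Qed.

Lemma mul_weights (xi : V) i : (xi *m weights_mx) 0 i = weight i ^+ 2 * xi 0 i.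
Proof.
rewrite mxE (bigD1 i) //= !mxE eqxx mulr1n mulrC big1 ?addr0 // => k ki.
by rewrite !mxE (negbTE ki) mulr0n mulr0.
Qed.

Lemma frame_unit : frame_mx \in unitmx.
Proof.
rewrite -row_free_unit; apply: inj_row_free => c c0.
have [h0 h1 hj] := mul_frame c.
have z j : (c *m frame_mx) 0 j = 0 by rewrite c0 mxE.
have c00 : c 0 0 = 0 by move: h0; rewrite z; lra.
have cj j : j != 0 -> j != 1 -> c 0 j = 0.
  move=> j0 j1; have := hj j j0 j1; rewrite z => /esym/eqP.
  by rewrite mulf_eq0 (gt_eqF tau_gt0) => /eqP.
apply/rowP => j; rewrite mxE.
have [->//|j0] := eqVneq j 0; have [->|j1] := eqVneq j 1; last exact: cj.
move: h1; rewrite z c00 mulr0 add0r (bigD1 1) //= big1 ?addr0.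
  move=> /esym/eqP; rewrite mulf_eq0 => /orP[/eqP g0|/eqP //].
  move: g1_r; rewrite g0 expr0n /= => /esym/eqP; rewrite expf_eq0 /=.
  by have /andP[r0 _] := r_bounds; rewrite gt_eqF.
by move=> i /andP[i0 i1]; rewrite cj // mulr0.
Qed.

Lemma weights_unit : weights_mx \in unitmx.
Proof.
rewrite -row_free_unit; apply: inj_row_free => c c0.
apply/rowP => j; rewrite mxE; have := mul_weights c j; rewrite c0 mxE => /esym/eqP.
by rewrite mulf_eq0 expf_eq0 /= (negbTE (weight_neq0 a_gt1 j)) => /eqP.
Qed.

Lemma scaled_frame_unit : weights_mx *m frame_mx \in unitmx.
Proof. by rewrite unitmx_mul weights_unit frame_unit. Qed.

Lemma mul_turn (xi : V) i : (xi *m turn_mx) 0 (ordS i) =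
  a * weight i ^+ 2 / weight (ordS i) ^+ 2 * xi 0 i.
Proof.
rewrite mxE (bigD1 i) //= mxE eqxx mulrC big1 ?addr0 // => k ki.
by rewrite mxE (inj_eq (@ordS_inj _)) eq_sym (negbTE ki) mulr0.
Qed.

Lemma turnE (xi : V) i : turn xi 0 (ordS i) =
  a * weight i ^+ 2 / weight (ordS i) ^+ 2 * xi 0 i -
  (if i == 0 then shift_amount a A else 0).
Proof.
rewrite -mul_turn [turn xi]/(_ - _) [LHS]mxE; congr (_ + _).
rewrite !mxE /= -ordS0 (inj_eq (@ordS_inj _)).
by case: (i == 0); rewrite ?mulr1 ?mulr0.
Qed.

Lemma coef0 : a * weight 0 ^+ 2 / weight (ordS 0) ^+ 2 = slope A / a.
Proof.
rewrite ordS0 (weight1 a_gt1) {1}/frame_weight eqxx /slope.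
by field; rewrite a_neq0 A_neq0.
Qed.

Lemma coefS i : i != 0 -> a * weight i ^+ 2 / weight (ordS i) ^+ 2 = a^-1.
Proof.
move=> i0; rewrite (weight_ordS a_gt1 i0).
by field; rewrite a_neq0 (weight_neq0 a_gt1).
Qed.

Lemma turn0 (xi : V) : turn xi 0 (ordS 0) = slope A / a * xi 0 0 - shift_amount a A.
Proof. by rewrite turnE coef0 eqxx. Qed.

Lemma turnS (xi : V) i : i != 0 -> turn xi 0 (ordS i) = xi 0 i / a.
Proof. by move=> i0; rewrite turnE coefS // (negbTE i0) subr0 mulrC. Qed.

Definition linear_part : 'M[R]_d :=
  invmx (weights_mx *m frame_mx) *m turn_mx *m (weights_mx *m frame_mx).
Definition translation_part : V :=
  origin - origin *m linear_part - shift_amount a A *: (delta_mx 0 1 *m (weights_mx *m frame_mx)).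

Lemma chart_turn xi :
  chart xi *m linear_part + translation_part = chart (turn xi).
Proof.
rewrite /chart /translation_part /linear_part /turn.
move: (weights_mx *m frame_mx) scaled_frame_unit => E uE.
rewrite scalemxAl !mulmxDl mulNmx !mulmxA (mulmxK uE).
move: (origin *m _ *m _ *m _) (xi *m _ *m _) (_ *: _ *m _) => P Q Z.
by rewrite [P + Q]addrC -addrA [origin - P]addrC -[- P + origin - Z]addrA addNKr addrCA.
Qed.

Lemma chart_inj : injective chart.
Proof.
by move=> x y /addrI /(can_inj (mulmxK scaled_frame_unit)).
Qed.

Lemma chart_surj x : exists xi, chart xi = x.
Proof.
exists ((x - origin) *m invmx (weights_mx *m frame_mx)).
by rewrite /chart mulmxKV ?scaled_frame_unit // addrC subrK.
Qed.

Lemma chart_scale t xi : chart (t *: xi) = origin + t *: (chart xi - origin).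
Proof. by rewrite /chart -scalemxAl [origin + _ - _]addrAC subrr add0r. Qed.

Lemma turn_mx_unit : turn_mx \in unitmx.
Proof.
rewrite -row_free_unit; apply: inj_row_free => c c0.
apply/rowP => i; rewrite mxE; have := mul_turn c i; rewrite c0 mxE => /esym/eqP.
have w0 := weight_neq0 a_gt1 i; have w1 := weight_neq0 a_gt1 (ordS i).
rewrite mulf_eq0 => /orP[|/eqP //].
by rewrite !mulf_eq0 invr_eq0 !expf_eq0 /= (negbTE a_neq0) (negbTE w0) (negbTE w1).
Qed.

Lemma linear_part_unit : linear_part \in unitmx.
Proof.
by rewrite !unitmx_mul unitmx_inv !unitmx_mul turn_mx_unit weights_unit frame_unit.
Qed.

Lemma frame_row_norm i : enorm (row i frame_mx) = r.
Proof.
have /andP[r0 _] := r_bounds.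
rewrite /enorm -[RHS]ger0_norm ?(ltW r0) // -sqrtr_sqr; congr Num.sqrt.
have [->|i0] := eqVneq i 0.
  rewrite (bigD1 0) //= (bigD1 1) //= !mxE /= big1 ?addr0.
    by rewrite sqrrN addrC.
  by move=> j /andP[/negbTE j0 /negbTE j1]; rewrite !mxE /= j0 j1 expr0n.
have [->|i1] := eqVneq i 1.
  rewrite (bigD1 1) //= !mxE /= big1 ?addr0 // => j /negbTE j1.
  by rewrite !mxE /= j1 expr0n.
rewrite (bigD1 1) //= (bigD1 i) //= !mxE (negbTE i0) (negbTE i1) eqxx /= big1 ?addr0.
  exact: g_r.
move=> j /andP[/negbTE j1 /negbTE ji].
by rewrite !mxE (negbTE i0) j1 ji expr0n.
Qed.

Lemma frame_row_linear i :
  row i frame_mx *m linear_part = a *: row (ordS i) frame_mx.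
Proof.
have wi := weight_neq0 a_gt1 i; have wS := weight_neq0 a_gt1 (ordS i).
have e j : delta_mx 0 j *m (weights_mx *m frame_mx) = weight j ^+ 2 *: row j frame_mx.
  rewrite mulmxA rowE scalemxAl; congr (_ *m _); apply/rowP => k.
  rewrite mul_weights !mxE /=; have [->|kj] := eqVneq k j; rewrite ?mulr1 ?mulr0 //.
have t : (delta_mx 0 i : V) *m turn_mx =
    (a * weight i ^+ 2 / weight (ordS i) ^+ 2) *: delta_mx 0 (ordS i).
  rewrite -rowE; apply/rowP => k; rewrite !mxE /=.
  by case: eqP; rewrite ?mulr1 ?mulr0.
apply: (scalerI (expf_neq0 2 wi)); rewrite scalemxAl -e /linear_part.
move: (weights_mx *m frame_mx) scaled_frame_unit e => E uE e.
rewrite !mulmxA mulmxK // t -scalemxAl e !scalerA; congr (_ *: _).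
by field.
Qed.

Lemma frame_basis : basis_of fullv [tuple row i frame_mx | i < d].
Proof.
rewrite basisEdim size_tuple dimvf /dim /= mul1n leqnn andbT.
apply/subvP => x _; rewrite -[x](mulmxKV frame_unit) mulmx_sum_row.
apply: memv_suml => i _; apply: memvZ; apply: memv_span.
by apply/mapP; exists i; rewrite ?mem_enum.
Qed.

(** The sum of the absolute values of the coordinates of [eta - eta'] along the
    frame is multiplied by [a] under the linear part. *)
Lemma turn_fixed_unique eta eta' : turn eta = eta -> turn eta' = eta' -> eta = eta'.
Proof.
move=> h h'; pose f i := weight i ^+ 2 * (eta 0 i - eta' 0 i).
have fS i : f (ordS i) = a * f i.
  have wS := weight_neq0 a_gt1 (ordS i).
  by rewrite /f -{1}h -{1}h' !turnE; field.
have S0 : \sum_i `|f i| = 0.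
  have : \sum_i `|f i| = a * \sum_i `|f i|.
    rewrite {1}(reindex_inj (@ordS_inj _)) mulr_sumr; apply: eq_bigr => i _.
    by rewrite fS normrM gtr0_norm.
  move/eqP; rewrite -subr_eq0 -{1}[\sum_i _]mul1r -mulrBl mulf_eq0 => /orP[|/eqP //].
  by rewrite subr_eq0 eq_sym (gt_eqF a_gt1).
apply/rowP => i; apply/eqP; rewrite -subr_eq0.
have : `|f i| = 0.
  apply/eqP; rewrite eq_le normr_ge0 andbT -S0 (bigD1 i) //= lerDl.
  exact: sumr_ge0.
move/eqP; rewrite normr_eq0 /f mulf_eq0 expf_eq0 /=.
by rewrite (negbTE (weight_neq0 a_gt1 i)).
Qed.

Definition fixed_coord : V := \row_i (fix0 a A / weight i).

Lemma turn_fixed : turn fixed_coord = fixed_coord.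
Proof.
apply/rowP => j; rewrite -[j]ord_predK; move: (ord_pred j) => i.
have [->|i0] := eqVneq i 0.
  rewrite turn0 ordS0 !mxE (weight1 a_gt1) /frame_weight eqxx divr1 /slope invf_div.
  rewrite -(fix0_fixed a_gt1 A3 A2); congr (_ - _); rewrite expr2.
rewrite turnS // !mxE (weight_ordS a_gt1 i0).
by field; rewrite a_neq0 (weight_neq0 a_gt1).
Qed.

(** A neighbourhood of the point with coordinates 1, large enough for the whole
    invariant union. *)
Definition tame (xi : V) : Prop :=
  (forall i, (a ^+ 2)^-1 <= xi 0 i <= a ^+ 2) /\ xi 0 0 <= a.

Lemma chart_coords xi : [/\ chart xi 0 0 = 1 - xi 0 0 / 2,
  chart xi 0 1 = gamma * xi 0 0 + \sum_(i | i != 0) g i * (weight i ^+ 2 * xi 0 i) &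
  forall j, j != 0 -> j != 1 -> chart xi 0 j = tau * (weight j ^+ 2 * xi 0 j)].
Proof.
have [h0 h1 hj] := mul_frame (xi *m weights_mx).
have w0 : (xi *m weights_mx) 0 0 = xi 0 0.
  by rewrite mul_weights /frame_weight eqxx expr1n mul1r.
split=> [||j j0 j1]; rewrite /chart mulmxA mxE.
- by rewrite h0 w0 !mxE !eqxx.
- rewrite h1 w0 [origin 0 1]mxE /= add0r; congr (_ + _).
  by apply: eq_bigr => i _; rewrite mul_weights.
- by rewrite hj // mul_weights [origin 0 j]mxE /= (negbTE j0) add0r.
Qed.

Lemma g_le i : i != 0 -> `|g i| <= 5 / 4.
Proof.
move=> i0; have /andP[r0 r1] := r_bounds; apply: le_trans r1.
rewrite -[leRHS]gtr0_norm // -ler_sqr ?nnegrE //= real_normK ?num_real // [`|r|]gtr0_norm //.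
have [->|i1] := eqVneq i 1; first by rewrite g1_r.
by rewrite -(g_r i0 i1) lerDl sqr_ge0.
Qed.

Lemma sqr_aA : a ^+ 2 <= A ^+ 2.
Proof. by rewrite ler_sqr ?nnegrE ?(ltW a_gt0) ?(ltW A_gt0) // (ltW (A_gta a_gt1 A3 A2)). Qed.

Lemma invA2_ge : 1 - (80 * d%:R)^-1 <= (A ^+ 2)^-1.
Proof.
have As := A_small; have A0 : 0 < A ^+ 2 by rewrite exprn_gt0.
have y0 : 0 < (80 * d%:R)^-1 :> R by rewrite invr_gt0 mulr_gt0.
rewrite -[leRHS]mul1r ler_pdivlMr //.
move: (_^-1) (A ^+ 2) As A0 y0 => y B As A0 y0; nra.
Qed.

(** The weights and the coordinates are so close to 1 that the coordinates can be
    replaced by xi_0 / weight_i, for which [g_sum] gives the exact value. *)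
Lemma chart01_close xi : tame xi -> `|chart xi 0 1 - xi 0 0 / 4| <= 32^-1.
Proof.
move=> [xi_i xi0]; have [_ -> _] := chart_coords xi.
have -> : gamma * xi 0 0 + \sum_(i | i != 0) g i * (weight i ^+ 2 * xi 0 i) - xi 0 0 / 4
   = \sum_(i | i != 0) g i * (weight i ^+ 2 * xi 0 i - weight i * xi 0 0).
  have -> : gamma = 4^-1 - \sum_(i | i != 0) weight i * g i by rewrite -g_sum addrK.
  set S := \sum_(i | _) _ * g _; set T := \sum_(i | _) g _ * (_ * _).
  transitivity (T - S * xi 0 0); first by field.
  by rewrite /S mulr_suml -sumrB; apply: eq_bigr => i _; ring.
have a2A := sqr_aA; have iA := invA2_ge; have As := A_small.
have y3 : (80 * d%:R)^-1 <= 240^-1 :> R.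
  by rewrite lef_pV2 ?posrE ?mulr_gt0 //; have := d_ge3; lra.
have close i : `|weight i ^+ 2 * xi 0 i - weight i * xi 0 0| <= 2 / (80 * d%:R).
  have w0 := weight_gt0 a_gt1 i; have w1 := weight_le1 a_gt1 i.
  have aw : a / A <= weight i by rewrite ler_pdivrMr // mulrC; exact: weight_ge.
  have a2 : 0 < a ^+ 2 by rewrite exprn_gt0.
  have p1 : (A ^+ 2)^-1 <= weight i ^+ 2 * xi 0 i.
    have -> : (A ^+ 2)^-1 = (a / A) ^+ 2 * (a ^+ 2)^-1 by field; rewrite a_neq0 A_neq0.
    have /andP[x1 _] := xi_i i.
    apply: ler_pM => //; first by rewrite sqr_ge0.
      by rewrite invr_ge0 ltW.
    by rewrite ler_sqr ?nnegrE ?divr_ge0 ?(ltW a_gt0) ?(ltW A_gt0) ?(ltW w0).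
  have p2 : weight i ^+ 2 * xi 0 i <= a ^+ 2.
    have /andP[x1 x2] := xi_i i; apply: le_trans x2.
    rewrite ler_piMl ?exprn_ile1 ?(ltW w0) //.
    by apply: le_trans x1; rewrite invr_ge0 ltW.
  have /andP[z1 z2] := xi_i 0.
  have z0 : 0 <= xi 0 0 by apply: le_trans z1; rewrite invr_ge0 ltW.
  have q1 : (A ^+ 2)^-1 <= weight i * xi 0 0.
    apply: (@le_trans _ _ (a / A * (a ^+ 2)^-1)).
      have -> : a / A * (a ^+ 2)^-1 = (A * a)^-1 by field; rewrite a_neq0 A_neq0.
      have h : A * a <= A ^+ 2.
        by rewrite [leRHS]expr2 ler_pM2l // (ltW (A_gta a_gt1 A3 A2)).
      have AA : 0 < A ^+ 2 by rewrite exprn_gt0.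
      have Aa : 0 < A * a by exact: mulr_gt0.
      by rewrite lef_pV2 ?posrE.
    by apply: ler_pM => //; rewrite ?divr_ge0 ?invr_ge0 ?(ltW a_gt0) ?(ltW A_gt0) ?(ltW a2).
  have q2 : weight i * xi 0 0 <= a ^+ 2 by apply: le_trans z2; rewrite ler_piMl.
  move: (weight i ^+ 2 * _) (weight i * _) p1 p2 q1 q2 => p q p1 p2 q1 q2.
  rewrite ler_norml; move: (A ^+ 2)^-1 (A ^+ 2) (a ^+ 2) iA As a2A p1 p2 q1 q2.
  by move: (80 * d%:R)^-1 => y *; lra.
apply: le_trans (ler_norm_sum _ _ _) _.
apply: (@le_trans _ _ (\sum_(i < d) 5 / 4 * (2 / (80 * d%:R)))).
  rewrite [leRHS](bigD1 0) //=; apply: ler_wpDl.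
    by apply: mulr_ge0 => //; apply: divr_ge0 => //; apply: mulr_ge0.
  by apply: ler_sum => i i0; rewrite normrM ler_pM // g_le.
rewrite sumr_const cardT size_enum_ord -[_ *+ _]mulr_natl le_eqVlt; apply/orP; left.
by apply/eqP; field; rewrite gt_eqF.
Qed.

Lemma sum_split (x : V) : \sum_j x 0 j =
  x 0 0 + x 0 1 + \sum_(j | (j != 0) && (j != 1)) x 0 j.
Proof. by rewrite (bigD1 0) //= (bigD1 1) //= addrA. Qed.

Lemma chart_tail xi : tame xi ->
  (forall j, j != 0 -> j != 1 -> 0 < chart xi 0 j) /\
  0 <= \sum_(j | (j != 0) && (j != 1)) chart xi 0 j <= 40^-1.
Proof.
move=> [xi_i _]; have [_ _ cj] := chart_coords xi.
have a2 : 0 < a ^+ 2 by rewrite exprn_gt0.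
have pos j : 0 < weight j ^+ 2 * xi 0 j.
  have /andP[x1 _] := xi_i j.
  rewrite mulr_gt0 ?exprn_gt0 ?weight_gt0 //.
  by apply: lt_le_trans x1; rewrite invr_gt0.
have le2 j : weight j ^+ 2 * xi 0 j <= 2.
  have /andP[x1 x2] := xi_i j; have w0 := weight_gt0 a_gt1 j.
  apply: le_trans (le_trans sqr_aA A2); apply: le_trans x2.
  rewrite ler_piMl ?exprn_ile1 ?(ltW w0) ?weight_le1 //.
  by apply: le_trans x1; rewrite invr_ge0 ltW.
split=> [j j0 j1|]; first by rewrite cj // mulr_gt0.
apply/andP; split.
  by apply: sumr_ge0 => j /andP[j0 j1]; rewrite cj // ltW // mulr_gt0.
have q1 := fix0_gt1 a_gt1 A3 A2; have ts := tau_small.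
apply: (@le_trans _ _ (\sum_(j < d) tau * 2)); last first.
  rewrite sumr_const cardT size_enum_ord -[_ *+ _]mulr_natl.
  apply: (@le_trans _ _ ((2 - fix0 a A) / 40)); last by lra.
  by have -> : d%:R * (tau * 2) = 2 * d%:R * tau by ring.
rewrite [leRHS](bigID (fun j : 'I_d => (j != 0) && (j != 1))) /=.
apply: ler_wpDr; first by apply: sumr_ge0 => j _; rewrite mulr_ge0 // ltW.
by apply: ler_sum => j /andP[j0 j1]; rewrite cj // ler_pM2l.
Qed.

(** Tame points lie near the point with barycentric coordinates (1/4, 1/2, 1/4)
    on the vertices of indices 0, 1 and 2, which satisfies strictly all the
    inequalities defining [Aset 1] and [Bset 1] except those about x_1. *)
Lemma chart_region xi : tame xi ->
  [/\ Sd (chart xi), co (chart xi) 1 = 1 - xi 0 0 / 2, 3 / 8 < co (chart xi) 1,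
    cosum (chart xi) 2 d < 3 / 8 & 2^-1 < co (chart xi) 1 + co (chart xi) 2].
Proof.
move=> t; have /ler_normlP[y1 y2] := chart01_close t.
have [pos /andP[S0 S1]] := chart_tail t.
have [c0 _ _] := chart_coords xi.
have := sum_split (chart xi); rewrite -cosum_all => sm.
case: t => xi_i xi0; have /andP[z1 z2] := xi_i 0.
have iA := invA2_ge; have a2A := sqr_aA.
have y3 : (80 * d%:R)^-1 <= 240^-1 :> R.
  by rewrite lef_pV2 ?posrE ?mulr_gt0 //; have := d_ge3; lra.
have u1 : 1 - 240^-1 <= xi 0 0.
  apply: le_trans z1; apply: (@le_trans _ _ (A ^+ 2)^-1).
    by apply: le_trans iA; move: (80 * _)^-1 y3 => y y3; lra.
  by rewrite lef_pV2 ?posrE ?exprn_gt0.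
have u2 : xi 0 0 <= 1 + 240^-1.
  apply: le_trans xi0 _; apply: (@le_trans _ _ (A ^+ 2)).
    by have := slope_gta a_gt1 A3 A2; rewrite /slope => /ltW.
  by apply: le_trans A_small _; move: (80 * _)^-1 y3 => y y3; lra.
rewrite cosum2 co1 co2 sm c0.
move: (\sum_(j | _) chart xi 0 j) S0 S1 sm => S S0 S1 sm.
split=> //; try lra.
split; last by rewrite sm c0; lra.
move=> j; have [->|j0] := eqVneq j 0; first by rewrite c0; lra.
have [->|j1] := eqVneq j 1; last exact: pos.
by lra.
Qed.

Lemma chart_region_B xi : tame xi -> 1 < xi 0 0 -> Bset 1 (chart xi).
Proof.
move=> t x1; have [Sx c1 c2 c3 c4] := chart_region t.
by split => //=; split; lra.
Qed.

Lemma chart_region_A xi : tame xi -> xi 0 0 < 1 -> Aset 1 (chart xi).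
Proof.
move=> t x1; have [Sx c1 c2 c3 c4] := chart_region t.
by split => //=; lra.
Qed.

(** The fixed point need not be tame, but its coordinates are proportional to the
    inverses of the weights, so that [g_sum] gives its first two components
    exactly; the other ones are of the order of [tau]. *)
Lemma fixed_point_B : Bset 1 (chart fixed_coord).
Proof.
have q1 := fix0_gt1 a_gt1 A3 A2; have q2 := fix0_lt2 a_gt1 A3 A2.
have [c0 c1 cj] := chart_coords fixed_coord.
have fc i : weight i ^+ 2 * fixed_coord 0 i = weight i * fix0 a A.
  by rewrite mxE; field; exact: weight_neq0.
have f0 : fixed_coord 0 0 = fix0 a A by rewrite mxE /frame_weight eqxx divr1.
rewrite f0 in c0 c1.
have {}c1 : chart fixed_coord 0 1 = fix0 a A / 4.
  rewrite c1 (eq_bigr (fun i => weight i * g i * fix0 a A)) => [|i _].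
    by rewrite -mulr_suml -mulrDl g_sum mulrC.
  by rewrite fc; ring.
have {}cj j : j != 0 -> j != 1 -> chart fixed_coord 0 j = tau * (weight j * fix0 a A).
  by move=> j0 j1; rewrite cj // fc.
have pos j : j != 0 -> j != 1 -> 0 < chart fixed_coord 0 j.
  have q0 : 0 < fix0 a A by lra.
  move=> j0 j1; rewrite cj //; apply: mulr_gt0 => //; apply: mulr_gt0 => //.
  exact: weight_gt0.
have := sum_split (chart fixed_coord); rewrite -cosum_all => sm.
have S1 : \sum_(j | (j != 0) && (j != 1)) chart fixed_coord 0 j <= (2 - fix0 a A) / 40.
  apply: le_trans tau_small.
  apply: (@le_trans _ _ (\sum_(j < d) tau * 2)); last first.
    rewrite sumr_const cardT size_enum_ord -[_ *+ _]mulr_natl.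
    by have -> : d%:R * (tau * 2) = 2 * d%:R * tau by ring.
  rewrite [leRHS](bigID (fun j : 'I_d => (j != 0) && (j != 1))) /=.
  apply: ler_wpDr; first by apply: sumr_ge0 => j _; rewrite mulr_ge0 // ltW.
  apply: ler_sum => j /andP[j0 j1]; rewrite cj // ler_pM2l //.
  apply: (@le_trans _ _ (1 * fix0 a A)); last by rewrite mul1r ltW.
  by rewrite ler_pM2r ?weight_le1 //; lra.
have S0 : 0 <= \sum_(j | (j != 0) && (j != 1)) chart fixed_coord 0 j.
  by apply: sumr_ge0 => j /andP[j0 j1]; rewrite ltW // pos.
move: (\sum_(j | _ && _) _) S0 S1 sm => S S0 S1 sm.
split.
  split; last by rewrite sm c0 c1; lra.
  move=> j; have [->|j0] := eqVneq j 0; first by rewrite c0; lra.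
  have [->|j1] := eqVneq j 1; last exact: pos.
  by rewrite c1; lra.
rewrite /= cosum2 co1 co2 sm c0 c1; split; lra.
Qed.

(** ** The cube and its two-step return *)

Local Notation lo := (cube_lo a A).
Local Notation hi := (cube_hi a A).

Definition cube : set V := [set xi | forall i, lo <= xi 0 i <= hi].

Let lo_lt1' : lo < 1. Proof. exact: lo_lt1 a_gt1 A3 A2. Qed.
Let hi_lta' : hi < a. Proof. exact: hi_lta a_gt1 A3 A2. Qed.
Let a_lo_gt1' : 1 < a * lo. Proof. exact: a_lo_gt1 a_gt1 A3 A2. Qed.
Let hi_lo' : hi - lo = slope A * (1 - lo). Proof. exact: hi_lo. Qed.
Let lo_fixed' : slope A * lo - shift_amount a A = lo. Proof. exact: lo_fixed. Qed.
Let lo_image' : slope A - a * shift_amount a A = lo.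
Proof. exact: lo_image a_gt1 A3 A2. Qed.

Let lo_bounds : a^-1 < lo.
Proof. by rewrite -[ltLHS]mul1r ltr_pdivrMr // mulrC a_lo_gt1'. Qed.

Lemma tame_cube xi : cube xi -> tame xi.
Proof.
have h1 := a_gt1; have h2 := hi_lta'; have h3 := lo_bounds; have h4 := a_gt0.
have ia : (a ^+ 2)^-1 <= a^-1 by rewrite lef_pV2 ?posrE ?exprn_gt0 // expr2; nra.
have aa : a <= a ^+ 2 by rewrite expr2; nra.
move=> c; split=> [i|].
  by have /andP[c1 c2] := c i; apply/andP; split; lra.
by have /andP[c1 c2] := c 0; lra.
Qed.

Lemma tame_up xi : cube xi -> xi 0 0 <= 1 -> tame (a *: xi).
Proof.
have h1 := a_gt1; have h2 := hi_lta'; have h3 := a_lo_gt1'; have h4 := a_gt0.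
have ia : (a ^+ 2)^-1 <= 1 by rewrite invf_le1 ?exprn_gt0 // expr2; nra.
move=> c x1; split=> [i|]; rewrite mxE; last by rewrite ger_pMr.
have /andP[c1 c2] := c i; apply/andP; split.
  by apply: le_trans ia _; apply: le_trans (ltW h3) _; rewrite ler_pM2l.
by rewrite expr2 ler_pM2l //; lra.
Qed.

Lemma tame_down xi : cube xi -> tame (a^-1 *: xi).
Proof.
have h1 := a_gt1; have h2 := hi_lta'; have h3 := lo_bounds; have h4 := a_gt0.
have ai : 0 < a^-1 by rewrite invr_gt0.
have le1 i : cube xi -> a^-1 * xi 0 i <= 1.
  move=> /(_ i)/andP[_ c2]; rewrite mulrC ler_pdivrMr // mul1r; lra.
have aa : 1 <= a ^+ 2 by rewrite expr2; nra.
move=> c; split=> [i|]; rewrite mxE.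
  have /andP[c1 c2] := c i; apply/andP; split.
    by rewrite expr2 invfM ler_pM2l //; lra.
  exact: le_trans (le1 i c) aa.
by apply: le_trans (le1 0 c) _; exact: ltW.
Qed.

Lemma turn_cube_low xi : cube xi -> xi 0 0 <= 1 -> cube (turn (a *: xi)).
Proof.
move=> c x1 j; rewrite -[j]ord_predK; move: (ord_pred j) => i.
have [->|i0] := eqVneq i 0; last by rewrite turnS // mxE mulrC mulKf.
have /andP[c1 c2] := c 0; rewrite turn0 mxE mulrA divfK //.
have s0 : 0 < slope A by rewrite exprn_gt0.
have := lo_fixed'; rewrite /cube_hi => lf.
have : slope A * lo <= slope A * xi 0 0 by rewrite ler_pM2l.
have : slope A * xi 0 0 <= slope A by rewrite ger_pMr.
by move=> *; apply/andP; split; lra.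
Qed.

Lemma turn_cube_high xi : cube xi -> 1 <= xi 0 0 -> cube (a *: turn xi).
Proof.
move=> c x1 j; rewrite mxE -[j]ord_predK; move: (ord_pred j) => i.
have [->|i0] := eqVneq i 0; last by rewrite turnS // mulrC divfK.
have /andP[c1 c2] := c 0; rewrite turn0 mulrBr mulrA mulrCA divff // mulr1.
have s0 : 0 < slope A by rewrite exprn_gt0.
have s2 : slope A <= 2 by exact: A2.
have l1 := lo_lt1'; have li := lo_image'; have hl := hi_lo'.
have h1 : slope A <= slope A * xi 0 0 by rewrite ler_pMr.
have h2 : slope A * xi 0 0 <= slope A * hi by rewrite ler_pM2l.
have h3 : slope A * (hi - 1) <= hi - lo.
  have -> : hi - 1 = (1 - lo) * (slope A - 1) by move: hl; nra.
  rewrite hl ler_pM2l // ger_pMr; lra.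
by apply/andP; split; lra.
Qed.


Local Notation b := ((slope A)^-1).

Let slope_gt1' : 1 < slope A. Proof. exact: slope_gt1 a_gt1 A3 A2. Qed.
Let slope_gt0' : 0 < slope A. Proof. by have := slope_gt1'; lra. Qed.
Let lo_lt_hi : 0 < hi - lo.
Proof.
have s0 := slope_gt0'; have l1 := lo_lt1'.
by rewrite hi_lo'; apply: mulr_gt0; lra.
Qed.

Lemma slope_inv_bounds : 2^-1 <= b < 1.
Proof.
apply/andP; split; first by rewrite lef_pV2 ?posrE.
by rewrite invf_lt1.
Qed.

(** Normalises the cube to the unit cube; the cut xi_0 = 1 is then at
    1 / slope, that of the beta-transformation. *)
Definition unit_coord (s : V) : V := \row_i (lo + (hi - lo) * s 0 i).

Lemma unit_coord_sub1 s i : unit_coord s 0 i - 1 = (hi - lo) * (s 0 i - b).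
Proof.
have s0 : slope A != 0 by rewrite gt_eqF.
rewrite mxE mulrBr [X in _ = _ - X](_ : _ = 1 - lo); last by rewrite hi_lo'; field.
by ring.
Qed.

Lemma unit_coord_lt1 s i : (unit_coord s 0 i < 1) = (s 0 i < b).
Proof. by rewrite -subr_lt0 unit_coord_sub1 pmulr_rlt0 // subr_lt0. Qed.

Lemma unit_coord_gt1 s i : (1 < unit_coord s 0 i) = (b < s 0 i).
Proof. by rewrite -subr_gt0 unit_coord_sub1 pmulr_rgt0 // subr_gt0. Qed.

Lemma cube_unit_coord (s : V) : (forall i, 0 <= s 0 i <= 1) -> cube (unit_coord s).
Proof.
move=> s01 i; rewrite mxE; have /andP[s0 s1] := s01 i; have h := ltW lo_lt_hi.
have : 0 <= (hi - lo) * s 0 i by rewrite mulr_ge0.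
have : (hi - lo) * s 0 i <= hi - lo by rewrite ler_piMr.
by move=> *; apply/andP; split; lra.
Qed.

Lemma turn_loop_low (s : V) : s 0 0 <= b ->
  turn (a *: unit_coord s) = unit_coord (loop_map b s).
Proof.
move=> sb; apply/rowP => j; rewrite -[j]ord_predK; move: (ord_pred j) => i.
rewrite [RHS]mxE loop_mapS; have [->|i0] := eqVneq i 0; last first.
  by rewrite turnS // !mxE mulrC mulKf.
rewrite turn0 mxE mulrA divfK // mxE /beta_map sb invrK.
have lf := lo_fixed'; have -> : shift_amount a A = slope A * lo - lo by lra.
by move: (lo) (hi) (slope A) => l h u; ring.
Qed.

Lemma turn_loop_high (s : V) : b < s 0 0 ->
  a *: turn (unit_coord s) = unit_coord (loop_map b s).
Proof.
move=> sb; apply/rowP => j; rewrite mxE -[j]ord_predK; move: (ord_pred j) => i.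
rewrite [RHS]mxE loop_mapS; have [->|i0] := eqVneq i 0; last first.
  by rewrite turnS // !mxE mulrC divfK.
rewrite turn0 mulrBr mulrA mulrCA divff // mulr1 mxE /beta_map leNgt sb /= invrK.
have lf := lo_fixed'; have li := lo_image'.
have hl : hi - lo = (a - 1) * shift_amount a A by rewrite /cube_hi; lra.
have : (hi - lo) * (s 0 0 * slope A - 1) = slope A * ((hi - lo) * s 0 0) - (hi - lo) by ring.
by move=> ->; rewrite mulrDr; lra.
Qed.

Local Notation H := (glued_map a linear_part translation_part).

Lemma a_bounds : 1 < a < 2.
Proof.
have := slope_gta a_gt1 A3 A2; have := A2; rewrite /slope; have := a_gt1.
by move: (A ^+ 2) => B *; lra.
Qed.

Lemma vertex_dilation_A1 x : Aset 1 x -> vertex_dilation a x = origin + a *: (x - origin).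
Proof.
move=> Ax; have := Ax => -[_ /=]; rewrite co1 => x0.
apply/rowP => j; rewrite !mxE /=; have [->|j0] := eqVneq j 0.
  by rewrite x0 /= mulr1n mulrBr mulr1; ring.
have lt : x 0 j < 2^-1.
  by rewrite -bary_ord; apply: (Aset_others (j := 1)) Ax.
by rewrite ltNge (ltW lt) /= mulr0n addr0 add0r subr0.
Qed.

Lemma H_low xi : tame xi -> xi 0 0 < 1 -> H (chart xi) = chart (a *: xi).
Proof.
move=> t x1; have A1 := chart_region_A t x1.
rewrite glued_map_A; last by exists 1%N.
by rewrite vertex_dilation_A1 // chart_scale.
Qed.

Lemma H_high xi : tame xi -> 1 < xi 0 0 -> tame (turn xi) ->
  H (chart xi) = chart (turn xi).
Proof.
move=> t x1 tt; rewrite -chart_turn; apply: glued_map_B; first exact: chart_region_B.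
by rewrite chart_turn; case: (chart_region tt).
Qed.

Lemma scaleK (xi : V) : a^-1 *: (a *: xi) = xi.
Proof. by rewrite scalerA mulVf // scale1r. Qed.

Lemma scaleVK (xi : V) : a *: (a^-1 *: xi) = xi.
Proof. by rewrite scalerA divff // scale1r. Qed.

Lemma H_cube_low xi : cube xi -> xi 0 0 < 1 ->
  H (chart xi) = chart (a *: xi) /\ H (chart (a *: xi)) = chart (turn (a *: xi)).
Proof.
move=> c x1; split; first exact: H_low (tame_cube c) x1.
apply: H_high.
- by apply: tame_up => //; exact: ltW.
- have /andP[c1 _] := c 0; rewrite mxE; apply: lt_le_trans a_lo_gt1' _.
  by rewrite ler_pM2l.
- by apply: tame_cube; apply: turn_cube_low => //; exact: ltW.
Qed.

Lemma H_down eta : cube eta -> H (chart (a^-1 *: eta)) = chart eta.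
Proof.
move=> c; rewrite H_low ?scaleVK //; first exact: tame_down.
rewrite mxE mulrC ltr_pdivrMr // mul1r.
by have /andP[_ c2] := c 0; have := hi_lta'; lra.
Qed.

Lemma H_cube_high xi : cube xi -> 1 < xi 0 0 ->
  H (chart xi) = chart (turn xi) /\ H (chart (turn xi)) = chart (a *: turn xi).
Proof.
move=> c x1; have cc := turn_cube_high c (ltW x1).
have tE : turn xi = a^-1 *: (a *: turn xi) by rewrite scaleK.
split; first by apply: H_high => //; [exact: tame_cube|rewrite tE; exact: tame_down].
by rewrite {1}tE; exact: H_down.
Qed.

Lemma H2_loop (s : V) : (forall i, 0 <= s 0 i <= 1) -> s 0 0 != b ->
  H (H (chart (unit_coord s))) = chart (unit_coord (loop_map b s)).
Proof.
move=> s01 sb; have c := cube_unit_coord s01.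
have [h|h|h] := ltgtP (s 0 0) b; last by rewrite h eqxx in sb.
  have [-> ->] := H_cube_low c (etrans (unit_coord_lt1 s 0) h).
  by rewrite turn_loop_low // ltW.
have [-> ->] := H_cube_high c (etrans (unit_coord_gt1 s 0) h).
by rewrite turn_loop_high.
Qed.

(** ** The invariant union of polytopes *)

Local Notation E := (weights_mx *m frame_mx).

Definition coord_fun (i : 'I_d) : afun (R := R) (n := d) :=
  afun_comp (afun_coord i) (invmx E) (- origin *m invmx E).

Lemma ev_coord_fun i xi : ev (coord_fun i) (chart xi) = xi 0 i.
Proof.
rewrite ev_comp ev_coord -mulmxDl /chart [origin + _]addrC addrK.
by rewrite mulmxK // scaled_frame_unit.
Qed.

Definition box_funs (l h : V) : seq (afun (R := R) (n := d)) :=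
  [seq ((coord_fun i).1, (coord_fun i).2 - l 0 i) | i <- enum 'I_d] ++
  [seq (- (coord_fun i).1, h 0 i - (coord_fun i).2) | i <- enum 'I_d].

Definition piece (l h : V) : set V := closed_cell (box_funs l h).

Lemma ev_box_lo i l xi :
  ev ((coord_fun i).1, (coord_fun i).2 - l) (chart xi) = xi 0 i - l.
Proof. by rewrite -[in RHS](ev_coord_fun i xi) /ev /= addrA. Qed.

Lemma ev_box_hi i h xi :
  ev (- (coord_fun i).1, h - (coord_fun i).2) (chart xi) = h - xi 0 i.
Proof.
rewrite -[in RHS](ev_coord_fun i xi) /ev /= mulmxN00.
by ring.
Qed.

Lemma pieceP l h xi : piece l h (chart xi) <-> forall i, l 0 i <= xi 0 i <= h 0 i.
Proof.
split=> [p i|p f].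
  apply/andP; split; rewrite -subr_ge0.
    rewrite -ev_box_lo; apply: p; rewrite mem_cat; apply/orP; left.
    by apply/mapP; exists i; rewrite ?mem_enum.
  rewrite -ev_box_hi; apply: p; rewrite mem_cat; apply/orP; right.
  by apply/mapP; exists i; rewrite ?mem_enum.
rewrite mem_cat => /orP[] /mapP[i _ ->]; have /andP[p1 p2] := p i.
  by rewrite ev_box_lo subr_ge0.
by rewrite ev_box_hi subr_ge0.
Qed.

Lemma piece_polytope (l h : V) : (forall i, l 0 i < h 0 i) -> piece l h `<=` Sd ->
  polytope (piece l h).
Proof.
move=> lh pS; apply: polytope_closed_cell; first exact: bounded_Sd.
exists (chart (2^-1 *: (l + h))).
have sub : cell (box_funs l h) `<=` piece l h by move=> x c f /c /ltW.
have := sub; rewrite (open_subsetE _ (cell_open (gs := box_funs l h))); apply.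
by move=> f; rewrite mem_cat => /orP[] /mapP[i _ ->];
  rewrite ?ev_box_lo ?ev_box_hi !mxE; have := lh i; lra.
Qed.

Definition bounds (k : 'I_3) : V * V :=
  if k == 0 then (const_mx lo, const_mx hi)
  else if k == 1 then (const_mx (a * lo), \row_i (if i == 0 then a else a * hi))
  else (const_mx (a^-1 * lo), const_mx (a^-1 * hi)).

Definition box_union : set V := \bigcup_k piece (bounds k).1 (bounds k).2.

Let ord3P (k : 'I_3) : [\/ k = 0, k = 1 | k = 2%:R].
Proof.
by case: k => [[|[|[|k]]] hk] //; [constructor 1|constructor 2|constructor 3];
  apply: val_inj.
Qed.

Lemma box_unionP x : box_union x <-> exists xi, x = chart xi /\
  [\/ cube xi, exists eta, [/\ cube eta, eta 0 0 <= 1 & xi = a *: eta]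
    | exists2 eta, cube eta & xi = a^-1 *: eta].
Proof.
have [xi0 xE] := chart_surj x; split.
  move=> [k _]; rewrite -xE => /pieceP p; exists xi0; split => //.
  have [kE|kE|kE] := ord3P k; rewrite kE /bounds /= in p.
  - by apply: Or31 => i; have := p i; rewrite !mxE.
  - apply: Or32; exists (a^-1 *: xi0); rewrite scaleVK; split => //.
      move=> i; have := p i; have := p 0; rewrite !mxE eqxx => /andP[_ p0] /andP[p1 p2].
      rewrite [a^-1 * _]mulrC ler_pdivlMr // ler_pdivrMr // [_ * a]mulrC p1 /=.
      move: p2; case: eqP => [-> _|_]; last by rewrite mulrC.
      by apply: le_trans p0 _; rewrite ler_peMl ?(ltW a_gt0) // ltW // hi_gt1.
    by have := p 0; rewrite !mxE eqxx => /andP[_ p0]; rewrite mulrC ler_pdivrMr // mul1r.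
  - apply: Or33; exists (a *: xi0); rewrite ?scaleK // => i.
    have := p i; rewrite !mxE => /andP[p1 p2].
    by rewrite -ler_pdivrMl // p1 /= -ler_pdivlMl.
move=> [xi [-> []]].
- by move=> c; exists 0 => //; apply/pieceP => i; rewrite !mxE; exact: c.
- move=> [eta [c e1 ->]]; exists 1 => //; apply/pieceP => i; rewrite !mxE.
  have /andP[c1 c2] := c i; rewrite ler_pM2l // c1 /=.
  case: eqP => [->|_]; last by rewrite ler_pM2l.
  by rewrite ger_pMr.
- move=> [eta c ->]; exists 2%:R => //; apply/pieceP => i; rewrite !mxE.
  by have /andP[c1 c2] := c i; rewrite !ler_pM2l ?invr_gt0 // c1.
Qed.

Lemma box_union_tame x : box_union x -> exists2 xi, x = chart xi & tame xi.
Proof.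
move=> /box_unionP[xi [-> h]]; exists xi => //.
case: h => [|[eta [c e1 ->]]|[eta c ->]]; [exact: tame_cube|exact: tame_up|exact: tame_down].
Qed.

Lemma box_union_Sd : box_union `<=` Sd.
Proof. by move=> _ /box_union_tame[xi -> t]; case: (chart_region t). Qed.

Lemma box_union_closed : closed box_union.
Proof.
apply: closed_bigcup; first exact: finite_finset.
by move=> k _; exact: closed_cell_closed.
Qed.

Lemma box_union_polytope k : polytope (piece (bounds k).1 (bounds k).2).
Proof.
apply: piece_polytope; last by move=> x px; apply: box_union_Sd; exists k.
have h := lo_lt_hi; have ai : 0 < a^-1 by rewrite invr_gt0.
have a1 := a_gt1; have l1 := lo_lt1'.
have [->|->|->] := ord3P k; rewrite /bounds /= => i; rewrite !mxE.
- lra.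
- by case: eqP => _; rewrite ?ltr_pM2l //; [rewrite gtr_pMr|lra].
- by rewrite ltr_pM2l //; lra.
Qed.

(** Neither branch applies on the cut x_1 = 1/2, which no atom meets. *)
Lemma box_union_image x : box_union x -> co x 1 != 2^-1 -> box_union (H x).
Proof.
move=> /box_unionP[xi [-> [c|[eta [c e1 ->]]|[eta c ->]]]].
- have [_ -> _ _ _] := chart_region (tame_cube c) => x1.
  have {}x1 : xi 0 0 != 1 by apply: contraNneq x1 => ->; apply/eqP; lra.
  have [h|h|h] := ltgtP (xi 0 0) 1; last by rewrite h eqxx in x1.
    have [-> _] := H_cube_low c h; apply/box_unionP; exists (a *: xi); split => //.
    by apply: Or32; exists xi; split => //; exact: ltW.
  have [-> _] := H_cube_high c h; apply/box_unionP; exists (turn xi); split => //.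
  apply: Or33; exists (a *: turn xi); last by rewrite scaleK.
  by apply: turn_cube_high => //; exact: ltW.
- have [_ -> _ _ _] := chart_region (tame_up c e1) => _.
  rewrite H_high; [|exact: tame_up| |by apply: tame_cube; exact: turn_cube_low].
    apply/box_unionP; exists (turn (a *: eta)); split => //; apply: Or31.
    exact: turn_cube_low.
  have /andP[c1 _] := c 0; rewrite mxE; apply: lt_le_trans a_lo_gt1' _.
  by rewrite ler_pM2l.
- move=> _; rewrite H_down //; apply/box_unionP; exists eta; split => //.
  exact: Or31.
Qed.

Lemma box_union_IUP : IUP H box_union.
Proof.
split; first exact: box_union_Sd.
exists 3, (fun k => piece (bounds k).1 (bounds k).2); split => //.
  exact: box_union_polytope.
have at_ := glued_map_atomic translation_part a_bounds linear_part_unit.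
exists #|{: (size (glue_funs linear_part translation_part)).-tuple bool}|,
  (sign_atom (fs := glue_funs linear_part translation_part)); split => //.
move=> _ [x [k _ [w _ [px xw]]] <-]; apply: box_union_image; first by exists k.
pose f : afun (R := R) (n := d) := (delta_mx 0 0, - 2^-1).
have fs : f \in glue_funs linear_part translation_part.
  rewrite mem_cat; apply/orP; left; rewrite inE; apply/orP; right.
  by apply/mapP; exists 0; rewrite ?mem_enum.
have [i ifs fi] := nthP (0, 0) fs.
have [] := sign_cell_sign ifs xw; rewrite fi ev_delta => h _.
by apply: contraNneq h => h; rewrite -co1 h subrr.
Qed.

(** By [chart_region], on the union the coordinate x_1 is larger than 3/8 while
    the last one, which becomes the first under [sigma], is smaller. *)
Lemma box_union_AsIUP : AsIUP H box_union.
Proof.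
split; first exact: box_union_IUP.
apply/seteqP; split => // x [/box_union_tame[xi -> t] [y /box_union_tame[eta -> t']]] /=.
have [_ _ c1 _ _] := chart_region t; have [Sy _ _ c2 _] := chart_region t'.
move=> e; move: c1; rewrite -e.
have -> : co (sigma (chart eta)) 1 = bary (sigma (chart eta)) 1 by [].
rewrite bary_sigma // subn1 /= (bary_ord _ (Ordinal (ltnW (ltnSn n.+2)))).
move: c2; rewrite cosum2 co1 cosum_all (bigD1 0) //= [_ + \sum_(_ < _ | _) _]addrC addrK.
rewrite (bigD1 (Ordinal (ltnW (ltnSn n.+2)))) //=.
have : 0 <= \sum_(i < d | (i != 0) && (i != Ordinal (ltnW (ltnSn n.+2)))) chart eta 0 i.
  by apply: sumr_ge0 => i _; case: Sy => S0 _; exact: ltW.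
by move: (\sum_(_ < _ | _) _) => S S0; lra.
Qed.

(** Points of the cut are reached from the side of [Aset 1]. *)
Lemma box_union_closure : box_union `<=` closure (Aset 1 `|` Bset 1).
Proof.
move=> _ /box_union_tame[xi -> t].
have [h|h|h] := ltgtP (xi 0 0) 1.
- by apply: subset_closure; left; exact: chart_region_A.
- by apply: subset_closure; right; exact: chart_region_B.
have [Sx c1 _ _ _] := chart_region t; rewrite h in c1.
move=> B nB; have nS : nbhs (chart xi) (B `&` Sd).
  apply: filterI => //; apply: open_nbhs_nbhs; split => //; exact: open_Sd.
have /nbhs_ballP[e /= e0 eB] := nS.
pose y : V := chart xi + (e / 2) *: delta_mx 0 0.
have [By Sy] : (B `&` Sd) y.
  apply: eB; apply/rV_ballP; split => // j; rewrite !mxE opprD addrA subrr sub0r normrN.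
  by rewrite eqxx /=; case: (j == 0); rewrite ?mulr1 ?mulr0 ?normr0 //= gtr0_norm; lra.
exists y; split => //; left; split => //=.
rewrite co1 mxE -[chart xi 0 0]co1 c1 mxE [delta_mx _ _ _ _]mxE /= mulr1.
by lra.
Qed.

Lemma H_affine_on_B x : box_union x -> Bset 1 x ->
  H x = x *m linear_part + translation_part.
Proof.
move=> Ux Bx; apply: glued_map_B => //.
have /= c1 : co x 1 < 2^-1 by case: Bx => _ /= [].
have [xi xE t] := box_union_tame Ux.
have x1 : 1 < xi 0 0.
  by have [_ c _ _ _] := chart_region t; move: c1; rewrite xE c; lra.
have /box_unionP[xi' [xE' h]] := Ux.
have {xi' xE'} h : [\/ cube xi, exists eta, [/\ cube eta, eta 0 0 <= 1 & xi = a *: eta]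
    | exists2 eta, cube eta & xi = a^-1 *: eta].
  by have <- : xi' = xi by apply: chart_inj; rewrite -xE' xE.
suff tt : tame (turn xi) by rewrite xE chart_turn; case: (chart_region tt).
case: h => [c|[eta [c e1 xiE]]|[eta c xiE]].
- rewrite -[turn xi]scaleK; apply: tame_down; apply: turn_cube_high => //.
  exact: ltW.
- by apply: tame_cube; rewrite xiE; exact: turn_cube_low.
- have /andP[_ c2] := c 0; move: x1; rewrite xiE mxE mulrC ltr_pdivlMr // mul1r.
  by have := hi_lta' => *; lra.
Qed.

(** ** The invariant measure *)

Definition place (s : V) : V := chart (unit_coord s).

Definition place_mx : 'M[R]_d := (hi - lo) *: E.

Lemma chart_scale_unit (t : R) s :
  chart (t *: unit_coord s) = s *m (t *: place_mx) + chart (t *: const_mx lo).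
Proof.
have -> : unit_coord s = const_mx lo + (hi - lo) *: s by apply/rowP => i; rewrite !mxE.
rewrite /chart /place_mx scalerDr mulmxDl [RHS]addrC [LHS]addrA.
by congr (_ + _); rewrite -!scalemxAl -!scalemxAr.
Qed.

Lemma place_affine s : place s = s *m place_mx + chart (const_mx lo).
Proof. by have := chart_scale_unit 1 s; rewrite !scale1r. Qed.

Lemma place_mx_unit (t : R) : 0 < t -> t *: place_mx \in unitmx.
Proof.
move=> t0; rewrite /place_mx scalerA unitmxZ ?scaled_frame_unit // unitfE.
by rewrite mulf_neq0 // gt_eqF.
Qed.

Lemma loop_domainP (s : V) : loop_domain b s ->
  (forall i, 0 <= s 0 i <= 1) /\ s 0 0 != b.
Proof.
move=> D; split=> [i|].
  by have [] := D i => /=; rewrite in_itv /= => /andP[s0 ->] _; rewrite ltW.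
by have [_] := D 0; rewrite eqxx => sb; apply/eqP.
Qed.

Lemma place_box s : loop_domain b s -> box_union (place s) /\ box_union (H (place s)).
Proof.
move=> /loop_domainP[s01 sb]; have c := cube_unit_coord s01.
have U1 : box_union (place s).
  by apply/box_unionP; exists (unit_coord s); split => //; exact: Or31.
split => //; apply: box_union_image => //.
have [_ -> _ _ _] := chart_region (tame_cube c).
apply: contraNneq sb => h; rewrite -subr_eq0.
have /eqP : unit_coord s 0 0 - 1 = 0 by lra.
by rewrite unit_coord_sub1 mulf_eq0 gt_eqF.
Qed.

(** Away from a null set the image of the reference measure by [H \o place] is
    made of two pieces, each of them affine. *)
Lemma H_place_cases s : loop_domain b s ->
  H (place s) = chart (a *: unit_coord s) \/
  H (place s) = place s *m linear_part + translation_part.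
Proof.
move=> /loop_domainP[s01 sb]; have c := cube_unit_coord s01.
have [h|h|h] := ltgtP (s 0 0) b; last by rewrite h eqxx in sb.
  by left; case: (H_cube_low c (etrans (unit_coord_lt1 s 0) h)).
right; rewrite chart_turn.
by case: (H_cube_high c (etrans (unit_coord_gt1 s 0) h)).
Qed.

Lemma H_measurable : measurable_fun setT (H : borel R d -> borel R d).
Proof. exact: glued_map_measurable. Qed.

(** The third property is absolute continuity together with that of the images
    under invertible affine maps, among which is [sigma]. *)
Lemma measure_exists : exists mu : probability (borel R d) R,
  [/\ mu Sd = 1%E, mu box_union = 1%E,
    forall (M : 'M[R]_d) (c : V) (B : set (borel R d)), M \in unitmx ->
      measurable B -> lebesgue B = 0%E ->
      mu ((fun x : V => x *m M + c) @^-1` B) = 0%E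
  & forall B : set (borel R d), measurable B -> mu (Sd `&` (H @^-1` B)) = mu B].
Proof.
have [P [bP PD PT]] := @loop_measure R n.+2 b slope_inv_bounds.
have mD := @loop_domain_measurable R n.+2 b.
have mplace : measurable_fun setT (place : borel R d -> borel R d).
  rewrite (_ : place = fun s => s *m place_mx + chart (const_mx lo)).
    exact: affine_measurable.
  by apply/funext => s; exact: place_affine.
pose f : {mfun borel R d >-> borel R d} :=
  @mfun_Sub _ _ (borel R d) (borel R d) _ (mem_set mplace).
(* [P0] is carried by the cube of the chart and is preserved by two steps. *)
pose P0 : probability (borel R d) R := distribution P f.
have P0E B : P0 B = P (place @^-1` B) by [].
have pre (h : V -> V) : measurable_fun setT (h : borel R d -> borel R d) ->
    forall B : set (borel R d), measurable B -> measurable (h @^-1` B : set (borel R d)).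
  by move=> mh B mB; rewrite -[X in measurable X]setTI; exact: mh.
have mp := pre _ mplace; have mH := pre _ H_measurable.
have mS : measurable (Sd : set (borel R d)) := borel_open_measurable open_Sd.
have mU : measurable (box_union : set (borel R d)).
  rewrite -[box_union]setCK; apply: measurableC.
  exact: (borel_open_measurable (closed_openC box_union_closed)).
have full (B : set (borel R d)) : measurable B -> box_union `<=` B ->
    P0 B = 1%E /\ P0 (H @^-1` B) = 1%E.
  move=> mB UB; split; rewrite P0E; apply: (full_measure_sub mD) PD _.
  - exact: mp.
  - by move=> s /place_box[/UB].
  - exact: mp (mH _ mB).
  - by move=> s /place_box[_ /UB].
have [P0S P0HS] := full _ mS box_union_Sd.
have [P0U P0HU] := full _ mU (@subset_refl _ _).
have [|mu [muE muI]] := invariant_average H_measurable mS P0S P0HS.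
  move=> B mB; rewrite !P0E -[RHS]PT; last exact: mp.
  apply: (full_measure_eq mD) PD _.
  - exact: mp (mH _ (mH _ mB)).
  - exact: pre (loop_map_measurable b) _ (mp _ mB).
  apply/seteqP; split => s [/= Bs Ds]; split => //=; move: Bs;
    by have [s01 sb] := loop_domainP Ds; rewrite /place /= H2_loop.
have avg1 : ((1 / 2)%:E * 1 + (1 / 2)%:E * 1 = 1 :> \bar R)%E.
  by rewrite !mule1 -EFinD; congr EFin; lra.
exists mu; split => //; [by rewrite muE P0S P0HS|by rewrite muE P0U P0HU|].
move=> M c B uM mB B0; rewrite muE.
have null (N : 'M[R]_d) (c' : V) : N \in unitmx ->
    P ((fun x : V => x *m N + c') @^-1` B) = 0%E.
  by move=> uN; exact: affine_law_null.
have mM := @affine_measurable R d M c.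
have h1 : P0 ((fun x : V => x *m M + c) @^-1` B) = 0%E.
  rewrite P0E; have {1}-> : place @^-1` ((fun x : V => x *m M + c) @^-1` B) =
      (fun x : V => x *m (place_mx *m M) + (chart (const_mx lo) *m M + c)) @^-1` B.
    by apply/funext => s /=; rewrite /preimage /= place_affine mulmxDl mulmxA addrA.
  by apply: null; rewrite unitmx_mul uM -[place_mx]scale1r place_mx_unit.
have h2 : P0 (H @^-1` ((fun x : V => x *m M + c) @^-1` B)) = 0%E.
  rewrite P0E.
  pose B1 := (fun x : V => x *m (a *: place_mx *m M) + (chart (a *: const_mx lo) *m M + c)) @^-1` B.
  pose B2 := (fun x : V => x *m (place_mx *m linear_part *m M) +
    ((chart (const_mx lo) *m linear_part + translation_part) *m M + c)) @^-1` B.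
  have m1 : measurable (B1 : set (borel R d)) by exact: pre (affine_measurable _ _) _ mB.
  have m2 : measurable (B2 : set (borel R d)) by exact: pre (affine_measurable _ _) _ mB.
  rewrite -(full_measureI mD) //; last exact: mp (mH _ (pre _ mM _ mB)).
  apply: (@subset_measure0 _ _ _ P _ (B1 `|` B2)).
  - by apply: measurableI => //; exact: mp (mH _ (pre _ mM _ mB)).
  - exact: measurableU.
  - move=> s [/= Bs /H_place_cases[e|e]]; rewrite e in Bs; [left|right].
      by rewrite /B1 /= mulmxA addrA -mulmxDl -chart_scale_unit.
    move: Bs; rewrite /B2 /= place_affine.
    by move: linear_part place_mx => L N; rewrite !mulmxDl !mulmxA !addrA.
  - apply: (etrans (@measureU0 _ _ _ P _ _ m1 m2 _)); apply: null.
      rewrite unitmx_mul uM andbT unitmx_mul linear_part_unit andbT.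
      by rewrite -[place_mx]scale1r place_mx_unit.
    by rewrite unitmx_mul uM place_mx_unit.
by rewrite h1 h2 mule0 adde0.
Qed.

Lemma sigma_continuous : continuous (sigma : V -> V).
Proof.
rewrite (_ : sigma = fun x : V => x *m sigma_mx + sigma_cst).
  exact: affine_continuous.
by apply/funext => x; exact: sigma_affine.
Qed.

Lemma sigma_image (U : set V) : sigma @` U = sigma @^-1` U.
Proof.
apply/seteqP; split => [_ [x Ux <-]|x Ux] /=; first by rewrite sigmaK.
by exists (sigma x); rewrite ?sigmaK.
Qed.

Lemma box_union_sigma_closure :
  sigma @` box_union `<=` closure (Aset (d - 1) `|` Bset (d - 1)).
Proof.
move=> _ [x /box_union_closure cx <-] B nB.
have [y [ABy By]] := cx _ (sigma_continuous nB).
exists (sigma y); split => //; case: ABy => [Ay|By1]; [left|right].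
  by apply/Aset_sigma; rewrite ?leq_subr // subKn.
by have := Bset_sigma By1; rewrite subn1.
Qed.

Lemma fixed_point_unique q :
  q *m linear_part + translation_part = q <-> q = chart fixed_coord.
Proof.
have [xi <-] := chart_surj q; rewrite chart_turn; split => [/chart_inj h|/chart_inj ->].
  by congr chart; exact: turn_fixed_unique h turn_fixed.
by rewrite turn_fixed.
Qed.

Lemma frame_system : asymmetric_acim a 1 H.
Proof.
have [mu [muS muU null inv]] := measure_exists.
have mH := H_measurable.
have mS : measurable (Sd : set (borel R d)) := borel_open_measurable open_Sd.
have closed_measurable (F : set V) : closed F -> measurable (F : set (borel R d)).
  by move=> cF; rewrite -[F]setCK; apply: measurableC;
    exact: (borel_open_measurable (closed_openC cF)).
have cU := box_union_closed; have mU := closed_measurable _ cU.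
have csU : closed (sigma @` box_union).
  by rewrite sigma_image; have /continuous_closedP := sigma_continuous; apply.
have acim : is_acim H mu.
  split => //; first exact: measurable_funTS.
  move=> N leb0 B mB BN.
  have -> : B = (fun x : V => x *m 1%:M + 0) @^-1` B.
    by apply/seteqP; split => x /=; rewrite mulmx1 addr0.
  by apply: null (leb0 _ mB BN) => //; exact: unitmx1.
pose f : {mfun borel R d >-> borel R d} :=
  @mfun_Sub _ _ (borel R d) (borel R d) _ (mem_set sigma_measurable).
pose nu : probability (borel R d) R := distribution mu f.
have nuE B : nu B = mu (sigma @^-1` B) by [].
have SS : sigma @^-1` Sd = Sd :> set V by apply/seteqP; split => x /= /Sd_sigma.
have acim' : is_acim H nu.
  split; first exact: measurable_funTS.
  - by rewrite nuE SS.
  - move=> N leb0 B mB BN; rewrite nuE.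
    rewrite (_ : sigma = fun x : V => x *m sigma_mx + sigma_cst); last first.
      by apply/funext => x; exact: sigma_affine.
    by apply: null (leb0 _ mB BN) => //; exact: sigma_mx_unit.
  - move=> B mB; rewrite !nuE preimage_setI SS -[RHS]inv; last first.
      by rewrite -[X in measurable X]setTI; exact: sigma_measurable.
    by congr (mu (_ `&` _)); apply/seteqP; split => x /=; rewrite glued_map_sigma.
have smu : msupport mu `<=` box_union by exact: msupport_sub.
have snu : msupport nu `<=` sigma @` box_union.
  apply: msupport_sub => //; first exact: closed_measurable.
  rewrite nuE sigma_image [X in mu X](_ : _ = box_union) //.
  by apply/seteqP; split => x /=; rewrite sigmaK.
exists mu; split => //; split; first exact: subset_trans smu box_union_closure.
split.
  exists nu; split => //; first exact: subset_trans snu box_union_sigma_closure.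
  apply/seteqP; split => // x [/smu Ux /snu sUx].
  by have [_ <-] := box_union_AsIUP.
exists box_union; split => //; [exact: box_union_AsIUP|exact: box_union_closure|].
exists linear_part, translation_part; split.
- exact: H_affine_on_B.
- exists (chart fixed_coord); split; [exact: fixed_point_B|exact: fixed_point_unique].
- exists [tuple row i frame_mx | i < d]; split; first exact: frame_basis.
  move=> i; rewrite !tnth_mktuple !frame_row_norm mulfK ?frame_row_linear //.
  by have := r_bounds => /andP[/gt_eqF ->].
Qed.

End FrameDynamics.

(** * The theorem *)

(** Bernoulli's inequality for 1 / ad = 1 - s. *)
Lemma power_bound (R : realType) (d : nat) : (0 < d)%N ->
  exists2 ad : R, 1 < ad < 2 &
    forall a : R, 1 < a < ad -> (a ^+ d) ^+ 2 <= 1 + (80 * d%:R)^-1.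
Proof.
move=> d0; have D1 : 1 <= d%:R :> R by rewrite ler1n.
pose K : R := 80 * d%:R; have K80 : 80 <= K by rewrite /K; lra.
pose s : R := (2 * d%:R * (K + 1))^-1.
have den : 160 <= 2 * d%:R * (K + 1) by nra.
have s0 : 0 < s by rewrite invr_gt0; lra.
have s1 : s <= 160^-1 by rewrite lef_pV2 ?posrE //; lra.
exists (1 - s)^-1.
  apply/andP; split; first by rewrite invf_gt1; lra.
  by rewrite -[2]invrK ltf_pV2 ?posrE; lra.
move=> a /andP[a1 aad]; rewrite -exprM.
have ad1 : a * (1 - s) <= 1.
  by move: aad; rewrite -[(1 - s)^-1]mul1r ltr_pdivlMr; [move/ltW|lra].
have bern : forall m, 1 - m%:R * s <= (1 - s) ^+ m.
  elim=> [|m IH]; first by rewrite expr0 mul0r subr0.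
  rewrite exprS; apply: le_trans (_ : (1 - s) * (1 - m%:R * s) <= _); last first.
    by rewrite ler_pM2l //; lra.
  have m0 : 0 <= m%:R :> R by []; rewrite -natr1.
  have : 0 <= m%:R * s ^+ 2 by rewrite mulr_ge0 // sqr_ge0.
  by rewrite expr2 => h; lra.
have := bern (d * 2)%N.
have -> : (d * 2)%:R * s = (K + 1)^-1.
  rewrite natrM /s; field; apply/andP; split; lra.
move=> bd.
have prod1 : a ^+ (d * 2) * (1 - s) ^+ (d * 2) <= 1.
  by rewrite -exprMn exprn_ile1 // mulr_ge0 //; lra.
have K1 : 1 - (K + 1)^-1 = (1 + K^-1)^-1 by field; apply/andP; split; lra.
rewrite -/K -[leRHS]invrK -[leRHS]mul1r ler_pdivlMr -?K1; last first.
  by rewrite K1 invr_gt0 addr_gt0 // invr_gt0; lra.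
apply: le_trans prod1; rewrite ler_wpM2l // exprn_ge0 //; lra.
Qed.

Theorem theorem4p1 (R : realType) (d : nat) (hd : (3 <= d)%N) :
  exists (ad : R) (k : nat) (H : R -> 'rV[R]_d -> 'rV[R]_d),
    1 < ad < 2 /\ (k <= (uphalf d).-1)%N /\
    forall a : R, 1 < a < ad ->
      (forall x, Sd x -> Sd (H a x)) /\
      piecewise_smooth (H a) /\
      (forall x, Sd x -> H a (sigma x) = sigma (H a x)) /\
      (forall (j : nat) (x : 'rV[R]_d), (j <= d)%N -> Aset j x ->
         G_graph (1 - a / 2) x (H a x)) /\
      exists mu : probability (borel R d) R,
        is_acim (H a) mu /\
        msupport mu `<=` closure (Aset k `|` Bset k) /\
        (exists nu : probability (borel R d) R,
           [/\ is_acim (H a) nu,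
               msupport nu `<=` closure (Aset (d - k) `|` Bset (d - k))
             & msupport mu `&` msupport nu = set0]) /\
        exists U : set 'rV[R]_d,
          [/\ AsIUP (H a) U, U `<=` closure (Aset k `|` Bset k),
              msupport mu `<=` U
            & exists (L : 'M[R]_d) (b : 'rV[R]_d),
                [/\ forall x, U x -> Bset k x -> H a x = x *m L + b,
                    exists p : 'rV[R]_d, Bset k p /\
                      (forall q : 'rV[R]_d, q *m L + b = q <-> q = p)
                  & exists e : d.-tuple 'rV[R]_d,
                      basis_of fullv e /\
                      forall n : 'I_d,
                        tnth e n *m L =
                        (a * enorm (tnth e n) / enorm (tnth e (ordS n)))
                          *: tnth e (ordS n)]].
Proof.
case: d hd => [|[|[|n]]] // _.
have [ad ad12 small] := @power_bound R n.+3 isT.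
have ex (a : R) : exists Lt : 'M[R]_n.+3 * 'rV[R]_n.+3, 1 < a < ad ->
    Lt.1 \in unitmx /\ asymmetric_acim a 1 (glued_map a Lt.1 Lt.2).
  have [h|] := boolP (1 < a < ad); last by exists (0, 0).
  have As := small _ h; have /andP[a1 _] := h.
  have [gamma [tau [r [g [h1 h2 h3 h4 [h5 h6 h7]]]]]] := frame_constants a1 As.
  exists (linear_part a gamma tau g, translation_part a gamma tau g) => _; split.
    exact: (linear_part_unit a1 gamma h1 h2 h5).
  exact: (frame_system a1 As h1 h2 h3 h4 h5 h6 h7).
have [Lt LtP] := choice ex.
exists ad, 1%N, (fun a => glued_map a (Lt a).1 (Lt a).2); split => //; split => // a h.
have [uL aP] := LtP a h.
have a12 : 1 < a < 2.
  by have /andP[_ h1] := ad12; have /andP[-> /lt_trans ->] := h.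
split; first exact: glued_map_Sd.
split; first by eexists; eexists; exact: glued_map_atomic.
split; first by move=> x _; exact: glued_map_sigma.
split; last exact: aP.
move=> j x jd Ax; rewrite glued_map_A; last by exists j.
exact: G_graph_vertex_dilation Ax.
Qed.
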